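(* Let $\beta\ge 0$, $B,\rho>0$ and $d\in\mathbb{N}$ with $d\ge 2$. Let $\mathcal{F}$ be a set of functions $\gamma:[0,1]^{d-1}\to\mathbb{R}$ such that the following holds: there exist $\epsilon_0,C_1,C_2>0$ and $C_3,C_4\in\mathbb{N}$ such that for any $\gamma\in\mathcal{F}$ and any $\epsilon\in(0,\epsilon_0)$ there is a ReLU neural network $\Phi$ (input dimension $d-1$, output dimension $1$) with $L\le L_0(\epsilon):=C_1\lceil\log(\epsilon^{-1})\rceil$ layers, sparsity $s\le s_0(\epsilon):=C_2\epsilon^{-\rho}\log(\epsilon^{-1})$ and weights in $\mathcal{W}_c$ with $c=c_0(\epsilon):=C_3+C_4\lceil\log(\epsilon^{-1})\rceil$ such that $\|R(\Phi)-\gamma\|_\infty\le\epsilon$. Define $\kappa:=1+\beta$ and let $\mathfrak{Q}$ be a class of probability distributions $\mathbb{Q}$ of $(X,Y)$ on $[0,1]^d\times\{0,1\}$ such that: (a) There is a constant $M>1$ such that for all $\mathbb{Q}\in\mathfrak{Q}$ the marginal distribution $\mathbb{Q}_X$ has a Lebesgue density bounded by $M$. (b) There are constants $r\in\mathbb{N}$ and $\epsilon_1,\epsilon_2>0$ such that for all $\mathbb{Q}\in\mathfrak{Q}$ the Bayes rule satisfies $G^*_{\mathbb{Q}}\in\mathcal{K}^{\mathcal{F}}_{\mathbb{Q},\beta,B,\epsilon_1,\epsilon_2,r,d}$. (c) There is a constant $c_1>0$ such that $d_{f_{\mathbb{Q}}}(G,G^*_{\mathbb{Q}})\ge c_1 d_\Delta^{\kappa}(G,G^*_{\mathbb{Q}})$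 for all $G\in\mathcal{N}:=\bigcup_{n\in\mathbb{N}}\mathcal{N}_{n,n,n}$ and all $\mathbb{Q}\in\mathfrak{Q}$. Let $$\tau_n:=\frac{n^{\frac{1}{2\kappa+\rho-1}}}{\log^{\frac{2}{\rho}}(n)}.$$ Then there exist constants $C_1',C_2'>0$ and $C_3'\in\mathbb{N}$ such that for all $p\ge 1$ $$\limsup_{n\to\infty}\ \sup_{\mathbb{Q}\in\mathfrak{Q}}\ \tau_n^{p\kappa}\,\mathbb{E}\big[d^p_{f_{\mathbb{Q}}}(\hat G_n,G^*_{\mathbb{Q}})\big]<\infty,\qquad \limsup_{n\to\infty}\ \sup_{\mathbb{Q}\in\mathfrak{Q}}\ \tau_n^{p}\,\mathbb{E}\big[d^p_{\Delta}(\hat G_n,G^*_{\mathbb{Q}})\big]<\infty,$$ where $\hat G_n:=\arg\min_{G\in\mathcal{N}_n}R_n(G)$ with $\mathcal{N}_n=\mathcal{N}_{C_1'L_0(\tau_n^{-1}),\,C_2's_0(\tau_n^{-1}),\,C_3'c_0(\tau_n^{-1})}$.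
   Context: **Classification setup.** $(X_i,Y_i)_{i=1}^n$ are i.i.d. with distribution $\mathbb{Q}$ on $\mathbb{R}^d\times\{0,1\}$ (here supported on $[0,1]^d\times\{0,1\}$); $\mathbb{E}$ is expectation under this sampling. $\mathbb{Q}_X$ is the marginal of $X$, $f_{\mathbb{Q}}(x):=\mathbb{Q}(Y=1\mid X=x)$ (a fixed version), and the Bayes rule is $G^*_{\mathbb{Q}}:=\{x : f_{\mathbb{Q}}(x)\ge \tfrac12\}$. For measurable sets $G_1,G_2$, $d_{f_{\mathbb{Q}}}(G_1,G_2):=\int_{G_1\Delta G_2}|2f_{\mathbb{Q}}(x)-1|\,\mathbb{Q}_X(\mathrm{d}x)$ and $d_\Delta(G_1,G_2):=\mathbb{Q}_X(G_1\Delta G_2)$; powers are $d^p(\cdot,\cdot)=(d(\cdot,\cdot))^p$. The empirical risk is $R_n(G):=\frac1n\sum_{i=1}^n \mathbf{1}\big(Y_i\ne \mathbf{1}(X_i\in G)\big)$; $\arg\min$ denotes a minimizer over the finite class. **Neural networks.** A ReLU network with $L$ (hidden) layers and dimensions $m_0,\dots,m_{L+1}$ is a sequence $\Phi=(W_1,b_1,\dots,W_L,b_L,W_{L+1})$ with $W_s\in\mathbb{R}^{m_s\times m_{s-1}}$, $b_s\in\mathbb{R}^{m_s}$. Its realization is $R(\Phi)(x)=W_{L+1}\sigma_{b_L}W_L\cdots W_2\sigma_{b_1}W_1x$, where $\sigma_b(y)=(\sigma(y_1-b_1),\dots,\sigma(y_k-b_k))$ and $\sigma(t)=\max\{t,0\}$;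 for $L=0$, $R(\Phi)(x)=W_1x$. The domain is $[0,1]^{m_0}$. The weights of $\Phi$ are all entries of the $W_s$ and $b_s$; the sparsity is the number of nonzero weights. For $c\in\mathbb{N}$, $\mathcal{W}_c:=\{k2^{-c} : k\in\{-2^c,-2^c+1,\dots,2^c\}\}$. $\mathcal{N}_{L_0,s_0,c}$ is the collection of all sets $\{x\in[0,1]^d : R(\Phi)(x)=1\}$ where $\Phi$ is a ReLU network with input dimension $d$, output dimension $1$, at most $L_0$ layers, sparsity at most $s_0$, and all weights in $\mathcal{W}_c$ (hidden dimensions arbitrary; $L_0$, $s_0$ may be real numbers). **Hölder classes.** For $\beta>0$ let $m$ be the largest integer $k\ge0$ with $k<\beta$ and $\omega:=\beta-m$. For continuous $f:[0,1]^s\to\mathbb{R}$, $\|f\|_{\mathcal{C}^\beta}:=\sum_{|\alpha|\le m}\|\partial^\alpha f\|_\infty+\sum_{|\alpha|=m}\sup_{x\ne y}\frac{|\partial^\alpha f(x)-\partial^\alpha f(y)|}{\|x-y\|_\infty^\omega}$, and $\mathcal{F}_{\beta,B,s}:=\{f : \|f\|_{\mathcal{C}^\beta}\le B\}$. For $\beta>0$, $\mathcal{H}_{\beta,B}:=\{g\in\mathcal{F}_{\beta,B,1} : \partial^\alpha g(0)=0 \text{ for all integers } 0\le\alpha<\beta\}$. **The class $\mathcal{K}^{\mathcal{F}}_{\mathbb{Q},\beta,B,\epsilon_1,\epsilon_2,r,d}$.** For $x\in\mathbb{R}^d$, $x_{-j}$ denotes $x$ with the $j$-th coordinate removed; $\lambda$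 is Lebesgue measure. Given $\beta\ge0$, $B>0$, $d\ge2$, $r\in\mathbb{N}$, $\epsilon_1,\epsilon_2>0$, a probability measure $\mathbb{Q}$ on $[0,1]^d\times\{0,1\}$, and a class $\mathcal{F}$ of functions $[0,1]^{d-1}\to\mathbb{R}$, it is the class of all $H=H_1\cup\dots\cup H_u\subseteq[0,1]^d$ with $u\in\{0,\dots,r\}$ such that for $\nu=1,\dots,u$ there exist $(j_\nu,\iota_\nu)\in\{1,\dots,d\}\times\{-1,1\}$, $\gamma_\nu\in\mathcal{F}$ and $D_\nu=\prod_{i=1}^d[a_i^\nu,b_i^\nu]$ with $0\le a_i^\nu<b_i^\nu\le1$ satisfying: 1. $H_\nu=D_\nu\cap\{x\in[0,1]^d : \iota_\nu x_{j_\nu}\le\gamma_\nu(x_{-j_\nu})\}$ for all $\nu$. 2. $\lambda(D_{\nu_1}\cap D_{\nu_2})=0$ for $\nu_1\ne\nu_2$. 3. If $\beta>0$: for every $\nu$ and every $x\in D_\nu\cap\partial H$ (with $\partial H$ the topological boundary of $H$ as a subset of $[0,1]^d$) there is $g_{\nu,x}\in\mathcal{H}_{\beta,B}$ such that for all $y_{j_\nu}\in[\max\{0,x_{j_\nu}-\epsilon_1\},\min\{1,x_{j_\nu}+\epsilon_1\}]$, with $y=(x_1,\dots,x_{j_\nu-1},y_{j_\nu},x_{j_\nu+1},\dots,x_d)$, one has $|2f_{\mathbb{Q}}(y)-1|\le g_{\nu,x}(|y_{j_\nu}-x_{j_\nu}|)$. 4. $b^\nu_{j_\nu}-a^\nu_{j_\nu}\ge\epsilon_2$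 for all $\nu$. *)

(* Defs.v *)
From HB Require Import structures.
From mathcomp Require Import all_boot all_order all_algebra.
From mathcomp Require Import all_classical all_reals all_analysis.

Set Implicit Arguments.
Unset Strict Implicit.
Unset Printing Implicit Defensive.
Import Order.TTheory GRing.Theory Num.Theory.
Import numFieldNormedType.Exports.
Local Open Scope classical_set_scope.
Local Open Scope ring_scope.

Definition tcons (T : Type) n (z : T * n.-tuple T) : n.+1.-tuple T :=
  [tuple of z.1 :: z.2].

Lemma measurable_tcons d (T : measurableType d) n :
  measurable_fun [set: T * n.-tuple T] (@tcons T n).
Proof. exact: measurable_cons. Qed.

Section power_measure.
Context d (T : measurableType d) (R : realType).
Variable mu : {sigma_finite_measure set T -> \bar R}.
Local Open Scope ereal_scope.

Section step.
Variables (n : nat) (nu : {sigma_finite_measure set (n.-tuple T) -> \bar R}).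

Definition cons_measure : set (n.+1.-tuple T) -> \bar R :=
  pushforward (mu \x nu) (@tcons T n).

Let mpre A : measurable A -> measurable (@tcons T n @^-1` A).
Proof. by move=> mA; rewrite -[X in measurable X]setTI; exact: measurable_tcons. Qed.

Let cons_measure0 : cons_measure set0 = 0.
Proof. by rewrite /cons_measure /pushforward preimage_set0 measure0. Qed.

Let cons_measure_ge0 A : 0 <= cons_measure A.
Proof. by rewrite /cons_measure /pushforward; exact: measure_ge0. Qed.

Let cons_measure_sigma_additive : semi_sigma_additive cons_measure.
Proof.
move=> F mF tF mUF; rewrite /cons_measure /pushforward preimage_bigcup.
apply: measure_semi_sigma_additive => [k||].
- exact: mpre.
- apply/trivIsetP => /= i j _ _ ij; rewrite -preimage_setI.
  by move/trivIsetP : tF => /(_ _ _ _ _ ij) ->//; rewrite preimage_set0.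
- by rewrite -preimage_bigcup; exact: mpre.
Qed.

HB.instance Definition _ := isMeasure.Build _ _ _ cons_measure
  cons_measure0 cons_measure_ge0 cons_measure_sigma_additive.

Let cons_measure_sigma_finite : sigma_finite setT cons_measure.
Proof.
have /sigma_finiteP[F [TF ndF Foo]] := sigma_finiteT mu.
have /sigma_finiteP[G [TG ndG Goo]] := sigma_finiteT nu.
pose uncons (t : n.+1.-tuple T) := (thead t, [tuple of behead t]).
have consK : cancel (@tcons T n) uncons.
  by move=> [x t]; rewrite /uncons /tcons/= theadE; congr pair; exact/val_inj.
have muncons : measurable_fun setT uncons.
  by apply: measurable_fun_pair; [exact: measurable_tnth|exact: measurable_behead].
exists (fun k => uncons @^-1` (F k `*` G k)).
  rewrite -preimage_bigcup [X in _ @^-1` X](_ : _ = setT) ?preimage_setT//.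
  apply/seteqP; split => // -[x y] _.
  have [k _ Fkx] : (\bigcup_k F k) x by rewrite -TF.
  have [l _ Gly] : (\bigcup_k G k) y by rewrite -TG.
  exists (maxn k l) => //; split.
  - by move: x Fkx; exact/subsetPset/ndF/leq_maxl.
  - by move: y Gly; exact/subsetPset/ndG/leq_maxr.
move=> k; have [mF Fk] := Foo k; have [mG Gk] := Goo k; split.
  by rewrite -[X in measurable X]setTI; apply: muncons => //; exact: measurableX.
rewrite /cons_measure /pushforward -comp_preimage.
rewrite (_ : uncons \o _ = id) ?preimage_id; last first.
  by apply/funext => z /=; rewrite consK.
by rewrite product_measure1E// lte_mul_pinfty// ge0_fin_numE.
Qed.

HB.instance Definition _ := Measure_isSigmaFinite.Build _ _ _ cons_measure
  cons_measure_sigma_finite.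

End step.

Fixpoint power_measure (n : nat) :
    {sigma_finite_measure set (n.-tuple T) -> \bar R} :=
  match n with
  | 0 => \d_([tuple] : 0.-tuple T)
  | n'.+1 => cons_measure (power_measure n')
  end.

Lemma power_measure_box n (A : 'I_n -> set T) :
  (forall i, measurable (A i)) ->
  power_measure n [set t | forall i, A i (tnth t i)] = \prod_(i < n) mu (A i).
Proof.
elim: n A => [|n IH] A mA.
  by rewrite big_ord0 /= diracE mem_set// => -[].
rewrite big_ord_recl -IH// /= /cons_measure /pushforward.
rewrite -product_measure1E//; last first.
  rewrite (_ : [set _ | _] = \bigcap_(i in [set: 'I_n])
     ((@tnth n T ^~ i) @^-1` A (lift ord0 i))).
    apply: fin_bigcap_measurable => // i _.
    by rewrite -[X in measurable X]setTI; exact: measurable_tnth.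
  by apply/seteqP; split => [t /= At i _|t /= At i]; exact: At.
congr ((mu \x _) _); apply/seteqP; split => -[x t] /=.
  move=> At; split; first by have := At ord0; rewrite tnth0.
  by move=> i; have := At (lift ord0 i); rewrite tnthS.
move=> [Ax At] i; case: (unliftP ord0 i) => [j|] ->.
  by rewrite tnthS; exact: At.
by rewrite tnth0.
Qed.

End power_measure.

(* Points of R^d are tuples, which carry the product sigma-algebra in the
   library; [to_col] moves to the column vectors, which carry the topology and
   the matrix product. *)
Notation euclid R d := (d.-tuple (measurableTypeR R)).

Section euclidean.
Variables (R : realType) (d : nat).

Definition xcoord (x : euclid R d) (i : 'I_d) : R := tnth x i.

Definition to_col (x : euclid R d) : 'cV[R]_d := \col_i xcoord x i.

Definition lebesgue_tuple : {sigma_finite_measure set (euclid R d) -> \bar R} :=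
  power_measure (@lebesgue_measure R) d.

Definition box (a b : 'I_d -> R) : set (euclid R d) :=
  [set x | forall i, a i <= xcoord x i <= b i].

Definition unit_cube : set (euclid R d) := box (fun=> 0) (fun=> 1).

(* Boundary of H in the subspace [0,1]^d; the cube being closed, closures
   relative to the cube are traces of closures in R^d. *)
Definition cube_boundary (H : set (euclid R d)) : set (euclid R d) :=
  [set x | unit_cube x /\
    (closure (to_col @` (unit_cube `&` H)) `&`
     closure (to_col @` (unit_cube `\` H))) (to_col x)].

Definition remove_coord (j : 'I_d) (x : euclid R d) : euclid R d.-1 :=
  [tuple tnth x (lift j i) | i < d.-1].

Definition replace_coord (j : 'I_d) (t : R) (x : euclid R d) : euclid R d :=
  [tuple (if i == j then t else xcoord x i) : measurableTypeR R | i < d].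

End euclidean.
Arguments unit_cube {R d}.

Section relu_networks.
Variable R : realType.

(* [relu_net k m]: networks with input dimension m and output dimension k. *)
Inductive relu_net (k : nat) : nat -> Type :=
| OutputLayer m of 'M[R]_(k, m) : relu_net k m
| HiddenLayer m h of 'M[R]_(h, m) & 'cV[R]_h & relu_net k h : relu_net k m.

Fixpoint realization k m (Phi : relu_net k m) : 'cV[R]_m -> 'cV[R]_k :=
  match Phi with
  | OutputLayer _ W => fun x => W *m x
  | HiddenLayer _ _ W b Phi' => fun x =>
      realization Phi' (map_mx (fun t => Num.max t 0) (W *m x - b))
  end.

Fixpoint layers k m (Phi : relu_net k m) : nat :=
  match Phi with
  | OutputLayer _ _ => 0
  | HiddenLayer _ _ _ _ Phi' => (layers Phi').+1
  end.

Definition entries p q (W : 'M[R]_(p, q)) : seq R :=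
  [seq W i j | i <- enum 'I_p, j <- enum 'I_q].

Fixpoint weights k m (Phi : relu_net k m) : seq R :=
  match Phi with
  | OutputLayer _ W => entries W
  | HiddenLayer _ _ W b Phi' => entries W ++ entries b ++ weights Phi'
  end.

Definition sparsity k m (Phi : relu_net k m) : nat :=
  count (fun w => w != 0) (weights Phi).

Definition weight_grid (c : nat) : set R :=
  [set w | exists k : int, - (2 ^+ c) <= k <= 2 ^+ c /\ w = k%:~R / 2 ^+ c].

Definition bounded_net k m (L0 s0 : R) (c : nat) (Phi : relu_net k m) : Prop :=
  [/\ (layers Phi)%:R <= L0, (sparsity Phi)%:R <= s0
    & forall w, w \in weights Phi -> weight_grid c w].

Definition net_fun d (Phi : relu_net 1 d) (x : euclid R d) : R :=
  realization Phi (to_col x) 0 0.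

Definition net_regions d (L0 s0 : R) (c : nat) : set (set (euclid R d)) :=
  [set G | exists2 Phi : relu_net 1 d, bounded_net L0 s0 c Phi &
           G = [set x | unit_cube x /\ net_fun Phi x = 1]].

Definition all_net_regions d : set (set (euclid R d)) :=
  \bigcup_n @net_regions d n%:R n%:R n.

Definition net_layers (C1 eps : R) : R := C1 * (Num.ceil (ln eps^-1))%:~R.

Definition net_sparsity (C2 rho eps : R) : R :=
  C2 * eps `^ (- rho) * ln eps^-1.

(* The absolute value only matters when the ceiling is negative; the bound
   [net_layers] on the number of layers is then negative as well, so that no
   network satisfies it. *)
Definition net_precision (C3 C4 : nat) (eps : R) : nat :=
  (C3 + C4 * `|Num.ceil (ln eps^-1)|)%N.

End relu_networks.
Arguments net_regions {R} d L0 s0 c.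
Arguments all_net_regions {R} d.

Section hoelder.
Variable R : realType.
Implicit Types (beta B : R) (g : R -> R).

(* The largest natural number smaller than beta, see [lt_hoelder_order]. *)
Definition hoelder_order beta : nat := (`|Num.ceil beta|%N).-1.

Lemma lt_hoelder_order beta (k : nat) : 0 < beta ->
  (k%:R < beta) = (k <= hoelder_order beta)%N.
Proof.
rewrite -ceil_gt0 /hoelder_order -[k%:R]/((k%:Z)%:~R) -ceil_gt_int.
by case: (Num.ceil beta) => // -[].
Qed.

(* Derivatives on [0,1], one-sided at the endpoints. *)
Definition unit_quotient g (x y : R) : R := (g y - g x) / (y - x).

Definition unit_derivable g (x : R) : Prop :=
  cvg (unit_quotient g x @ within `[0, 1] x^').

Definition unit_derive g (x : R) : R :=
  lim (unit_quotient g x @ within `[0, 1] x^').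

Definition unit_derive_n (k : nat) g : R -> R := iter k unit_derive g.

Definition hoelder_norm beta g : \bar R :=
  let m := hoelder_order beta in
  ((\sum_(k < m.+1)
      ereal_sup [set `|unit_derive_n k g x|%:E | x in `[0%R, 1%R]]) +
   ereal_sup [set (`|unit_derive_n m g z.1 - unit_derive_n m g z.2| /
                   `|z.1 - z.2| `^ (beta - m%:R))%:E
             | z in [set z : R * R | [/\ z.1 \in `[0%R, 1%R], z.2 \in `[0%R, 1%R]
                                       & z.1 != z.2]]])%E.

Definition hoelder_class beta B : set (R -> R) :=
  [set g | [/\ {within `[0 : R, 1], continuous g},
      forall k x, (k < hoelder_order beta)%N -> x \in `[0, 1] ->
        unit_derivable (unit_derive_n k g) x
    & (hoelder_norm beta g <= B%:E)%E]].

Definition hoelder0_class beta B : set (R -> R) :=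
  [set g | hoelder_class beta B g /\
     forall k : nat, k%:R < beta -> unit_derive_n k g 0 = 0].

End hoelder.

Notation sample R d := (euclid R d * bool)%type.

Section marginal.
Variables (R : realType) (d : nat) (Q : probability (sample R d) R).
Local Open Scope ereal_scope.

Definition marginal : set (euclid R d) -> \bar R := pushforward Q fst.

Let marginal0 : marginal set0 = 0.
Proof. by rewrite /marginal /pushforward preimage_set0 measure0. Qed.

Let marginal_ge0 A : 0 <= marginal A.
Proof. by rewrite /marginal /pushforward; exact: measure_ge0. Qed.

Let mpre A : measurable A -> measurable (@fst (euclid R d) bool @^-1` A).
Proof. by move=> mA; rewrite -[X in measurable X]setTI; exact: measurable_fst. Qed.

Let marginal_sigma_additive : semi_sigma_additive marginal.
Proof.
move=> F mF tF mUF; rewrite /marginal /pushforward preimage_bigcup.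
apply: measure_semi_sigma_additive => [k||].
- exact: mpre.
- apply/trivIsetP => /= i j _ _ ij; rewrite -preimage_setI.
  by move/trivIsetP : tF => /(_ _ _ _ _ ij) ->//; rewrite preimage_set0.
- by rewrite -preimage_bigcup; exact: mpre.
Qed.

HB.instance Definition _ := isMeasure.Build _ _ _ marginal
  marginal0 marginal_ge0 marginal_sigma_additive.

Let marginal_setT : marginal setT = 1.
Proof. by rewrite /marginal /pushforward preimage_setT probability_setT. Qed.

HB.instance Definition _ := Measure_isProbability.Build _ _ _ marginal
  marginal_setT.

End marginal.

Section classification.
Variables (R : realType) (d : nat).
Implicit Types (Q : probability (sample R d) R) (f : euclid R d -> R).
Implicit Types (G : set (euclid R d)).

(* f is a version of x |-> Q(Y = 1 | X = x). *)
Definition is_regression_fun Q f : Prop :=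
  [/\ measurable_fun setT f, forall x, 0 <= f x <= 1
    & forall A, measurable A ->
        Q (A `*` [set true]) = (\int[marginal Q]_(x in A) (f x)%:E)%E].

Definition has_density_bounded_by Q (M : R) : Prop :=
  exists p : euclid R d -> R,
    [/\ measurable_fun setT p, forall x, 0 <= p x <= M
      & forall A, measurable A ->
          marginal Q A = (\int[lebesgue_tuple R d]_(x in A) (p x)%:E)%E].

Definition bayes_rule f : set (euclid R d) :=
  [set x | unit_cube x /\ 2^-1 <= f x].

Definition excess_risk Q f G1 G2 : \bar R :=
  (\int[marginal Q]_(x in G1 `+` G2) `|2 * f x - 1|%:E)%E.

Definition sym_diff_dist Q G1 G2 : \bar R := marginal Q (G1 `+` G2).

Definition empirical_risk n (z : n.-tuple (sample R d)) G : R :=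
  n%:R^-1 * \sum_(i < n) ((tnth z i).2 != ((tnth z i).1 \in G))%:R.

Definition estimator : Type :=
  forall n : nat, n.-tuple (sample R d) -> set (euclid R d).

(* Ghat n is a minimizer of the empirical risk over N n, chosen measurably with
   respect to the data (N n is a finite class in the application).  Small n are
   left out because N n may then be empty. *)
Definition empirical_risk_minimizer (N : nat -> set (set (euclid R d)))
    (Ghat : estimator) : Prop :=
  \forall n \near \oo,
    (forall z, N n (Ghat n z) /\
       forall G, N n G -> empirical_risk z (Ghat n z) <= empirical_risk z G) /\
    (forall G, measurable [set z | Ghat n z = G]).

Definition expectation_iid Q n (h : n.-tuple (sample R d) -> \bar R) : \bar R :=
  (\int[power_measure Q n]_z h z)%E.

End classification.

Section piecewise_class.
Variables (R : realType) (d : nat).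

Definition piecewise_class (F : set (euclid R d.-1 -> R)) (f : euclid R d -> R)
    (beta B eps1 eps2 : R) (r : nat) : set (set (euclid R d)) :=
  [set H | exists u : nat, (u <= r)%N /\
    exists (j : 'I_u -> 'I_d) (iota : 'I_u -> R)
           (gamma : 'I_u -> euclid R d.-1 -> R) (a b : 'I_u -> 'I_d -> R)
           (Hs : 'I_u -> set (euclid R d)),
      let D nu := box (a nu) (b nu) in
      H = \bigcup_nu Hs nu /\
      (forall nu, iota nu = - 1 \/ iota nu = 1) /\
      (forall nu, F (gamma nu)) /\
      (forall nu i, 0 <= a nu i /\ a nu i < b nu i /\ b nu i <= 1) /\
      (forall nu, Hs nu = D nu `&`
         [set x | unit_cube x /\
                  iota nu * xcoord x (j nu) <= gamma nu (remove_coord (j nu) x)]) /\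
      (forall nu1 nu2, nu1 != nu2 ->
         lebesgue_tuple R d (D nu1 `&` D nu2) = 0%E) /\
      (0 < beta -> forall nu x, (D nu `&` cube_boundary H) x ->
         exists2 g, hoelder0_class beta B g &
           forall t, Num.max 0 (xcoord x (j nu) - eps1) <= t
                       <= Num.min 1 (xcoord x (j nu) + eps1) ->
             `|2 * f (replace_coord (j nu) t x) - 1|
               <= g `|t - xcoord x (j nu)|) /\
      (forall nu, eps2 <= b nu (j nu) - a nu (j nu))].

End piecewise_class.

Definition rate (R : realType) (kappa rho : R) (n : nat) : R :=
  n%:R `^ (2 * kappa + rho - 1)^-1 / ln n%:R `^ (2 / rho).

(* Main.v *)
(** Write [eps = 1 / tau_n] and [kappa = 1 + beta].

    Approximation.  A piece [{iota x_j <= gamma(x_{-j})}] of the Bayes rule,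
    cut by its box, is replaced by the zero set of the penalty
    [relu (theta iota x_j + q - Phi x_{-j}) + sum_i relu (lo_i - x_i) +
    sum_i relu (x_i - hi_i)], where [Phi] approximates [gamma] up to [eps] and
    all other weights are rounded to the grid; the network
    [1 - min (1, penalties)] takes the value 1 exactly on the union of these
    zero sets.  The factor [theta], slightly below 1, shrinks [x_j] towards the
    middle of the box, so that [gamma] outside the range of the box is never
    mistaken for [gamma] inside (this uses the lower bound [eps2] on the width
    of the box).  Outside thin strips along the faces, every misclassified
    point then lies within [O(eps)] of a boundary point of the Bayes rule in
    direction [j], where [|2 f - 1| = O(eps ^ beta)] by Taylor expansion; hence
    the excess risk of the approximation is [O(eps ^ kappa)].

    Counting.  A network is determined, up to relabelling of its neurons, by
    the list of its nonzero weights, so the logarithm of the size of the class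
    is [O(eps ^ - rho * log (1 / eps) ^ 2)].

    Concentration.  Since [E exp (- lam Z) <= 1 - lam E Z + lam ^ 2 E Z ^ 2]
    for the difference [Z] of the losses of [G] and of the approximation, and
    [E Z ^ 2] is at most of order [D ^ (1 / kappa)] for [D] the excess risk of
    [G], a union bound over the class shows that the empirical minimizer has
    excess risk at most [K eps ^ kappa] up to a probability smaller than any
    power of [eps]. *)

Require Import Defs.
From HB Require Import structures.
From mathcomp Require Import all_boot all_order all_algebra.
From mathcomp Require Import all_classical all_reals all_analysis.
From mathcomp Require Import measurable_realfun ring lra zify.
Set Implicit Arguments.
Unset Strict Implicit.
Unset Printing Implicit Defensive.
Import Order.TTheory GRing.Theory Num.Theory.
Import numFieldNormedType.Exports.
Local Open Scope classical_set_scope.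
Local Open Scope ring_scope.

(** * Counting networks by their nonzero weights *)

(* A triple [(i, o, w)] is a weight [w] in row [i], in column [j] if
   [o = Some j], and in the bias vector if [o = None]. *)
Notation entry R := (nat * option nat * R)%type.

(** Three choices determine the constants. On the strips along the faces of the boxes nothing better
    than [|2 f - 1| <= 1] is available, so these strips have to be as thin as [eps ^ kappa], not
    just [eps]; a factor [C3'] of order [kappa / ln 2] in the precision achieves this and costs only
    a constant in the entropy. In the exponential bound, [lam] is tuned to the excess risk of each
    set [G] separately, which replaces slicing the class by the size of the excess; the tail becomes
    [exp (- n t ^ (2 - 1 / kappa) / (16 A))] with [t = K eps ^ kappa], and
    [kappa (2 - 1 / kappa) = 2 kappa - 1]. Balancing [n eps ^ (2 kappa - 1)] against the entropy
    gives the power of [n] in [tau_n], whose factor [log ^ (2 / rho)] pays for the two logarithms of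
    the entropy. Finally, the bad event is never isolated as a set: the loss of the minimizer is
    dominated pointwise by a constant plus a sum of products over the sample, and only these
    products are integrated. *)

Section sparse_code.
Variable R : realType.
Implicit Types (l : seq (entry R)) (u : nat -> R).

(** The -1 for a bias entry reflects the convention [sigma (y - b)]. Inputs are functions on [nat],
    so that evaluation does not involve the widths of the layers. *)
Definition code_row l u (k : nat) : R :=
  \sum_(e <- l | e.1.1 == k) e.2 * (if e.1.2 is Some j then u j else -1).

Fixpoint code_eval l (ls : seq (seq (entry R))) u : R :=
  if ls is l' :: ls' then
    code_eval l' ls' (fun k => Num.max (code_row l u k) 0)
  else code_row l u 0.

Definition nz_pos p q (W : 'M[R]_(p, q)) : seq ('I_p * 'I_q) :=
  [seq ij <- [seq (i, j) | i <- enum 'I_p, j <- enum 'I_q] | W ij.1 ij.2 != 0].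

Lemma entries_map p q (W : 'M[R]_(p, q)) : entries W =
  [seq W ij.1 ij.2 | ij <- [seq (i, j) | i <- enum 'I_p, j <- enum 'I_q]].
Proof. by rewrite map_allpairs. Qed.

Lemma size_nz_pos p q (W : 'M[R]_(p, q)) :
  size (nz_pos W) = count (fun w => w != 0) (entries W).
Proof. by rewrite entries_map count_map /nz_pos size_filter. Qed.

Lemma mem_entries p q (W : 'M[R]_(p, q)) i j : W i j \in entries W.
Proof. by rewrite /entries allpairs_f ?mem_enum. Qed.

Lemma sum_nz_pos p q (W : 'M[R]_(p, q)) (P : pred 'I_p) (v : 'I_q -> R) :
  \sum_(ij <- nz_pos W | P ij.1) W ij.1 ij.2 * v ij.2 =
  \sum_(i | P i) \sum_j W i j * v j.
Proof.
rewrite big_filter_cond big_mkcond big_allpairs /= [RHS]big_mkcond big_enum /=.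
apply: eq_bigr => i _; rewrite big_enum /=; case: ifPn => Pi; last first.
  by rewrite big1// => j _; rewrite andbF.
by apply: eq_bigr => j _; rewrite andbT; case: eqP => // ->; rewrite mul0r.
Qed.

(* Row [i] is relabelled by its position among the rows with a nonzero weight;
   all the other rows share one label, past the end of that list. *)
Definition active m h (W : 'M[R]_(h, m)) (b : 'cV[R]_h) : seq 'I_h :=
  map fst (nz_pos W) ++ map fst (nz_pos b).

Definition layer_code m h (W : 'M[R]_(h, m)) (b : 'cV[R]_h) (phi : 'I_m -> nat) :
    seq (entry R) :=
  [seq (index ij.1 (active W b), Some (phi ij.2), W ij.1 ij.2) | ij <- nz_pos W] ++
  [seq (index ij.1 (active W b), None, b ij.1 ij.2) | ij <- nz_pos b].

Lemma active_index m h (W : 'M[R]_(h, m)) (b : 'cV[R]_h) i i' :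
  i' \in active W b ->
  (index i' (active W b) == index i (active W b)) = (i' == i).
Proof.
move=> ai'; apply/eqP/eqP => [e|->//].
have ai : i \in active W b by rewrite -index_mem -e index_mem.
by rewrite -(nth_index i ai') e nth_index.
Qed.

(** If [i] is active, its label belongs to its row alone; otherwise no entry carries its label and
    both sides are 0, which is why all inactive rows may share one. *)
Lemma layer_codeE m h (W : 'M[R]_(h, m)) (b : 'cV[R]_h) (phi : 'I_m -> nat)
    (x : 'cV[R]_m) u i :
  (forall j, x j 0 = u (phi j)) ->
  (W *m x - b) i 0 =
  code_row (layer_code W b phi) u (index i (active W b)) :> R.
Proof.
move=> xu; rewrite /code_row big_cat /= !big_map /=.
have W_eq : forall ij, ij \in nz_pos W ->
    (index ij.1 (active W b) == index i (active W b)) = (ij.1 == i).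
  move=> ij ijW; apply: active_index; rewrite mem_cat; apply/orP; left.
  exact: map_f.
have b_eq : forall ij, ij \in nz_pos b ->
    (index ij.1 (active W b) == index i (active W b)) = (ij.1 == i).
  move=> ij ijb; apply: active_index; rewrite mem_cat; apply/orP; right.
  exact: map_f.
rewrite big_seq_cond [X in _ = _ + X]big_seq_cond.
rewrite (eq_bigl (fun ij => (ij \in nz_pos W) && (ij.1 == i))); last first.
  by move=> ij; case: (boolP (ij \in _)) => //= /W_eq ->.
rewrite [X in _ = _ + X](eq_bigl (fun ij => (ij \in nz_pos b) && (ij.1 == i))); last first.
  by move=> ij; case: (boolP (ij \in nz_pos b)) => //= /b_eq ->.
rewrite -!big_seq_cond.
rewrite (sum_nz_pos W (pred1 i) (fun j => u (phi j))).
rewrite (sum_nz_pos b (pred1 i) (fun=> -1)) /=.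
rewrite !big_pred1_eq big_ord1 mulrN1 !mxE; congr (_ - _).
by apply: eq_bigr => j _; rewrite xu.
Qed.

Lemma size_active m h (W : 'M[R]_(h, m)) (b : 'cV[R]_h) :
  size (active W b) = (size (nz_pos W) + size (nz_pos b))%N.
Proof. by rewrite size_cat !size_map. Qed.

Lemma size_layer_code m h (W : 'M[R]_(h, m)) (b : 'cV[R]_h) phi :
  size (layer_code W b phi) = (size (nz_pos W) + size (nz_pos b))%N.
Proof. by rewrite size_cat !size_map. Qed.

Definition entry_bounded (c K : nat) (e : entry R) : Prop :=
  [/\ (e.1.1 <= K)%N, (if e.1.2 is Some j then j <= K else true)%N
    & weight_grid c e.2].

Lemma layer_code_bounded c K m h (W : 'M[R]_(h, m)) (b : 'cV[R]_h) phi :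
  (forall w, w \in entries W -> weight_grid c w) ->
  (forall w, w \in entries b -> weight_grid c w) ->
  (forall j, (phi j <= K)%N) -> (size (nz_pos W) + size (nz_pos b) <= K)%N ->
  forall e, e \in layer_code W b phi -> entry_bounded c K e.
Proof.
move=> cW cb phiK WbK e.
have idx i : (index i (active W b) <= K)%N.
  by rewrite (leq_trans (index_size _ _))// size_active.
rewrite mem_cat => /orP[|] /mapP[ij ijn ->]; split => //=.
  by apply: cW; exact: mem_entries.
by apply: cb; exact: mem_entries.
Qed.

(** Induction on the layers with the relabelling [phi] of the inputs generalized: a hidden layer
    hands on the relabelling by position in [active], whose values are bounded by the number of
    nonzero weights. Labels thus stay at most [K] however wide the layers are. *)
Lemma net_code c K m (Phi : relu_net R 1 m) (phi : 'I_m -> nat) :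
  (forall w, w \in weights Phi -> weight_grid c w) ->
  (forall j, (phi j <= K)%N) -> (sparsity Phi <= K)%N ->
  exists l ls, [/\ size ls = layers Phi,
    size (flatten (l :: ls)) = sparsity Phi,
    forall e, e \in flatten (l :: ls) -> entry_bounded c K e &
    forall (x : 'cV[R]_m) (u : nat -> R), (forall i, x i 0 = u (phi i)) ->
      realization Phi x 0 0 = code_eval l ls u].
Proof.
elim: Phi phi => {m} [m W|m h W b Phi IH] phi cPhi phiK sK.
  exists [seq (0%N, Some (phi ij.2), W ij.1 ij.2) | ij <- nz_pos W], [::].
  split => //=.
  - by rewrite cats0 size_map size_nz_pos.
  - move=> e; rewrite cats0 => /mapP[ij ijn ->]; split => //=.
    by apply: cPhi; exact: mem_entries.
  - move=> x u xu; rewrite /code_row big_map /=.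
    rewrite (sum_nz_pos W xpredT (fun j => u (phi j))) big_ord1 mxE.
    by apply: eq_bigr => j _; rewrite xu.
move: sK; rewrite /sparsity /= !count_cat -!size_nz_pos => sK.
have cW : forall w, w \in entries W -> weight_grid c w.
  by move=> w wW; apply: cPhi; rewrite /= mem_cat wW.
have cb : forall w, w \in entries b -> weight_grid c w.
  by move=> w wW; apply: cPhi; rewrite /= !mem_cat wW orbT.
have sub : forall w, w \in weights Phi -> weight_grid c w.
  by move=> w wW; apply: cPhi; rewrite /= !mem_cat wW !orbT.
have phiK' : forall i : 'I_h, (index i (active W b) <= K)%N.
  move=> i; rewrite (leq_trans (index_size _ _))// size_active.
  by rewrite (leq_trans _ sK)// addnA leq_addr.
have sK' : (sparsity Phi <= K)%N.
  by rewrite (leq_trans _ sK)// addnA leq_addl.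
have [l [ls [sl sf bl ev]]] := IH _ sub phiK' sK'.
exists (layer_code W b phi), (l :: ls); split => /=.
- by rewrite sl.
- by rewrite size_cat size_layer_code sf addnA.
- move=> e; rewrite mem_cat => /orP[|]; last exact: bl.
  apply: layer_code_bounded => //.
  by rewrite (leq_trans _ sK)// addnA leq_addr.
- move=> x u xu; apply: ev => i; rewrite !mxE.
  by rewrite -(layer_codeE W b i xu) !mxE.
Qed.


(** Shorter data are padded: the first ordinal tells how many of the [lb.+1] block lengths count
    (the output layer is one of the blocks), and these lengths tell how many of the [s] entries
    count. [(2 ^ c.+1).+1] is the number of points of the weight grid. *)
Definition code_type (lb s c K : nat) : finType :=
  ('I_lb.+2 * lb.+1.-tuple 'I_s.+1 *
   s.-tuple ('I_K.+1 * option 'I_K.+1 * 'I_(2 ^ c.+1).+1))%type.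

Definition decode_entry c K
    (e : 'I_K.+1 * option 'I_K.+1 * 'I_(2 ^ c.+1).+1) : entry R :=
  (nat_of_ord e.1.1, omap (@nat_of_ord _) e.1.2,
   ((e.2 : nat)%:Z - (2 ^ c)%N%:Z)%:~R / 2 ^+ c).

Definition decode lb s c K (t : code_type lb s c K) : seq (seq (entry R)) :=
  reshape (take t.1.1 (map (@nat_of_ord _) t.1.2)) (map (@decode_entry c K) t.2).

Lemma card_code_type lb s c K : #|{: code_type lb s c K}| =
  (lb.+2 * s.+1 ^ lb.+1 * (K.+1 * K.+2 * (2 ^ c.+1).+1) ^ s)%N.
Proof. by rewrite !(card_prod, card_tuple, card_ord, card_option). Qed.

Lemma decode_entry_surj c K e : entry_bounded c K e ->
  exists e', @decode_entry c K e' = e.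
Proof.
case: e => -[i o] w [/= iK oK [k [/andP[k1 k2] ->]]].
have kp : (`|(k + (2 ^ c)%N%:Z)%R| < (2 ^ c.+1).+1)%N.
  have -> : ((2 ^ c.+1)%N = 2 * 2 ^ c)%N by rewrite expnS.
  move: k1 k2; rewrite -!natrX; lia.
exists (inord i, omap inord o, Ordinal kp); rewrite /decode_entry /=.
rewrite inordK//; congr (_, _, _ / _).
  by case: o oK => //= j jK; rewrite inordK.
congr (_%:~R); move: k1 k2; rewrite -!natrX; lia.
Qed.

Lemma decode_surj lb s c K (ls : seq (seq (entry R))) :
  (size ls <= lb.+1)%N -> (size (flatten ls) <= s)%N ->
  (forall e, e \in flatten ls -> entry_bounded c K e) ->
  exists t : code_type lb s c K, decode t = ls.
Proof.
move=> sl ss bls.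
have [es esE] : exists es, map (@decode_entry c K) es = flatten ls.
  elim: (flatten ls) bls => [|e r IH] H; first by exists [::].
  have [|es <-] := IH; first by move=> e' e'r; apply: H; rewrite inE e'r orbT.
  have [e' <-] := decode_entry_surj (H e (mem_head _ _)).
  by exists (e' :: es).
have ses : size es = size (flatten ls) by rewrite -esE size_map.
pose dft : 'I_K.+1 * option 'I_K.+1 * 'I_(2 ^ c.+1).+1 := (ord0, None, ord0).
have Hes : size (es ++ nseq (s - size es) dft) == s.
  by rewrite size_cat size_nseq subnKC// ses.
have shs k : k \in shape ls -> (k <= s)%N.
  move=> /mapP[x xls ->]; rewrite (leq_trans _ ss)// size_flatten /shape.
  elim: ls xls {sl ss bls es esE ses Hes} => //= a r IH.
  rewrite inE => /orP[/eqP ->|/IH]; first exact: leq_addr.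
  by move=> /leq_trans; apply; rewrite leq_addl.
have Hsh : size (map (@inord s) (shape ls) ++ nseq (lb.+1 - size ls) ord0) == lb.+1.
  by rewrite size_cat size_nseq !size_map subnKC.
have shE : take (size ls) (map (@nat_of_ord _)
    (map (@inord s) (shape ls) ++ nseq (lb.+1 - size ls) ord0)) = shape ls.
  rewrite map_cat take_size_cat; last by rewrite !size_map.
  rewrite -map_comp -[RHS]map_id; apply/eq_in_map => k kls /=.
  by rewrite inordK// ltnS shs.
exists (@Ordinal lb.+2 (size ls) sl, Tuple Hsh, Tuple Hes).
rewrite /decode /= shE map_cat esE.
(* [reshape] ignores everything past the last block, so the padding [tl] does no harm. *)
have H : forall (tl : seq (entry R)), reshape (shape ls) (flatten ls ++ tl) = ls.
  move=> tl; elim: {sl ss bls es esE ses Hes shs Hsh shE} ls => //= a r IH.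
  by rewrite -catA take_size_cat// drop_size_cat// IH.
exact: H.
Qed.

Definition code_region d (ls : seq (seq (entry R))) : set (euclid R d) :=
  [set x | unit_cube x /\
     code_eval (head [::] ls) (behead ls) (fun k => nth 0 (map (fun t => t : R) x) k) = 1].

(** The label bound [s + d] leaves room for the inputs, labelled below [d], and for the hidden
    neurons, labelled at most [s]. Codes that decode to sets outside the class only enlarge the
    count. *)
Lemma net_regions_code d (L0 s0 : R) (lb s c : nat) (G : set (euclid R d)) :
  L0 <= lb%:R -> s0 <= s%:R -> net_regions d L0 s0 c G ->
  exists t : code_type lb s c (s + d), @code_region d (decode t) = G.
Proof.
move=> Ll ss [Phi [LPhi sPhi cPhi] ->].
have lP : (layers Phi <= lb)%N by rewrite -(ler_nat R) (le_trans LPhi).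
have sP : (sparsity Phi <= s)%N by rewrite -(ler_nat R) (le_trans sPhi).
have [||q [ls [sls sf bls ev]]] :=
    @net_code c (s + d) d Phi (fun i => nat_of_ord i) cPhi.
- by move=> j; rewrite (leq_trans (ltnW (ltn_ord j)))// leq_addl.
- by rewrite (leq_trans sP)// leq_addr.
have [|||t tE] := @decode_surj lb s c (s + d) (q :: ls).
- by rewrite /= sls.
- by rewrite sf.
- exact: bls.
exists t; rewrite tE /code_region /=; apply/seteqP; split => x /= -[cx];
  rewrite /net_fun (ev _ (fun k => nth 0 (map (fun t => t : R) x) k)) //;
  by move=> i; rewrite mxE /xcoord (tnth_nth 0) (nth_map 0) ?size_tuple.
Qed.

End sparse_code.

(** * Networks with weights on a grid *)

Section network_calculus.
Variable R : realType.

Definition nnz p q (W : 'M[R]_(p, q)) : nat := size (nz_pos W).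

Lemma nnzE p q (W : 'M[R]_(p, q)) :
  nnz W = (\sum_i \sum_j (W i j != 0%R))%N.
Proof.
rewrite /nnz size_nz_pos -sum1_count big_mkcond big_allpairs_dep /= big_enum /=.
by apply: eq_bigr => i _; rewrite big_enum.
Qed.

Lemma nnz_le p q (W : 'M[R]_(p, q)) : (nnz W <= p * q)%N.
Proof.
rewrite nnzE -[X in (_ <= X * _)%N]card_ord -sum_nat_const.
apply: leq_sum => i _; rewrite -[X in (_ <= X)%N]card_ord -sum1_card.
by apply: leq_sum => j _; case: (_ != _).
Qed.

Lemma nnz0 p q : nnz (0 : 'M[R]_(p, q)) = 0%N.
Proof. by rewrite nnzE !big1// => i _; rewrite big1// => j _; rewrite mxE eqxx. Qed.

Lemma nnzN p q (W : 'M[R]_(p, q)) : nnz (- W) = nnz W.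
Proof.
by rewrite !nnzE; do 2! apply: eq_bigr => ? _; rewrite mxE oppr_eq0.
Qed.

Lemma nnz1 n : nnz (1%:M : 'M[R]_n) = n.
Proof.
rewrite nnzE -[RHS](card_ord n) -sum1_card; apply: eq_bigr => i _.
rewrite (bigD1 i)//= !mxE eqxx oner_eq0 big1// => j ji.
by rewrite !mxE [i == j]eq_sym (negbTE ji) eqxx.
Qed.

Lemma nnz_col p1 p2 q (A : 'M[R]_(p1, q)) (B : 'M[R]_(p2, q)) :
  nnz (col_mx A B) = (nnz A + nnz B)%N.
Proof.
rewrite !nnzE big_split_ord /=; congr addn;
  do 2! apply: eq_bigr => ? _; by rewrite ?col_mxEu ?col_mxEd.
Qed.

Lemma nnz_row p q1 q2 (A : 'M[R]_(p, q1)) (B : 'M[R]_(p, q2)) :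
  nnz (row_mx A B) = (nnz A + nnz B)%N.
Proof.
rewrite !nnzE -big_split /=; apply: eq_bigr => i _.
by rewrite big_split_ord /=; congr addn;
  apply: eq_bigr => ? _; rewrite ?row_mxEl ?row_mxEr.
Qed.

Lemma nnz_block p1 p2 q1 q2 (A : 'M[R]_(p1, q1)) (B : 'M[R]_(p1, q2))
    (C : 'M[R]_(p2, q1)) (D : 'M[R]_(p2, q2)) :
  nnz (block_mx A B C D) = (nnz A + nnz B + (nnz C + nnz D))%N.
Proof. by rewrite /block_mx nnz_col !nnz_row. Qed.

Definition grid_mx (c : nat) p q (W : 'M[R]_(p, q)) : Prop :=
  forall i j, weight_grid c (W i j).

Lemma grid_mxP c p q (W : 'M[R]_(p, q)) :
  grid_mx c W <-> forall w, w \in entries W -> weight_grid c w.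
Proof.
split=> [cW w /allpairsP[[i j] /= [_ _ ->]]|cW i j]; first exact: cW.
by apply: cW; exact: mem_entries.
Qed.

Lemma weight_grid_int c (k : int) : - 1 <= k <= 1 -> weight_grid c (k%:~R : R).
Proof.
move=> k1; exists (k * 2 ^+ c); split.
  have : (0 : int) < 2 ^+ c by rewrite exprn_gt0. 
  move: k1; nia.
rewrite intrM rmorphXn /= mulfK// expf_neq0// pnatr_eq0//.
Qed.

Lemma weight_grid0 c : weight_grid c (0 : R).
Proof. exact: (@weight_grid_int c 0). Qed.

Lemma weight_grid1 c : weight_grid c (1 : R).
Proof. exact: (@weight_grid_int c 1). Qed.

Lemma weight_gridN c (w : R) : weight_grid c w -> weight_grid c (- w).
Proof.
by move=> [k [kc ->]]; exists (- k); split; [lia|rewrite rmorphN mulNr].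
Qed.

Lemma weight_grid_mono c c' (w : R) : (c <= c')%N ->
  weight_grid c w -> weight_grid c' w.
Proof.
move=> cc' [k [kc ->]]; exists (k * 2 ^+ (c' - c)); split.
  have : (0 : int) < 2 ^+ (c' - c) by rewrite exprn_gt0.
  have -> : (2 : int) ^+ c' = 2 ^+ c * 2 ^+ (c' - c) by rewrite -exprD subnKC.
  nia.
have e2 : (2 : R) ^+ (c' - c) != 0 by rewrite expf_neq0// pnatr_eq0.
have -> : (2 : R) ^+ c' = 2 ^+ c * 2 ^+ (c' - c) by rewrite -exprD subnKC.
by rewrite intrM rmorphXn /= -mulf_div divff ?mulr1.
Qed.

Lemma grid_mx0 c p q : grid_mx c (0 : 'M[R]_(p, q)).
Proof. by move=> i j; rewrite mxE; exact: weight_grid0. Qed.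

Lemma grid_mx1 c n : grid_mx c (1%:M : 'M[R]_n).
Proof. by move=> i j; rewrite !mxE; apply: (@weight_grid_int c (_ == _)); case: eqP. Qed.

Lemma grid_const c p q (w : R) : weight_grid c w -> grid_mx c (const_mx w : 'M[R]_(p, q)).
Proof. by move=> cw i j; rewrite mxE. Qed.

Lemma grid_mxN c p q (W : 'M[R]_(p, q)) : grid_mx c W -> grid_mx c (- W).
Proof. by move=> cW i j; rewrite mxE; exact: weight_gridN. Qed.

Lemma grid_col c p1 p2 q (A : 'M[R]_(p1, q)) (B : 'M[R]_(p2, q)) :
  grid_mx c A -> grid_mx c B -> grid_mx c (col_mx A B).
Proof.
by move=> cA cB i j; case: (split_ordP i) => k ->; rewrite (col_mxEu, col_mxEd).
Qed.

Lemma grid_row c p q1 q2 (A : 'M[R]_(p, q1)) (B : 'M[R]_(p, q2)) :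
  grid_mx c A -> grid_mx c B -> grid_mx c (row_mx A B).
Proof.
by move=> cA cB i j; case: (split_ordP j) => k ->; rewrite (row_mxEl, row_mxEr).
Qed.

Lemma grid_block c p1 p2 q1 q2 (A : 'M[R]_(p1, q1)) (B : 'M[R]_(p1, q2))
    (C : 'M[R]_(p2, q1)) (D : 'M[R]_(p2, q2)) :
  grid_mx c A -> grid_mx c B -> grid_mx c C -> grid_mx c D ->
  grid_mx c (block_mx A B C D).
Proof. by move=> cA cB cC cD; apply: grid_col; exact: grid_row. Qed.

Definition grid_net (c : nat) k m (Phi : relu_net R k m) : Prop :=
  forall w, w \in weights Phi -> weight_grid c w.

Lemma sparsity_hidden k m h (W : 'M[R]_(h, m)) b (Phi : relu_net R k h) :
  sparsity (HiddenLayer W b Phi) = (nnz W + nnz b + sparsity Phi)%N.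
Proof. by rewrite /sparsity /= !count_cat -!size_nz_pos addnA. Qed.

Lemma sparsity_output k m (W : 'M[R]_(k, m)) : sparsity (OutputLayer W) = nnz W.
Proof. by rewrite /nnz size_nz_pos. Qed.

Lemma grid_output c k m (W : 'M[R]_(k, m)) : grid_net c (OutputLayer W) <-> grid_mx c W.
Proof. by rewrite grid_mxP. Qed.

Lemma grid_hidden c k m h (W : 'M[R]_(h, m)) b (Phi : relu_net R k h) :
  grid_net c (HiddenLayer W b Phi) <-> [/\ grid_mx c W, grid_mx c b & grid_net c Phi].
Proof.
rewrite /grid_net /=; split=> [H|[/grid_mxP cW /grid_mxP cb cP] w].
  by split; [apply/grid_mxP|apply/grid_mxP|] => w wW; apply: H;
    rewrite !mem_cat wW ?orbT.
by rewrite !mem_cat => /or3P[/cW|/cb|/cP].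
Qed.

Definition relu p q (x : 'M[R]_(p, q)) : 'M[R]_(p, q) := map_mx (fun t => Num.max t 0) x.

Lemma relu_col p1 p2 q (A : 'M[R]_(p1, q)) (B : 'M[R]_(p2, q)) :
  relu (col_mx A B) = col_mx (relu A) (relu B).
Proof. exact: map_col_mx. Qed.

Lemma relu_id p q (A : 'M[R]_(p, q)) : (forall i j, 0 <= A i j) -> relu A = A.
Proof. by move=> A0; apply/matrixP => i j; rewrite mxE max_l. Qed.

Lemma realization_hidden k m h (W : 'M[R]_(h, m)) b (Phi : relu_net R k h) x :
  realization (HiddenLayer W b Phi) x = realization Phi (relu (W *m x - b)).
Proof. by []. Qed.

(* Feeds [y] through the hidden layers of [Phi] unchanged, then merges the
   output layer of [Phi] with the hidden layer
   [z, y |-> relu (a y - z - b1, A y - b2)]. *)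
Fixpoint carry n k h m (Phi : relu_net R 1 m) (a : 'M[R]_(1, n)) (b1 : 'cV[R]_1)
    (A : 'M[R]_(h, n)) (b2 : 'cV[R]_h) (Psi : relu_net R k (1 + h)) :
    relu_net R k (m + n) :=
  match Phi with
  | OutputLayer _ W => HiddenLayer (block_mx (- W) a 0 A) (col_mx b1 b2) Psi
  | HiddenLayer _ _ W b Phi' =>
      HiddenLayer (block_mx W 0 0 1%:M) (col_mx b 0) (carry Phi' a b1 A b2 Psi)
  end.

(** [relu] fixes a nonnegative vector, so the identity block transports [y] through every hidden
    layer. *)
Lemma carryE n k h m (Phi : relu_net R 1 m) (a : 'M[R]_(1, n)) b1
    (A : 'M[R]_(h, n)) b2 (Psi : relu_net R k (1 + h)) z (y : 'cV[R]_n) :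
  (forall i j, 0 <= y i j) ->
  realization (carry Phi a b1 A b2 Psi) (col_mx z y) =
  realization Psi (relu (col_mx (a *m y - realization Phi z - b1) (A *m y - b2))).
Proof.
move=> y0; elim: Phi z => {m} [m W|m h' W b Phi IH] z /=.
  rewrite -/(relu _) mul_block_col opp_col_mx add_col_mx mul0mx add0r mulNmx.
  by rewrite [- _ + _]addrC.
rewrite -/(relu _) mul_block_col !mul0mx mul1mx addr0 add0r opp_col_mx add_col_mx.
by rewrite subr0 [X in realization _ X]relu_col (relu_id y0) IH.
Qed.

Lemma layers_carry n k h m (Phi : relu_net R 1 m) (a : 'M[R]_(1, n)) b1
    (A : 'M[R]_(h, n)) b2 (Psi : relu_net R k (1 + h)) :
  layers (carry Phi a b1 A b2 Psi) = (layers Phi + 1 + layers Psi)%N.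
Proof. by elim: Phi => {m} [//|m h' W b Phi /= ->]. Qed.

(** The identity block costs [n] weights per hidden layer of [Phi]; this overhead is later absorbed
    into the sparsity bound. *)
Lemma sparsity_carry n k h m (Phi : relu_net R 1 m) (a : 'M[R]_(1, n)) b1
    (A : 'M[R]_(h, n)) b2 (Psi : relu_net R k (1 + h)) :
  sparsity (carry Phi a b1 A b2 Psi) = (sparsity Phi + layers Phi * n +
    (nnz a + nnz b1 + (nnz A + nnz b2)) + sparsity Psi)%N.
Proof.
elim: Phi => {m} [m W|m h' W b Phi IH] /=.
  rewrite sparsity_hidden sparsity_output nnz_block nnz_col nnzN nnz0; lia.
rewrite !sparsity_hidden IH nnz_block nnz_col !nnz0 nnz1; lia.
Qed.

Lemma grid_carry c n k h m (Phi : relu_net R 1 m) (a : 'M[R]_(1, n)) b1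
    (A : 'M[R]_(h, n)) b2 (Psi : relu_net R k (1 + h)) :
  grid_net c Phi -> grid_mx c a -> grid_mx c b1 -> grid_mx c A -> grid_mx c b2 ->
  grid_net c Psi -> grid_net c (carry Phi a b1 A b2 Psi).
Proof.
move=> cP ca cb1 cA cb2 cPsi; elim: Phi cP => {m} [m W|m h' W b Phi IH] /=.
  move=> /grid_output cW; apply/grid_hidden; split => //.
    by apply: grid_block => //; [exact: grid_mxN|exact: grid_mx0].
  exact: grid_col.
move=> /grid_hidden[cW cb cP]; apply/grid_hidden; split; last exact: IH.
  by apply: grid_block => //; [exact: grid_mx0|exact: grid_mx0|exact: grid_mx1].
by apply: grid_col => //; exact: grid_mx0.
Qed.

End network_calculus.

(** * A network for a union of boxes cut by graphs *)

Section union_of_pieces.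
Variables (R : realType) (d : nat).

(** The slope is meant to hold both the orientation [iota] and the contraction factor [theta]. *)
Record piece := Piece {
  piece_net : relu_net R 1 d.-1;
  piece_axis : 'I_d;
  piece_slope : R;
  piece_offset : R;
  piece_lo : 'cV[R]_d;
  piece_hi : 'cV[R]_d }.

Definition drop_mx (j : 'I_d) : 'M[R]_(d.-1, d) := \matrix_(i, k) (k == lift j i)%:R.

Definition margin (P : piece) (x : 'cV[R]_d) : R :=
  piece_slope P * x (piece_axis P) 0 + piece_offset P -
  realization (piece_net P) (drop_mx (piece_axis P) *m x) 0 0.

Definition penalty (P : piece) (x : 'cV[R]_d) : R :=
  Num.max (margin P x) 0 + \sum_i Num.max (piece_lo P i 0 - x i 0) 0 +
  \sum_i Num.max (x i 0 - piece_hi P i 0) 0.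

Definition grid_piece c (P : piece) : Prop :=
  [/\ grid_net c (piece_net P), weight_grid c (piece_slope P),
   weight_grid c (piece_offset P), grid_mx c (piece_lo P) & grid_mx c (piece_hi P)].

Lemma drop_mxE (j : 'I_d) (x : 'cV[R]_d) i :
  (drop_mx j *m x) i 0 = x (lift j i) 0.
Proof.
rewrite mxE (bigD1 (lift j i))//= mxE eqxx mul1r big1 ?addr0// => k ki.
by rewrite mxE (negbTE ki) mul0r.
Qed.

Lemma penalty_ge0 P x : 0 <= penalty P x.
Proof.
by rewrite !addr_ge0// ?sumr_ge0// => *; rewrite le_max lexx orbT.
Qed.

Lemma max0_eq0 (t : R) : (Num.max t 0 == 0) = (t <= 0).
Proof. by apply/eqP/idP => [<-|t0]; [rewrite le_max lexx|rewrite max_r]. Qed.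

Lemma penalty_eq0 P x : penalty P x = 0 <->
  margin P x <= 0 /\ forall i, piece_lo P i 0 <= x i 0 <= piece_hi P i 0.
Proof.
have max0 (t : R) : 0 <= Num.max t 0 by rewrite le_max lexx orbT.
split=> [/eqP|[m0 b]].
  rewrite !paddr_eq0 ?addr_ge0// ?sumr_ge0// !psumr_eq0//.
  rewrite max0_eq0 => /andP[/andP[m0 /allP lo] /allP hi]; split=> // i.
  have := lo i; rewrite mem_index_enum => /(_ isT) /=; rewrite max0_eq0 subr_le0 => ->.
  by have := hi i; rewrite mem_index_enum => /(_ isT) /=; rewrite max0_eq0 subr_le0.
rewrite /penalty max_r// !big1 ?addr0// => i _; apply/max_r; rewrite subr_le0;
  by have /andP[] := b i.
Qed.

(** One link of a chain acting on a state [(x, p)], where [p] is the running minimum of 1 and the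
    penalties met so far. Behind the carried network, a layer holds the margin, the violations of
    the lower and upper faces, [x] and [p]; the next one forms [relu (p - penalty)], and the last
    one [p - relu (p - penalty)], which is the minimum of [p] and the penalty. *)
Let add_net (P : piece) k (Psi : relu_net R k (d + 1)) : relu_net R k (d + 1) :=
  HiddenLayer (col_mx (row_mx (drop_mx (piece_axis P)) 0) 1%:M) 0
  (carry (piece_net P)
    (row_mx (piece_slope P *: delta_mx 0 (piece_axis P)) 0)
    (const_mx (- piece_offset P))
    (col_mx (row_mx (- 1%:M) 0) (col_mx (row_mx 1%:M 0) 1%:M))
    (col_mx (- piece_lo P) (col_mx (piece_hi P) 0))
  (HiddenLayer (col_mx (row_mx (const_mx (-1))
       (row_mx (const_mx (-1)) (row_mx (const_mx (-1)) (row_mx 0 1%:M))))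
     (row_mx 0 (row_mx 0 (row_mx 0 1%:M)))) 0
  (HiddenLayer (row_mx (col_mx 0 (const_mx (-1))) 1%:M) 0 Psi))).

Let add_netE P k (Psi : relu_net R k (d + 1)) (x : 'cV[R]_d) (p : R) :
  (forall i j, 0 <= x i j) -> 0 <= p ->
  realization (add_net P Psi) (col_mx x (const_mx p)) =
  realization Psi (col_mx x (const_mx (Num.min p (penalty P x)))).
Proof.
move=> x0 p0.
have y0 : forall i j, 0 <= (col_mx x (const_mx p : 'cV[R]_1)) i j.
  by move=> i j; case: (split_ordP i) => k' ->; rewrite (col_mxEu, col_mxEd)// mxE.
rewrite realization_hidden subr0 mul_col_mx mul1mx mul_row_col mul0mx addr0.
rewrite relu_col (relu_id y0) relu_id; last by move=> i j; rewrite ord1 drop_mxE.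
rewrite carryE// realization_hidden subr0 !mul_col_mx !mul_row_col !mul0mx.
rewrite !addr0 mulNmx !mul1mx !opp_col_mx !add_col_mx oppr0 addr0.
rewrite relu_col 3!(relu_col _ (col_mx _ _)) (relu_id y0).
rewrite !mul_row_col !mul0mx !mul1mx !add0r.
rewrite (relu_id y0).
rewrite realization_hidden subr0 mul_row_col mul1mx mul_col_mx mul0mx add_col_mx add0r.
rewrite relu_col (relu_id x0); congr (realization Psi (col_mx x _)).
have sumE n (v : 'cV[R]_n) : (const_mx (-1) *m v : 'M[R]_1) 0 0 = - \sum_i v i 0.
  by rewrite mxE -sumrN; apply: eq_bigr => i _; rewrite mxE mulN1r.
set X := (X in relu (const_mx (-1) *m relu X + _)).
have XE : X 0 0 = p - penalty P x.
  have addE (A B : 'cV[R]_1) : (A + B) 0 0 = A 0 0 + B 0 0 by rewrite mxE.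
  rewrite /X !addE !sumE big_ord1 [const_mx p 0 0]mxE /penalty.
  have -> : relu (piece_slope P *: 'e_(piece_axis P) *m x -
      realization (piece_net P) (drop_mx (piece_axis P) *m x) -
      const_mx (- piece_offset P)) 0 0 = Num.max (margin P x) 0.
    have E : (piece_slope P *: 'e_(piece_axis P) *m x : 'M[R]_1) 0 0 =
        piece_slope P * x (piece_axis P) 0.
      by rewrite -scalemxAl mxE -rowE mxE.
    have NE (A : 'cV[R]_1) : (- A) 0 0 = - A 0 0 by rewrite mxE.
    rewrite mxE !addE E !NE [const_mx _ 0 0]mxE /margin opprK.
    by congr Num.max; ring.
  have -> : \sum_i relu (- x - - piece_lo P) i 0 =
      \sum_i Num.max (piece_lo P i 0 - x i 0) 0.
    by apply: eq_bigr => i _; rewrite !mxE opprK addrC.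
  have -> : \sum_i relu (x - piece_hi P) i 0 =
      \sum_i Num.max (x i 0 - piece_hi P i 0) 0.
    by apply: eq_bigr => i _; rewrite !mxE.
  rewrite /margin; ring.
apply/matrixP => i j; rewrite !ord1 [LHS]mxE [in LHS]mxE sumE big_ord1.
rewrite [relu X _ _]mxE XE !mxE.
have := penalty_ge0 P x; set q := penalty P x => q0.
have [pq|pq] := leP p q.
  by rewrite (@max_r _ _ (p - q)) ?subr_le0// oppr0 add0r max_l.
by rewrite (@max_l _ _ (p - q)) ?subr_ge0 ?(ltW pq)// opprB subrK max_l.
Qed.

Let layers_add_net P k (Psi : relu_net R k (d + 1)) :
  layers (add_net P Psi) = (layers (piece_net P) + 4 + layers Psi)%N.
Proof. by rewrite /= layers_carry /=; lia. Qed.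

Let sparsity_add_net P k (Psi : relu_net R k (d + 1)) :
  (sparsity (add_net P Psi) <= sparsity (piece_net P) +
     layers (piece_net P) * (d + 1) + 30 * (d + 1) ^ 2 + sparsity Psi)%N.
Proof.
rewrite /add_net !(sparsity_hidden, sparsity_carry).
rewrite !(nnz_col, nnz_row, nnz0, nnzN, nnz1).
have := nnz_le (drop_mx (piece_axis P)).
have := nnz_le (piece_slope P *: 'e_(piece_axis P) : 'M[R]_(1, d)).
have := nnz_le (const_mx (- piece_offset P) : 'M[R]_1).
have := nnz_le (const_mx (-1) : 'M[R]_1).
have := nnz_le (const_mx (-1) : 'M[R]_(1, d)).
have := nnz_le (piece_lo P).
have := nnz_le (piece_hi P).
rewrite !mul1n !muln1.
have : (d.-1 * d <= d ^ 2)%N by rewrite -mulnn leq_mul2r leq_pred orbT.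
rewrite sqrnD; lia.
Qed.

Let grid_add_net c P k (Psi : relu_net R k (d + 1)) : grid_piece c P ->
  grid_net c Psi -> grid_net c (add_net P Psi).
Proof.
move=> [cP cs co cl ch] cPsi.
have c0 := @grid_mx0 R c; have c1 := @grid_mx1 R c.
have cN1 p q : grid_mx c (const_mx (-1) : 'M[R]_(p, q)).
  by apply: grid_const; exact/weight_gridN/weight_grid1.
apply/grid_hidden; split => //.
  apply: grid_col => //; apply: grid_row => // i j; rewrite mxE.
  by case: (_ == _); [exact: weight_grid1|exact: weight_grid0].
apply: grid_carry => //.
- apply: grid_row => // i j; rewrite !mxE.
  by case: (_ && _); rewrite ?mulr1 ?mulr0//; exact: weight_grid0.
- by apply: grid_const; exact: weight_gridN.
- by apply: grid_col; [apply: grid_row => //; exact: grid_mxN|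
    apply: grid_col => //; exact: grid_row].
- by apply: grid_col; [exact: grid_mxN|exact: grid_col].
apply/grid_hidden; split => //.
  by apply: grid_col; do ! (apply: grid_row => //).
apply/grid_hidden; split => //.
by apply: grid_row => //; exact: grid_col.
Qed.

(** An output layer has no bias, so the constant 1 comes from a hidden neuron with bias -1. *)
Let final_net : relu_net R 1 (d + 1) :=
  HiddenLayer (col_mx (row_mx 0 1%:M) 0) (col_mx 0 (const_mx (-1)))
    (OutputLayer (row_mx (const_mx (-1) : 'M[R]_(1, 1)) (const_mx 1 : 'M[R]_(1, 1)))).

Let final_netE (x : 'cV[R]_d) (p : R) : 0 <= p ->
  realization final_net (col_mx x (const_mx p)) 0 0 = 1 - p.
Proof.
move=> p0; rewrite realization_hidden mul_col_mx mul_row_col !mul0mx mul1mx add0r.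
rewrite opp_col_mx add_col_mx oppr0 addr0 add0r relu_col /= mul_row_col.
by rewrite mxE [X in X + _]mxE [X in _ + X]mxE !big_ord1 !mxE opprK max_l// max_l//; lra.
Qed.

(** The chain starts in the state [p = 1], produced by a bias -1. Without any piece the output is
    [1 - 1 = 0], and the region is empty, as it should be. *)
Definition union_net u (P : 'I_u -> piece) : relu_net R 1 d :=
  HiddenLayer (col_mx 1%:M 0) (col_mx 0 (const_mx (-1)))
    (foldr (fun nu => @add_net (P nu) 1) final_net (enum 'I_u)).

Lemma union_netP u (P : 'I_u -> piece) (x : 'cV[R]_d) : (forall i, 0 <= x i 0) ->
  realization (union_net P) x 0 0 = 1 <-> exists nu, penalty (P nu) x = 0.
Proof.
move=> x0; rewrite realization_hidden mul_col_mx mul1mx mul0mx opp_col_mx add_col_mx.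
rewrite oppr0 addr0 add0r relu_col.
have x0' i j : 0 <= x i j by rewrite (ord1 j).
have -> : relu (- const_mx (-1) : 'cV[R]_1) = const_mx 1.
  by apply/matrixP => i j; rewrite !mxE opprK max_l.
rewrite (relu_id x0').
(* Generalized over the initial state [p]: the chain outputs 1 minus the least of [p] and the
   penalties, and this least value vanishes only if one of them does. *)
have H (s : seq 'I_u) (p : R) : 0 <= p ->
    realization (foldr (fun nu => @add_net (P nu) 1) final_net s)
      (col_mx x (const_mx p)) 0 0 = 1 <->
    p = 0 \/ exists2 nu, nu \in s & penalty (P nu) x = 0.
  elim: s p => [|nu s IH] p p0.
    rewrite [foldr _ _ _]/= final_netE//; split=> [h|[->|[]//]]; last by rewrite subr0.
    by left; lra.
  rewrite [foldr _ _ _]/= -/add_net add_netE// IH; last first.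
    by rewrite le_min p0 penalty_ge0.
  split=> [[mp|[nu' nus e]]|[->|[nu']]].
  - have [pq|qp] := leP p (penalty (P nu) x); first by left; rewrite -mp min_l.
    by right; exists nu; rewrite ?mem_head// -mp min_r// ltW.
  - by right; exists nu' => //; rewrite inE nus orbT.
  - by left; rewrite min_l// penalty_ge0.
  - rewrite inE => /orP[/eqP -> e|nus e]; first by left; rewrite e min_r.
    by right; exists nu'.
rewrite H//; split=> [[/eqP|[nu _ e]]|[nu e]]; first by rewrite oner_eq0.
  by exists nu.
by right; exists nu; rewrite ?mem_enum.
Qed.

Lemma layers_union_net u (P : 'I_u -> piece) :
  layers (union_net P) = (2 + \sum_nu (layers (piece_net (P nu)) + 4))%N.
Proof.
rewrite -big_enum /=; elim: (enum _) => [|nu s IH]; first by rewrite big_nil.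
by rewrite big_cons [foldr _ _ _]/= layers_add_net; lia.
Qed.

Lemma sparsity_union_net u (P : 'I_u -> piece) :
  (sparsity (union_net P) <= 5 * (d + 1) + \sum_nu (sparsity (piece_net (P nu)) +
     layers (piece_net (P nu)) * (d + 1) + 30 * (d + 1) ^ 2))%N.
Proof.
rewrite sparsity_hidden !nnz_col nnz1 !nnz0.
have := nnz_le (const_mx (-1) : 'M[R]_1).
have := nnz_le (const_mx (1) : 'M[R]_1).
have fin : (sparsity final_net <= 4)%N.
  rewrite !(sparsity_hidden, sparsity_output, nnz_col, nnz_row, nnz0, nnz1).
  by have := nnz_le (const_mx (-1) : 'M[R]_1); have := nnz_le (const_mx (1) : 'M[R]_1); lia.
have : (sparsity (foldr (fun nu => @add_net (P nu) 1) final_net (enum 'I_u)) <= 4 +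
    \sum_nu (sparsity (piece_net (P nu)) +
     layers (piece_net (P nu)) * (d + 1) + 30 * (d + 1) ^ 2))%N.
  rewrite -big_enum /=; elim: (enum _) => [|nu s IH]; first by rewrite big_nil addn0.
  rewrite big_cons [foldr _ _ _]/=.
  by rewrite (leq_trans (sparsity_add_net _ _))//; lia.
lia.
Qed.

Lemma grid_union_net c u (P : 'I_u -> piece) :
  (forall nu, grid_piece c (P nu)) -> grid_net c (union_net P).
Proof.
move=> cP; have c0 := @grid_mx0 R c; have c1 := @grid_mx1 R c.
have w1 := weight_grid1 R c; have wN1 := weight_gridN w1.
apply/grid_hidden; split; [exact: grid_col| |].
  by apply: grid_col => //; exact: grid_const.
elim: (enum _) => [|nu s IH]; last exact: grid_add_net.
apply/grid_hidden; split.
- by apply: grid_col => //; exact: grid_row.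
- by apply: grid_col => //; exact: grid_const.
- by apply/grid_output; apply: grid_row; exact: grid_const.
Qed.

End union_of_pieces.

(** * Flat Hoelder functions *)

Section hoelder_flat.
Variable R : realType.
Implicit Types (g : R -> R) (x : R).

Lemma unit_derivable_cvg g x : unit_derivable g x ->
  unit_quotient g x @ within `[0, 1] x^' --> unit_derive g x.
Proof. by []. Qed.

Lemma within_unit_ballP x (A : set R) :
  (exists2 e : R, 0 < e & forall y, `|x - y| < e -> y != x -> y \in `[0, 1] -> A y) <->
  (within `[0, 1] x^') A.
Proof.
rewrite /within /dnbhs /= /within; split=> [[e e0 H]|].
  by apply/nbhs_ballP; exists e => //= y; rewrite /ball /= => xy yx /= y01; exact: H.
by move=> /nbhs_ballP[e /= e0 H]; exists e => // y xy yx y01; exact: H.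
Qed.

(** Near an interior point the restriction to [[0, 1]] is vacuous. This gives access to [MVT]. *)
Lemma unit_derivable_is_derive g x : x \in `]0, 1[ -> unit_derivable g x ->
  is_derive x (1 : R) g (unit_derive g x).
Proof.
rewrite in_itv /= => /andP[x0 x1] /unit_derivable_cvg gx.
have shiftx : (fun h : R => h + x) @ 0^' --> within `[0, 1] x^'.
  move=> A /within_unit_ballP[e e0 HA].
  rewrite /= /nbhs /= /dnbhs /within /=; apply/nbhs_ballP.
  exists (Num.min e (Num.min x (1 - x))) => /=.
    by rewrite !lt_min e0 x0 subr_gt0.
  move=> h; rewrite /ball /= sub0r normrN !lt_min => /and3P[he hx hx1] h0 /=.
  move: hx hx1; rewrite !ltr_norml => hx hx1.
  apply: HA; first by rewrite /= opprD addrCA subrr addr0 normrN.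
    by rewrite -subr_eq0 addrK.
  by rewrite /= in_itv /=; clear -hx hx1; lra.
have cv : h^-1 *: ((g \o shift x) (h *: 1) - g x) @[h --> 0^'] --> unit_derive g x.
  apply: cvg_trans (cvg_comp _ _ shiftx gx); apply: near_eq_cvg; near=> h.
  by rewrite /= /unit_quotient addrK /shift/= /GRing.scale/= mulr1 mulrC.
by apply: DeriveDef; [apply/cvg_ex; exists (unit_derive g x)|exact: cvg_lim cv].
Unshelve. all: by end_near. Qed.

Lemma unit_derivable_continuous g :
  (forall x, x \in `[0, 1] -> unit_derivable g x) ->
  {within `[0 : R, 1], continuous g}.
Proof.
move=> dg; apply/subspace_continuousP => x /= x01.
have /unit_derivable_cvg/cvgrPdist_lt/(_ 1 ltr01) := dg _ x01.
move=> /within_unit_ballP[e e0 He].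
apply/cvgrPdist_lt => eps eps0; rewrite /= /nbhs/= /within /=.
set K := `|unit_derive g x| + 1.
have K0 : 0 < K by rewrite ltr_wpDl.
apply/nbhs_ballP; exists (Num.min e (eps / K)) => /=.
  by rewrite lt_min e0 divr_gt0.
move=> y; rewrite /ball /= lt_min => /andP[xye xyK] y01.
have [->|yx] := eqVneq y x; first by rewrite subrr normr0.
have := He y xye yx y01; rewrite /unit_quotient => H.
have {}H : `|(g y - g x) / (y - x)| < K.
  rewrite -[X in `|X|](subrK (unit_derive g x)) addrC.
  by rewrite (le_lt_trans (ler_normD _ _))// ltrD2l distrC.
rewrite distrC -[g y - g x](@divfK _ (y - x)) ?subr_eq0// normrM.
move: xyK; rewrite ltr_pdivlMr// mulrC distrC => xyK.
by rewrite (le_lt_trans _ xyK)// ler_wpM2r// ltW.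
Qed.

Lemma unit_mean_value g (K a : R) : 0 <= a <= 1 ->
  {within `[0 : R, 1], continuous g} ->
  (forall x, x \in `]0, a[ -> unit_derivable g x) ->
  (forall x, x \in `]0, a[ -> `|unit_derive g x| <= K) ->
  `|g a - g 0| <= K * a.
Proof.
move=> /andP[]; rewrite le_eqVlt => /orP[/eqP <- _ _ _ _|a0 a1 cg dg Kg].
  by rewrite subrr normr0 mulr0.
have [x xa||c ca ->] := @MVT R g (unit_derive g) 0 a a0.
- apply: unit_derivable_is_derive (dg _ xa).
  by move: xa; rewrite !in_itv /= => /andP[-> xa]; rewrite (lt_le_trans xa).
- by apply: continuous_subspaceW cg => x /=; rewrite !in_itv /= => /andP[-> /le_trans ->].
- by rewrite subr0 normrM (gtr0_norm a0) ler_wpM2r ?Kg// ltW.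
Qed.

Lemma hoelder_quotient_le beta B g (x y : R) : hoelder_class beta B g ->
  x \in `[0, 1] -> y \in `[0, 1] -> x != y ->
  let m := hoelder_order beta in
  `|unit_derive_n m g x - unit_derive_n m g y| <= B * `|x - y| `^ (beta - m%:R).
Proof.
move=> [_ _ nB] x01 y01 xy /=; set m := hoelder_order beta.
rewrite -ler_pdivrMr; last by rewrite powR_gt0// normr_gt0 subr_eq0.
rewrite -lee_fin; apply: le_trans nB; rewrite /hoelder_norm -/m.
rewrite -[leLHS]add0e; apply: leeD; last by apply: ereal_sup_ubound; exists (x, y).
apply: sume_ge0 => k _; apply: (@le_trans _ _ `|unit_derive_n k g x|%:E).
  by rewrite lee_fin.
by apply: ereal_sup_ubound; exists x.
Qed.

(** Descending induction on the order of the derivative. At order [m], the Hoelder quotient against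
    0, where the derivative vanishes, gives [B * x ^ (beta - m)]. Each mean value inequality on
    [[0, x]] then gains a factor [x], because the previous bound increases with its argument; no
    constant besides [B] appears. *)
Lemma hoelder0_powR beta B g (h : R) : 0 < beta -> hoelder0_class beta B g ->
  0 <= h <= 1 -> `|g h| <= B * h `^ beta.
Proof.
move=> b0 [gH g0] /andP[]; rewrite le_eqVlt => /orP[/eqP <- _|h0 h1].
  by rewrite -[g 0]/(unit_derive_n 0 g 0) g0// normr0 powR0 ?mulr0// gt_eqF.
set m := hoelder_order beta.
have mb : m%:R < beta by rewrite lt_hoelder_order.
have [cg dg _] := gH.
have main k : (k <= m)%N -> forall x, 0 < x <= 1 ->
    `|unit_derive_n (m - k) g x| <= B * x `^ (beta - (m - k)%:R).
  elim: k => [_ x /andP[x0 x1]|k IH km x /andP[x0 x1]].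
    have x01 : x \in `[0, 1] by rewrite in_itv /= (ltW x0) x1.
    have o01 : (0 : R) \in `[0, 1] by rewrite in_itv /= lexx ler01.
    rewrite subn0; have := hoelder_quotient_le gH x01 o01; rewrite gt_eqF// => /(_ isT) /=.
    by rewrite -/m g0// !subr0 (gtr0_norm x0).
  have mk : (m - k = (m - k.+1).+1)%N by lia.
  rewrite -[unit_derive_n _ _ _]subr0 -[X in _ - X](g0 (m - k.+1)%N); last first.
    by rewrite lt_hoelder_order// leq_subr.
  have -> : B * x `^ (beta - (m - k.+1)%:R) = B * x `^ (beta - (m - k)%:R) * x.
    rewrite -mulrA -[X in _ * (_ * X)](powRr1 (ltW x0)) -powRD; last first.
      by rewrite [x == 0]gt_eqF// implybT.
    by congr (_ * _ `^ _); rewrite mk -natr1; ring.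
  have dgk y : y \in `[0, 1] -> unit_derivable (unit_derive_n (m - k.+1) g) y.
    by apply: dg; rewrite -/m; lia.
  apply: unit_mean_value; first by rewrite (ltW x0).
  - exact: unit_derivable_continuous.
  - move=> y; rewrite in_itv /= => /andP[y0 yx]; apply: dgk.
    by rewrite in_itv /= (ltW y0) (le_trans (ltW yx)).
  - move=> y; rewrite in_itv /= => /andP[y0 yx].
    have := IH (ltnW km) y; rewrite y0 (le_trans (ltW yx))// => /(_ isT).
    rewrite {1}mk => /le_trans; apply.
    have B0 : 0 <= B.
      have := IH (ltnW km) y; rewrite y0 (le_trans (ltW yx))// => /(_ isT).
      by move=> /(le_trans (normr_ge0 _)); rewrite pmulr_lge0// powR_gt0.
    rewrite ler_wpM2l// ge0_ler_powR ?nnegrE ?(ltW y0) ?(ltW x0) ?(ltW yx)//.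
    by rewrite subr_ge0 ltW// lt_hoelder_order// leq_subr.
by have := main m (leqnn m) h; rewrite subnn subr0 h0 h1 => /(_ isT).
Qed.

End hoelder_flat.

(** * Integration *)

Section measure_tools.
Import HBNNSimple.
Context d (T : measurableType d) (R : realType).
Local Open Scope ereal_scope.

(** The integral of a nonnegative function is a supremum over the simple functions below it, hence
    monotone without measurability. This serves for integrands such as [Psi (Ghat z)] and for fibre
    integrals. *)
Lemma ge0_le_integral_nonmeasurable (mu : {measure set T -> \bar R}) (h g : T -> \bar R) :
  (forall x, 0 <= h x) -> (forall x, h x <= g x) ->
  \int[mu]_x h x <= \int[mu]_x g x.
Proof.
move=> h0 hg; rewrite !ge0_integralTE//; last first.
  by move=> x; exact: le_trans (hg x).
apply: ereal_sup_le => _ [k kh <-].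
by exists k => // x; exact: le_trans (kh x) (hg x).
Qed.

(** Independence, in the form needed for exponential moments: Tonelli splits off the first sample
    point, and the bound [c] is collected once per point. *)
Lemma integral_prod_power_measure (mu : {sigma_finite_measure set T -> \bar R})
    (phi : T -> R) (c : R) (n : nat) :
  measurable_fun setT phi -> (forall x, 0 <= phi x)%R ->
  \int[mu]_x (phi x)%:E <= c%:E ->
  \int[power_measure mu n]_z (\prod_(i < n) phi (tnth z i))%:E <= (c ^+ n)%:E.
Proof.
move=> mphi phi0 phic.
have c0 : (0 <= c)%R.
  by rewrite -lee_fin (le_trans _ phic)//; apply: integral_ge0 => x _; rewrite lee_fin.
have mprod m : measurable_fun setT (fun z : m.-tuple T => \prod_(i < m) phi (tnth z i))%R.
  apply: measurable_prod => i _; apply: measurableT_comp => //.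
  exact: measurable_tnth.
elim: n => [|n IH].
  rewrite expr0 (eq_integral (cst 1)); last by move=> z _; rewrite big_ord0.
  by rewrite integral_cst// mul1e /= diracE in_setT.
rewrite /= ge0_integral_pushforward//; last 3 first.
- exact: measurable_tcons.
- by apply/measurable_EFinP; exact: mprod.
- by move=> z _; rewrite lee_fin prodr_ge0.
rewrite preimage_setT.
have -> : (fun z : n.+1.-tuple T => (\prod_(i < n.+1) phi (tnth z i))%:E) \o @tcons T n =
    fun z => (phi z.1)%:E * (\prod_(i < n) phi (tnth z.2 i))%:E.
  apply/funext => -[x z] /=; rewrite big_ord_recl tnth0 EFinM; congr (_ * _%:E).
  by apply: eq_bigr => i _; rewrite tnthS.
rewrite fubini_tonelli1/=; last 2 first.
- apply: emeasurable_funM; apply/measurable_EFinP.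
    exact: measurableT_comp.
  by apply: (measurableT_comp (mprod n)).
- by move=> z; rewrite mule_ge0// lee_fin ?prodr_ge0.
rewrite /fubini_F /=.
apply: (@le_trans _ _ (\int[mu]_x ((phi x)%:E * (c ^+ n)%:E))).
  apply: ge0_le_integral_nonmeasurable => x.
    by apply: integral_ge0 => y _; rewrite mule_ge0// lee_fin// prodr_ge0.
  rewrite ge0_integralZl//.
  - by apply: lee_wpmul2l => //; rewrite lee_fin.
  - by apply/measurable_EFinP; exact: mprod.
  - by move=> y _; rewrite lee_fin prodr_ge0.
  - by rewrite lee_fin.
rewrite ge0_integralZr//; last 3 first.
- exact/measurable_EFinP.
- by move=> x _; rewrite lee_fin.
- by rewrite lee_fin exprn_ge0.
by rewrite exprS EFinM lee_wpmul2r// lee_fin exprn_ge0.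
Qed.

End measure_tools.

(** * Volume from one-dimensional slices *)

Section slices.
Variable R : realType.
Local Open Scope ereal_scope.

Lemma unit_cube_measurable d : measurable (@unit_cube R d).
Proof.
rewrite (_ : unit_cube = \bigcap_(i in [set: 'I_d])
    ((@tnth d (measurableTypeR R) ^~ i) @^-1` `[0%R, 1%R])); last first.
  apply/seteqP; split => [x cx i _ /=|x cx i].
    by rewrite in_itv /=; exact: cx.
  by have := cx i I; rewrite /= in_itv.
apply: fin_bigcap_measurable => // i _.
by rewrite -[X in measurable X]setTI; apply: measurable_tnth => //; exact: measurable_itv.
Qed.

Lemma lebesgue_tuple_box d (a b : 'I_d -> R) : (forall i, a i <= b i)%R ->
  lebesgue_tuple R d (box a b) = (\prod_(i < d) (b i - a i))%:E.
Proof.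
move=> ab; rewrite /lebesgue_tuple.
have -> : box a b = [set t : euclid R d | forall i, [set` `[a i, b i]%R] (tnth t i)].
  by apply/seteqP; split => x H i; have := H i; rewrite /= in_itv.
rewrite (@power_measure_box _ (measurableTypeR R) R (@lebesgue_measure R) d
  (fun i => [set` `[a i, b i]%R])); last by move=> i; exact: measurable_itv.
rewrite -prodEFin; apply: eq_bigr => i _.
rewrite [LHS]lebesgue_measure_itv /= lte_fin; case: ltP => [//|ba].
by rewrite (@le_anti _ _ (a i) (b i)) ?subrr// ab ba.
Qed.

Lemma lebesgue_tuple_cube d : lebesgue_tuple R d unit_cube = 1.
Proof.
by rewrite lebesgue_tuple_box// big1// => i _; rewrite subr0.
Qed.

Lemma replace_coord_cons d (j : 'I_d) (t x : R) (y : euclid R d) :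
  replace_coord (lift ord0 j) t (tcons (x, y)) = tcons (x, replace_coord j t y)
  :> euclid R d.+1.
Proof.
apply: eq_from_tnth => i; rewrite tnth_mktuple /xcoord.
case: (unliftP ord0 i) => [k|] ->; rewrite ?tnth0//.
by rewrite !tnthS tnth_mktuple (inj_eq lift_inj).
Qed.

Lemma replace_coord0_cons d (t x : R) (y : euclid R d) :
  replace_coord ord0 t (tcons (x, y)) = tcons (t, y) :> euclid R d.+1.
Proof.
apply: eq_from_tnth => i; rewrite tnth_mktuple /xcoord.
by case: (unliftP ord0 i) => [k|] ->; rewrite ?tnth0// !tnthS.
Qed.

Lemma unit_cube_cons d (x : R) (y : euclid R d) :
  unit_cube (tcons (x, y) : euclid R d.+1) <-> (0 <= x <= 1)%R /\ unit_cube y.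
Proof.
split=> [c|[x01 cy] i].
  by split=> [|i]; [have := c ord0|have := c (lift ord0 i)];
    rewrite /xcoord ?tnth0 ?tnthS.
by case: (unliftP ord0 i) => [k|] ->; rewrite /xcoord ?tnth0 ?tnthS//; exact: cy.
Qed.

(** Tonelli in the order in which the power measure is built. If [j] is the first coordinate, it is
    integrated inside; otherwise the first coordinate is integrated outside and the induction
    applies to its fibres. Inside the cube the outer integral runs over mass 1, so the bound on
    slices is passed on without loss. *)
Lemma lebesgue_tuple_slices d (j : 'I_d) (A : set (euclid R d)) (K : R) :
  measurable A -> A `<=` unit_cube ->
  (forall x, @lebesgue_measure R [set t | A (replace_coord j t x)] <= K%:E) ->
  lebesgue_tuple R d A <= K%:E.
Proof.
elim: d j A => [[]//|d IH] j A mA Acube slA.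
have K0 : (0 <= K)%R.
  by rewrite -lee_fin (le_trans _ (slA [tuple 0%R | i < d.+1])).
pose B : set (measurableTypeR R * euclid R d) := @tcons _ d @^-1` A.
have mB : measurable B.
  by rewrite /B -[X in measurable X]setTI; exact: measurable_tcons.
have -> : lebesgue_tuple R d.+1 A =
    \int[@lebesgue_measure R \x lebesgue_tuple R d]_z (\1_B z)%:E.
  by rewrite integral_indic// setIT.
have m1B : measurable_fun setT (fun z => (\1_B z)%:E : \bar R).
  by apply/measurable_EFinP; exact: measurable_indic.
have B0 z : (0 : \bar R) <= (\1_B z)%:E by rewrite lee_fin.
case: (unliftP ord0 j) => [j'|] jE; rewrite jE in slA.
  rewrite fubini_tonelli1//=.
  apply: (@le_trans _ _ (\int[@lebesgue_measure R]_x (K%:E * (\1_`[0%R, 1%R] x)%:E))).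
    apply: ge0_le_integral_nonmeasurable => x; first by apply: integral_ge0.
    rewrite /fubini_F.
    pose Ax : set (euclid R d) := [set y | B (x, y)].
    have mAx : measurable Ax.
      have := measurable_xsection x mB.
      by congr measurable; apply/seteqP; split => y; rewrite /xsection /= inE.
    have -> : \int[lebesgue_tuple R d]_y (\1_B (x, y))%:E = lebesgue_tuple R d Ax.
      by rewrite (integral_indic _ measurableT mAx) setIT.
    have [x01|x01] := boolP (x \in `[0%R, 1%R]).
      rewrite indicE mem_set// mule1; apply: (IH j') => //.
        by move=> y /Acube/unit_cube_cons[].
      move=> y; apply: le_trans (slA (tcons (x, y))).
      by under [in leRHS]eq_set do rewrite replace_coord_cons.
    rewrite (_ : Ax = set0) ?measure0; last first.
      apply/seteqP; split => // y /Acube/unit_cube_cons[x01' _].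
      by move: x01; rewrite in_itv /= x01'.
    by rewrite mule_ge0// lee_fin.
  rewrite ge0_integralZl//.
  - rewrite integral_indic// setIT [X in _ * X]lebesgue_measure_itv /= lte_fin ltr01.
    by rewrite oppr0 addr0 mule1.
  - by apply/measurable_EFinP; exact: measurable_indic.
rewrite fubini_tonelli2//=.
apply: (@le_trans _ _ (\int[lebesgue_tuple R d]_y (K%:E * (\1_unit_cube y)%:E))).
  apply: ge0_le_integral_nonmeasurable => y; first by apply: integral_ge0.
  rewrite /fubini_G.
  pose Ay : set (measurableTypeR R) := [set x | B (x, y)].
  have mAy : measurable Ay.
    have := measurable_ysection y mB.
    by congr measurable; apply/seteqP; split => x; rewrite /ysection /= inE.
  have -> : \int[@lebesgue_measure R]_x (\1_B (x, y))%:E = lebesgue_measure Ay.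
    by rewrite (integral_indic _ measurableT mAy) setIT.
  have [cy|cy] := pselect (unit_cube y).
    rewrite indicE mem_set// mule1; apply: le_trans (slA (tcons (0%R, y))).
    by under [in leRHS]eq_set do rewrite replace_coord0_cons.
  rewrite (_ : Ay = set0) ?measure0; last first.
    by apply/seteqP; split => // x /Acube/unit_cube_cons[_ /cy].
  by rewrite mule_ge0// lee_fin.
rewrite ge0_integralZl//.
- rewrite integral_indic// ?setIT; last exact: unit_cube_measurable.
  by rewrite [X in _ * X]lebesgue_tuple_cube mule1.
- by apply/measurable_EFinP; apply: measurable_indic; exact: unit_cube_measurable.
Qed.

End slices.

(** * Measurability of networks *)

Section network_measurability.
Variable R : realType.

Definition measurable_col d (T : measurableType d) m (x : T -> 'cV[R]_m) : Prop :=
  forall i, measurable_fun setT (fun t => x t i 0).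

Lemma measurable_mulmx d (T : measurableType d) m h (W : 'M[R]_(h, m)) (x : T -> 'cV[R]_m) :
  measurable_col x -> measurable_col (fun t => W *m x t).
Proof.
move=> mx i; under eq_fun do rewrite mxE.
by apply: measurable_sum => j; apply: measurable_funM => //; exact: mx.
Qed.

Lemma measurable_realization d (T : measurableType d) k m (Phi : relu_net R k m)
    (x : T -> 'cV[R]_m) :
  measurable_col x -> measurable_col (fun t => realization Phi (x t)).
Proof.
elim: Phi x => {m} [m W|m h W b Phi IH] x mx /=; first exact: measurable_mulmx.
apply: IH => i; under eq_fun do rewrite !mxE.
apply: measurable_maxr => //; apply: measurable_funB => //.
by have := measurable_mulmx W mx i; under eq_fun do rewrite mxE.
Qed.

Lemma measurable_to_col d : measurable_col (@to_col R d).
Proof. by move=> i; under eq_fun do rewrite mxE; exact: measurable_tnth. Qed.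

Lemma measurable_net_fun d (Phi : relu_net R 1 d) :
  measurable_fun setT (net_fun Phi).
Proof. exact: (measurable_realization Phi (@measurable_to_col d)). Qed.

Lemma measurable_margin d (P : piece R d) :
  measurable_fun setT (fun x : euclid R d => margin P (to_col x)).
Proof.
apply: measurable_funB.
  by apply: measurable_funD => //; apply: measurable_funM => //; exact: measurable_to_col.
have H := measurable_realization (piece_net P)
  (measurable_mulmx (drop_mx R (piece_axis P)) (@measurable_to_col d)).
exact: (H 0).
Qed.

End network_measurability.

(** * Risk and concentration *)

Section risk.
Variables (R : realType) (d : nat) (Q : probability (sample R d) R).
Variables (f : euclid R d -> R).
Hypothesis f_regr : is_regression_fun Q f.
Local Open Scope ereal_scope.

Definition errors (G : set (euclid R d)) : set (sample R d) :=
  [set z | z.2 != (z.1 \in G)].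

Lemma measurable_label (A : set (euclid R d)) (b : bool) : measurable A ->
  measurable (A `*` [set b]).
Proof. by move=> mA; exact: measurableX. Qed.

Lemma errorsE G : errors G = (G `*` [set false]) `|` (~` G `*` [set true]).
Proof.
apply/seteqP; split => -[x b] /=; rewrite /errors /=.
  have [xG|xG] := pselect (G x).
    by rewrite mem_set//; case: b => // _; left.
  by rewrite memNset//; case: b => // _; right.
move=> [[xG ->]|[xG ->]]; first by rewrite mem_set.
by rewrite memNset.
Qed.

Lemma measurable_errors G : measurable G -> measurable (errors G).
Proof.
move=> mG; rewrite errorsE; apply: measurableU; apply: measurable_label => //.
exact: measurableC.
Qed.

Let mf : measurable_fun setT f. Proof. by case: f_regr. Qed.
Let f01 x : (0 <= f x <= 1)%R. Proof. by case: f_regr. Qed.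

Lemma label_true A : measurable A ->
  Q (A `*` [set true]) = \int[marginal Q]_(x in A) (f x)%:E.
Proof. by case: f_regr => _ _; exact. Qed.

Lemma label_split A : measurable A ->
  Q (A `*` [set true]) + Q (A `*` [set false]) = marginal Q A.
Proof.
move=> mA; rewrite -measureU; [|exact: measurable_label..|].
  rewrite /marginal /pushforward; congr (Q _); apply/seteqP; split => -[x b] /=.
    by move=> [] [].
  by case: b => xA; [left|right].
by apply/seteqP; split => // -[x b] /= [[_ ->] [_]].
Qed.

Lemma label_false A : measurable A ->
  Q (A `*` [set false]) = \int[marginal Q]_(x in A) (1 - f x)%:E.
Proof.
move=> mA.
have := label_split mA; rewrite label_true//.
have -> : marginal Q A = \int[marginal Q]_(x in A) (f x)%:E +
    \int[marginal Q]_(x in A) (1 - f x)%:E.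
  rewrite -ge0_integralD//=; last 4 first.
  - by move=> x _; rewrite lee_fin; have /andP[] := f01 x.
  - by apply/measurable_EFinP; exact: measurable_funTS.
  - by move=> x _; rewrite lee_fin subr_ge0; have /andP[] := f01 x.
  - by apply/measurable_EFinP; apply: measurable_funB => //; exact: measurable_funTS.
  rewrite -[LHS]mul1e -integral_cst//; apply: eq_integral => x _.
  by rewrite -EFinD addrC subrK.
move=> H.
have fin : \int[marginal Q]_(x in A) (f x)%:E \is a fin_num.
  by rewrite -label_true// fin_num_measure//; exact: measurable_label.
by rewrite -[LHS](addeK _ fin) [X in X - _]addeC H [X in X - _]addeC (addeK _ fin).
Qed.

(** Pointwise on [A], [1 - f = f + |2 f - 1|]. *)
Lemma label_below A : measurable A -> (forall x, A x -> f x < 2^-1)%R ->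
  Q (A `*` [set false]) =
  Q (A `*` [set true]) + \int[marginal Q]_(x in A) `|2 * f x - 1|%:E.
Proof.
move=> mA fA; rewrite label_true// label_false// -ge0_integralD//=; last 3 first.
- by move=> x _; rewrite lee_fin; have /andP[] := f01 x.
- by apply/measurable_EFinP; exact: measurable_funTS.
- apply/measurable_EFinP; apply: measurableT_comp => //; apply: measurable_funB => //.
  by apply: measurable_funM => //; exact: measurable_funTS.
apply: eq_integral => x /set_mem Ax; rewrite -EFinD; congr _%:E.
have := fA _ Ax => fx; rewrite ltr0_norm; lra.
Qed.

Lemma label_above A : measurable A -> (forall x, A x -> 2^-1 <= f x)%R ->
  Q (A `*` [set true]) =
  Q (A `*` [set false]) + \int[marginal Q]_(x in A) `|2 * f x - 1|%:E.
Proof.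
move=> mA fA; rewrite label_true// label_false// -ge0_integralD//=; last 3 first.
- by move=> x _; rewrite lee_fin subr_ge0; have /andP[] := f01 x.
- by apply/measurable_EFinP; apply: measurable_funB => //; exact: measurable_funTS.
- apply/measurable_EFinP; apply: measurableT_comp => //; apply: measurable_funB => //.
  by apply: measurable_funM => //; exact: measurable_funTS.
apply: eq_integral => x /set_mem Ax; rewrite -EFinD; congr _%:E.
have := fA _ Ax => fx; rewrite ger0_norm; lra.
Qed.

Let G0 := bayes_rule f.

Lemma measurable_bayes : measurable G0.
Proof.
rewrite /G0 (_ : bayes_rule f = unit_cube `&` f @^-1` `[2^-1%R, +oo[); last first.
  by apply/seteqP; split => x; rewrite /bayes_rule /= in_itv /= andbT.
apply: measurableI; first exact: unit_cube_measurable.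
by rewrite -[X in measurable X]setTI; apply: mf => //; exact: measurable_itv.
Qed.

Lemma excess_risk_split G : measurable G ->
  excess_risk Q f G G0 = \int[marginal Q]_(x in G `\` G0) `|2 * f x - 1|%:E +
    \int[marginal Q]_(x in G0 `\` G) `|2 * f x - 1|%:E.
Proof.
move=> mG; have mG0 := measurable_bayes.
rewrite /excess_risk ge0_integral_setU//=.
- exact: measurableD.
- exact: measurableD.
- apply/measurable_EFinP; apply: measurableT_comp => //; apply: measurable_funB => //.
  by apply: measurable_funM => //; exact: measurable_funTS.
- by apply/disj_setPS => x [[_ ?] []].
Qed.

(* The two sides differ only on the symmetric difference of [G] and the Bayes
   rule, and there the label probabilities are on the expected side of 1/2. *)
Lemma risk_excess G : measurable G -> G `<=` unit_cube ->
  Q (errors G) = Q (errors G0) + excess_risk Q f G G0.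
Proof.
move=> mG Gc; have mG0 := measurable_bayes.
have mD1 : measurable (G `\` G0) by exact: measurableD.
have mD2 : measurable (G0 `\` G) by exact: measurableD.
have mI : measurable (G `&` G0) by exact: measurableI.
have mC : measurable (~` (G `|` G0)) by apply: measurableC; exact: measurableU.
(* The errors of [A], cut along [B]. The first and the last term are symmetric in [A] and [B], hence
   common to [G] and the Bayes rule. *)
have split4 (A B : set (euclid R d)) : measurable A -> measurable B ->
    Q (errors A) = Q ((A `&` B) `*` [set false]) + Q ((A `\` B) `*` [set false]) +
      Q ((B `\` A) `*` [set true]) + Q ((~` (A `|` B)) `*` [set true]).
  move=> mA mB; rewrite errorsE.
  have -> : A `*` [set false] `|` ~` A `*` [set true] =
     ((A `&` B) `*` [set false] `|` (A `\` B) `*` [set false] `|`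
      (B `\` A) `*` [set true]) `|` (~` (A `|` B)) `*` [set true].
    apply/seteqP; split => -[x b] /=; last by tauto.
    move=> [[Ax ->]|[Ax ->]]; have [Bx|Bx] := pselect (B x); tauto.
  have mAB : measurable (A `\` B) by exact: measurableD.
  have mBA : measurable (B `\` A) by exact: measurableD.
  have mAIB : measurable (A `&` B) by exact: measurableI.
  have mCU : measurable (~` (A `|` B)) by apply: measurableC; exact: measurableU.
  have l1 := measurable_label false mAIB; have l2 := measurable_label false mAB.
  have l3 := measurable_label true mBA; have l4 := measurable_label true mCU.
  rewrite measureU; [|by apply: measurableU => //; exact: measurableU|by []|]; last first.
    by apply/seteqP; split => // -[x b] /=; intuition congruence.
  rewrite measureU; [|by apply: measurableU|by []|]; last first.
    by apply/seteqP; split => // -[x b] /=; intuition congruence.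
  rewrite measureU//.
  by apply/seteqP; split => // -[x b] /=; tauto.
rewrite (split4 G G0)// (split4 G0 G)// [G0 `&` G]setIC [G0 `|` G]setUC.
(* [bayes_rule] is cut down to the cube. Since [G] lies in the cube too, a point of [G] missing from
   it must have [f < 1/2]. *)
rewrite (label_below mD1); last first.
  by move=> x [/Gc cx Gx]; rewrite ltNge; apply/negP => fx; apply: Gx.
rewrite (label_above mD2); last by move=> x [[]].
rewrite excess_risk_split//.
set a := Q _; set b := Q _; set c := Q _; set e := Q _.
set u := integral _ _ _; set v := integral _ _ _.
by rewrite (AC (1*2*2*1) (1*4*2*6*(3*5))).
Qed.

End risk.

(** * Exponential moments of loss differences *)

Section concentration.
Variable R : realType.

(* For [t > 0], square the bound [expR (t / 2) <= (1 - t / 2)^-1]. *)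
Lemma expR_le_quadratic (t : R) : `|t| <= 4^-1 -> expR t <= 1 + t + t ^+ 2.
Proof.
rewrite ler_norml => /andP[t1 t2].
have inv (s : R) : s < 1 -> expR s <= (1 - s)^-1.
  move=> s1; rewrite -[s]opprK expRN opprK lef_pV2 ?posrE ?expR_gt0 ?subr_gt0//.
  exact: expR_ge1Dx.
have [t0|t0] := leP t 0.
  apply: le_trans (inv _ _) _; first lra.
  have p : 0 < 1 - t by lra.
  rewrite -(ler_pM2r p) mulVf ?gt_eqF//; nra.
have -> : t = t / 2 + t / 2 by field.
rewrite expRD.
have p : 0 < 1 - t / 2 by lra.
have e : expR (t / 2) <= (1 - t / 2)^-1 by apply: inv; lra.
apply: (@le_trans _ _ ((1 - t / 2)^-1 * (1 - t / 2)^-1)).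
  by rewrite ler_pM// expR_ge0.
rewrite -invfM -(ler_pM2r (mulr_gt0 p p)) mulVf ?gt_eqF ?mulr_gt0//.
have -> : (1 + (t / 2 + t / 2) + (t / 2 + t / 2) ^+ 2) * ((1 - t / 2) * (1 - t / 2)) =
  1 + t ^+ 2 / 4 * (1 - 3 * t + t ^+ 2) by field.
by rewrite lerDl mulr_ge0//; nra.
Qed.

Section mgf.
Variables (d : nat) (Q : probability (sample R d) R).
Variables (G G0 : set (euclid R d)).
Hypotheses (mG : measurable G) (mG0 : measurable G0).

Definition loss_ratio (lam : R) (z : sample R d) : R :=
  expR (- (lam * (\1_(errors G) z - \1_(errors G0) z))).

Lemma measurable_loss_ratio lam : measurable_fun setT (loss_ratio lam).
Proof.
apply: measurableT_comp => //; apply: measurableT_comp => //.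
apply: measurable_funM => //; apply: measurable_funB.
  by apply: measurable_indic; exact: measurable_errors.
by apply: measurable_indic; exact: measurable_errors.
Qed.

Local Open Scope ereal_scope.

(** Integrates the quadratic bound on the exponential; the squared loss difference is at most the
    indicator of [G]+[G0]. In use, [r] is the Bayes risk, and [D] and [d0] are the excess risks of
    the two sets. *)
Lemma loss_ratio_mgf (lam r D d0 v : R) : (0 <= lam <= 4^-1)%R ->
  Q (errors G) = (r + D)%:E -> Q (errors G0) = (r + d0)%:E ->
  marginal Q (G `+` G0) <= v%:E ->
  \int[Q]_z (loss_ratio lam z)%:E <= (1 - lam * (D - d0) + lam ^+ 2 * v)%:E.
Proof.
move=> /andP[lam0 lam4] QG QG0 Qv.
have mE := measurable_errors mG; have mE0 := measurable_errors mG0.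
have mD : measurable (@fst (euclid R d) bool @^-1` (G `+` G0)).
  rewrite -[X in measurable X]setTI; apply: measurable_fst => //.
  by apply: measurableU; exact: measurableD.
have ml := measurable_loss_ratio lam.
have mI (A : set (sample R d)) : measurable A ->
    measurable_fun setT (fun z => (\1_A z : R)%:E).
  by move=> mA; apply/measurable_EFinP; exact: measurable_indic.
(* The term [lam * \1_(errors G)] is moved to the left, so that all integrands are nonnegative and
   the integrals split in the extended reals. *)
have key : \int[Q]_z ((loss_ratio lam z)%:E + lam%:E * (\1_(errors G) z)%:E) <=
    \int[Q]_z (1 + lam%:E * (\1_(errors G0) z)%:E +
      (lam ^+ 2)%:E * (\1_(fst @^-1` (G `+` G0)) z)%:E).
  apply: ge0_le_integral_nonmeasurable => z.
    by rewrite adde_ge0 ?mule_ge0 ?lee_fin ?expR_ge0.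
  rewrite -!EFinM -!EFinD lee_fin /loss_ratio.
  set x := \1_(errors G) z : R; set y := \1_(errors G0) z : R.
  set w := \1_(_) z : R.
  have hw : ((x - y) ^+ 2 <= w)%R.
    have b01 (A : set (sample R d)) : ((\1_A z : R) = 0 \/ (\1_A z : R) = 1)%R.
      by rewrite indicE; case: (_ \in _); [right|left].
    have [zD|zD] := pselect ((G `+` G0) z.1).
      rewrite /w indicE mem_set//= /x /y.
      by case: (b01 (errors G)) => ->; case: (b01 (errors G0)) => ->; lra.
    have -> : x = y.
      rewrite /x /y !indicE.
      suff zGG0 : (z.1 \in G) = (z.1 \in G0).
        by congr ((_ : bool)%:R); apply/idP/idP => /set_mem; rewrite /errors /= => h;
          apply/mem_set; rewrite /errors /=; [rewrite -zGG0|rewrite zGG0].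
      apply/idP/idP => /set_mem zG; apply/mem_set; apply: contrapT => zG0; apply: zD;
        by [left|right].
    by rewrite subrr expr0n /w indicE.
  have s1 : (`|x - y| <= 1)%R.
    by rewrite /x /y !indicE; case: (_ \in _); case: (_ \in _); rewrite ?subrr ?subr0 ?sub0r ?normrN ?normr0 ?normr1.
  have := @expR_le_quadratic (- (lam * (x - y))).
  rewrite normrN normrM (ger0_norm lam0) sqrrN exprMn => /(_ _)/wrap[].
    by rewrite -[leRHS]mulr1 ler_pM.
  move=> h; have : (lam ^+ 2 * (x - y) ^+ 2 <= lam ^+ 2 * w)%R.
    by rewrite ler_wpM2l// sqr_ge0.
  lra.
move: key; rewrite ge0_integralD//=; last 4 first.
- by move=> z _; rewrite lee_fin expR_ge0.
- exact/measurable_EFinP.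
- by move=> z _; rewrite mule_ge0// lee_fin.
- by apply: emeasurable_funM => //; exact: mI.
have Zl (A : set (sample R d)) (k : R) : measurable A -> (0 <= k)%R ->
    \int[Q]_z (k%:E * (\1_A z)%:E) = k%:E * Q A.
  move=> mA k0; rewrite ge0_integralZl//; last exact: mI.
  by rewrite integral_indic// setIT.
rewrite Zl// ge0_integralD//=; last 4 first.
- by move=> z _; rewrite adde_ge0// mule_ge0// lee_fin.
- by apply: emeasurable_funD => //; apply: emeasurable_funM => //; exact: mI.
- by move=> z _; rewrite mule_ge0// lee_fin// sqr_ge0.
- by apply: emeasurable_funM => //; exact: mI.
rewrite ge0_integralD//=; last 2 first.
- by move=> z _; rewrite mule_ge0// lee_fin.
- by apply: emeasurable_funM => //; exact: mI.
rewrite integral_cst// mul1e.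
rewrite [X in _ <= X + _ + _ -> _](_ : _ = 1); last exact: probability_setT.
rewrite !Zl ?sqr_ge0//.
rewrite QG QG0 -!EFinM => key.
have : \int[Q]_z (loss_ratio lam z)%:E + (lam * (r + D))%:E <=
   1 + (lam * (r + d0))%:E + (lam ^+ 2 * v)%:E.
  apply: le_trans key _; by rewrite leeD2l// [leRHS]EFinM lee_wpmul2l// lee_fin sqr_ge0.
rewrite -leeBrDr// => /le_trans; apply; rewrite -!EFinD lee_fin; lra.
Qed.

End mgf.
End concentration.

(** * The empirical risk minimizer *)

Section erm.
Variables (R : realType) (d : nat) (Q : probability (sample R d) R).
Variables (f : euclid R d -> R).
Hypothesis f_regr : is_regression_fun Q f.

Definition real_excess (G : set (euclid R d)) : R :=
  fine (excess_risk Q f G (bayes_rule f)).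

Lemma excess_risk_le1 G : measurable G -> (excess_risk Q f G (bayes_rule f) <= 1)%E.
Proof.
have [mf f01 _] := f_regr; move=> mG.
have mGG : measurable (G `+` bayes_rule f).
  by apply: measurableU; apply: measurableD => //; exact: (measurable_bayes f_regr).
apply: (@le_trans _ _ (\int[marginal Q]_(x in G `+` bayes_rule f) 1)%E).
  apply: ge0_le_integral => //.
  - by apply/measurable_EFinP; apply: measurableT_comp => //;
      apply: measurable_funB => //; apply: measurable_funM => //; exact: measurable_funTS.
  - by move=> x _; rewrite lee_fin ler_norml; have /andP[] := f01 x; lra.
by rewrite integral_cst// mul1e; exact: probability_le1.
Qed.

Lemma excess_risk_ge0 G : (0 <= excess_risk Q f G (bayes_rule f))%E.
Proof. by apply: integral_ge0 => x _; rewrite lee_fin. Qed.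

Lemma real_excessE G : measurable G ->
  excess_risk Q f G (bayes_rule f) = (real_excess G)%:E.
Proof.
move=> mG; rewrite fineK// fin_numElt (lt_le_trans _ (excess_risk_ge0 _))//=.
  by rewrite (le_lt_trans (excess_risk_le1 mG))// ltry.
Qed.

Lemma real_excess_itv G : measurable G -> 0 <= real_excess G <= 1.
Proof.
move=> mG; rewrite -!lee_fin -real_excessE//.
by rewrite excess_risk_ge0 excess_risk_le1.
Qed.

Lemma sym_diff_dist_triangle (G1 G2 G3 : set (euclid R d)) :
  measurable G1 -> measurable G2 -> measurable G3 ->
  (marginal Q (G1 `+` G2) <= marginal Q (G1 `+` G3) + marginal Q (G2 `+` G3))%E.
Proof.
move=> m1 m2 m3.
have mY A B : measurable A -> measurable B -> measurable (A `+` B : set (euclid R d)).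
  by move=> mA mB; apply: measurableU; exact: measurableD.
apply: (@le_trans _ _ (marginal Q ((G1 `+` G3) `|` (G2 `+` G3)))).
  apply: le_measure; rewrite ?inE; [exact: mY|apply: measurableU; exact: mY|].
  move=> x [[x1 x2]|[x1 x2]]; have [x3|x3] := pselect (G3 x).
  - by right; right.
  - by left; left.
  - by left; right.
  - by right; left.
by apply: measureU2; exact: mY.
Qed.

(** Exponential Markov inequality in pointwise form: the product is the exponential of [- lam] times
    the difference of the numbers of errors on the sample. *)
Lemma empirical_risk_loss n (z : n.-tuple (sample R d)) G G0 lam : 0 <= lam ->
  empirical_risk z G <= empirical_risk z G0 ->
  1 <= \prod_(i < n) loss_ratio G G0 lam (tnth z i).
Proof.
move=> lam0 GG0; rewrite /loss_ratio -expR_sum -(@expR0 R) ler_expR.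
rewrite sumrN -mulr_sumr sumrB oppr_ge0 mulr_ge0_le0// subr_le0.
have errE A (u : sample R d) : \1_(errors A) u = (u.2 != (u.1 \in A))%:R :> R.
  by rewrite indicE; congr ((_ : bool)%:R); apply/idP/idP => [/set_mem//|?]; apply/mem_set.
under eq_bigr do rewrite errE; under [leRHS]eq_bigr do rewrite errE.
case: n z GG0 => [|n] z; first by rewrite !big_ord0.
by rewrite /empirical_risk ler_pM2l// invr_gt0 ltr0n.
Qed.

(** Write [D] and [d0] for the excess risks of [G] and [G0]. As [d0 <= D / 2], the exponent is at
    most [- lam * D / 2 + lam ^ 2 * A * D ^ (1 / kap)]. The chosen [lam] minimizes this expression,
    with minimum [- D ^ (2 - 1 / kap) / (16 * A)]. *)
Lemma loss_ratio_margin (G G0 : set (euclid R d)) (kap A t : R) :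
  measurable G -> G `<=` unit_cube -> measurable G0 -> G0 `<=` unit_cube ->
  1 <= kap -> 1 <= A -> 0 < t ->
  (sym_diff_dist Q G (bayes_rule f) <= (A / 2 * real_excess G `^ kap^-1)%:E)%E ->
  (sym_diff_dist Q G0 (bayes_rule f) <= (A / 2 * real_excess G0 `^ kap^-1)%:E)%E ->
  2 * real_excess G0 <= t -> t < real_excess G ->
  (\int[Q]_z (loss_ratio G G0 (real_excess G `^ (1 - kap^-1) / (4 * A)) z)%:E <=
    (expR (- (t `^ (2 - kap^-1) / (16 * A))))%:E)%E.
Proof.
move=> mG cG mG0 cG0 kap1 A1 t0 dG dG0 G0t tG.
have kap0 : 0 < kap by lra.
have k1 : kap^-1 <= 1 by rewrite invf_le1.
have ki : 0 < kap^-1 by rewrite invr_gt0.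
have := real_excess_itv mG; have := real_excess_itv mG0.
have EG := risk_excess f_regr mG cG; have EG0 := risk_excess f_regr mG0 cG0.
move: EG EG0; rewrite !real_excessE//.
set D := real_excess G in dG tG *; set d0 := real_excess G0 in dG0 G0t *.
move=> EG EG0 /andP[d00 d01] /andP[D0 D1].
have [r0 rE] : exists r0, Q (errors (bayes_rule f)) = r0%:E.
  exists (fine (Q (errors (bayes_rule f)))); rewrite fineK// fin_num_measure//.
  by apply: measurable_errors; exact: (measurable_bayes f_regr).
rewrite rE -EFinD in EG; rewrite rE -EFinD in EG0.
set lam := _ / _.
have DK : 0 <= D `^ (1 - kap^-1) <= 1.
  have one : 1 `^ (1 - kap^-1) = 1 :> R by rewrite powR1.
  by rewrite powR_ge0 -[X in _ && (_ <= X)]one ge0_ler_powR// ?subr_ge0// nnegrE.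
have A0 : 0 < A by lra.
(* [D <= 1] and [A >= 1] keep [lam] in the range of the quadratic bound. *)
have lam01 : 0 <= lam <= 4^-1.
  move/andP: DK => [DK0 DK1]; rewrite divr_ge0//=; last by lra.
  rewrite /lam invfM mulrCA ler_piMr// ler_pdivrMr//; lra.
(* Triangle inequality through the Bayes rule; each set contributes [A / 2] because [d0 <= D]. *)
have vA : (marginal Q (G `+` G0) <= (A * D `^ kap^-1)%:E)%E.
  apply: le_trans (sym_diff_dist_triangle mG mG0 (measurable_bayes f_regr)) _.
  apply: le_trans (leeD dG dG0) _; rewrite -EFinD lee_fin.
  rewrite [X in _ <= X * _](splitr A) mulrDl lerD2l.
  by rewrite ler_wpM2l ?ge0_ler_powR ?nnegrE ?divr_ge0 ?(ltW ki) ?(ltW A0)//; lra.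
apply: le_trans (loss_ratio_mgf mG mG0 lam01 EG EG0 vA) _.
rewrite lee_fin.
have DD0 : 0 < D by lra.
set P := D `^ (2 - kap^-1).
have e1 : D `^ (1 - kap^-1) * D = P.
  rewrite /P -[X in _ * X](powRr1 D0) -powRD; last by rewrite (gt_eqF DD0) implybT.
  by congr (_ `^ _); ring.
have e2 : D `^ (1 - kap^-1) * (D `^ (1 - kap^-1) * D `^ kap^-1) = P.
  rewrite /P -!powRD; last 2 first.
    by rewrite (gt_eqF DD0) implybT.
    by rewrite (gt_eqF DD0) implybT.
  by congr (_ `^ _); ring.
have tP : t `^ (2 - kap^-1) <= P.
  by rewrite ge0_ler_powR ?nnegrE ?(ltW t0) ?(ltW tG)//; lra.
apply: le_trans (expR_ge1Dx _); rewrite -addrA lerD2l.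
have -> : - (lam * (D - d0)) + lam ^+ 2 * (A * D `^ kap^-1) =
   - (P * (16 * A)^-1) - lam * (D / 2 - d0).
  have -> : lam ^+ 2 * (A * D `^ kap^-1) = P / (16 * A).
    by rewrite -e2 /lam; field; rewrite gt_eqF.
  have -> : lam * (D - d0) = P / (8 * A) + lam * (D / 2 - d0).
    by rewrite -e1 /lam; field; rewrite gt_eqF.
  by field; rewrite gt_eqF.
have l0 : 0 <= lam * (D / 2 - d0) by rewrite mulr_ge0//; [case/andP: lam01|lra].
have : t `^ (2 - kap^-1) / (16 * A) <= P * (16 * A)^-1.
  by rewrite ler_wpM2r// invr_ge0; lra.
lra.
Qed.

(** The loss [Psi] is left abstract so that powers of the excess risk and of the symmetric
    difference are treated at once. With [a] the bound on the good sets, the pointwise inequality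
    behind the result is [Psi (Ghat z) <= a + \sum_s prd s z]. *)
Lemma erm_expectation (S : finType) (dec : S -> set (euclid R d))
    (N : set (set (euclid R d))) n (Ghat : n.-tuple (sample R d) -> set (euclid R d))
    (G0 : set (euclid R d)) (kap A t a : R) (Psi : set (euclid R d) -> \bar R) :
  (forall G, N G -> exists s, dec s = G) ->
  (forall G, N G -> measurable G /\ G `<=` unit_cube) ->
  (forall z, N (Ghat z) /\
     forall G, N G -> empirical_risk z (Ghat z) <= empirical_risk z G) ->
  1 <= kap -> 1 <= A -> 0 < t -> 0 <= a ->
  (forall G, N G ->
     (sym_diff_dist Q G (bayes_rule f) <= (A / 2 * real_excess G `^ kap^-1)%:E)%E) ->
  N G0 -> 2 * real_excess G0 <= t ->
  (forall G, N G -> 0 <= Psi G <= 1)%E ->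
  (forall G, N G -> real_excess G <= t -> (Psi G <= a%:E)%E) ->
  (expectation_iid Q (fun z => Psi (Ghat z)) <=
   (a + #|S|%:R * expR (- (n%:R * (t `^ (2 - kap^-1) / (16 * A)))))%:E)%E.
Proof.
move=> decN mN GhatN kap1 A1 t0 a0 margN NG0 G0t Psi01 Psia.
(* Codes of sets outside [N] are discarded here: nothing is known about them. *)
pose bad s := `[< N (dec s) /\ t < real_excess (dec s) >].
pose lam s := real_excess (dec s) `^ (1 - kap^-1) / (4 * A).
pose prd s (z : n.-tuple (sample R d)) :=
  if bad s then \prod_(i < n) loss_ratio (dec s) G0 (lam s) (tnth z i) else 0.
have prd0 s z : 0 <= prd s z.
  by rewrite /prd; case: ifP => // _; rewrite prodr_ge0// => i _; exact: expR_ge0.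
have lam0 s : 0 <= lam s by rewrite divr_ge0 ?powR_ge0//; lra.
have [mG0 cG0] := mN _ NG0.
have mprd s : measurable_fun setT (fun z => (prd s z)%:E).
  apply/measurable_EFinP; rewrite /prd; case: (boolP (bad s)) => [/asboolP[/mN[mG _] _]|_]; last exact: measurable_cst.
  apply: measurable_prod => i _; apply: measurableT_comp; last exact: measurable_tnth.
  exact: measurable_loss_ratio.
have mass1 : power_measure Q n [set: n.-tuple (sample R d)] = 1%E.
  have := @power_measure_box _ _ R Q n (fun=> setT) (fun=> measurableT).
  rewrite big1 => [<-|i _]; last exact: probability_setT.
  by congr (power_measure Q n _); apply/seteqP; split.
rewrite /expectation_iid.
apply: (@le_trans _ _
  (\int[power_measure Q n]_z (a%:E + \sum_s (prd s z)%:E))%E).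
  apply: ge0_le_integral_nonmeasurable => z; have [Nz erm] := GhatN z.
    by case/andP: (Psi01 _ Nz).
  have [zt|zt] := leP (real_excess (Ghat z)) t.
    apply: le_trans (Psia _ Nz zt) _; rewrite leeDl// sume_ge0// => s _.
    by rewrite lee_fin.
  have [s sE] := decN _ Nz.
  (* The selected set is itself bad; its own product is at least 1 and so dominates [Psi]. *)
  have bs : bad s by apply/asboolP; rewrite sE.
  case/andP: (Psi01 _ Nz) => _ /le_trans; apply.
  rewrite (bigD1 s)//= addeCA.
  apply: (@le_trans _ _ (prd s z)%:E).
    by rewrite lee_fin /prd bs sE empirical_risk_loss// ?erm// -sE.
  by rewrite leeDl// adde_ge0// ?lee_fin// sume_ge0// => s' _; rewrite lee_fin.
rewrite ge0_integralD//=; last 2 first.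
- by move=> z _; apply: sume_ge0 => s _; rewrite lee_fin.
- exact: emeasurable_sum.
rewrite integral_cst// [X in (_ * X)%E]mass1 mule1 EFinD leeD2l//.
rewrite ge0_integral_sum//=; last by move=> s z _; rewrite lee_fin.
apply: (@le_trans _ _ (\sum_(s : S)
    (expR (- (n%:R * (t `^ (2 - kap^-1) / (16 * A)))))%:E)%E); last first.
  by rewrite sumEFin sumr_const lee_fin [leRHS]mulr_natl.
apply: lee_sum => s _; rewrite /prd; have [bs|bs] := boolP (bad s); last first.
  by rewrite integral0_eq// lee_fin expR_ge0.
have [Ns ts] := asboolP _ bs; have [mG cG] := mN _ Ns.
apply: le_trans.
  apply: (@integral_prod_power_measure _ _ R Q _ _ n).
  - exact: measurable_loss_ratio.
  - by move=> z; exact: expR_ge0.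
  - exact: loss_ratio_margin kap1 A1 t0 (margN _ Ns) (margN _ NG0) G0t ts.
by rewrite lee_fin -expRM_natl mulrN.
Qed.

End erm.

(** * Geometry of the Bayes rule *)

Section grid_rounding.
Variable R : realType.

Lemma grid_floor (c : nat) (x : R) : -1 <= x <= 1 ->
  exists2 w, weight_grid c w & w <= x < w + 2^-1 ^+ c.
Proof.
move=> /andP[x1 x2].
have p : 0 < (2 : R) ^+ c by rewrite exprn_gt0.
have := floor_itv (x * 2 ^+ c); set k := Num.floor _ => /andP[k1 k2].
exists (k%:~R / 2 ^+ c).
  exists k; split => //; apply/andP; split.
    rewrite /k floor_ge_int ?rmorphN ?rmorphXn /=.
    by rewrite -mulN1r ler_pM2r.
  rewrite -(@ler_int R) rmorphXn /=; apply: le_trans k1 _.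
  by rewrite -[leRHS]mul1r ler_pM2r.
rewrite ler_pdivrMr// k1 /= exprVn -[X in _ + X]mul1r -mulrDl ltr_pdivlMr//.
by rewrite intrD in k2.
Qed.
End grid_rounding.

Section graph_boundary.
Variables (R : realType) (d : nat).
Implicit Types (x : euclid R d) (a b : 'I_d -> R).

Lemma xcoord_replace (j : 'I_d) (t : R) x i :
  xcoord (replace_coord j t x) i = if i == j then t else xcoord x i.
Proof. by rewrite /xcoord tnth_mktuple. Qed.

Lemma replace_coord_id (j : 'I_d) (t : R) x :
  replace_coord j (xcoord x j) (replace_coord j t x) = x.
Proof.
apply: eq_from_tnth => i; rewrite -/(xcoord _ i) !xcoord_replace.
by case: eqP => [->|].
Qed.

Lemma remove_replace (j : 'I_d) (t : R) x :
  remove_coord j (replace_coord j t x) = remove_coord j x.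
Proof.
apply: eq_from_tnth => i; rewrite !tnth_mktuple.
by rewrite [_ == j]eq_sym (negbTE (neq_lift _ _)).
Qed.

(** The point is interior to the first box but may lie on a face of the second. As the second box is
    nondegenerate, the intersection is still a box of positive volume. *)
Lemma boxes_overlap a b a' b' x : (forall i, a i < b i) -> (forall i, a' i < b' i) ->
  (forall i, a i < xcoord x i < b i) -> box a' b' x ->
  lebesgue_tuple R d (box a b `&` box a' b') <> 0%E.
Proof.
move=> ab ab' xab xab'.
pose lo i := Num.max (a i) (a' i); pose hi i := Num.min (b i) (b' i).
have lohi i : lo i < hi i.
  have /andP[x1 x2] := xab i; have /andP[x3 x4] := xab' i.
  rewrite /lo /hi gt_max !lt_min ab ab' /= andbT.
  by rewrite (lt_le_trans x1)// (le_lt_trans x3).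
have -> : box a b `&` box a' b' = box lo hi.
  apply/seteqP; split => y; rewrite /box /=.
    by move=> [y1 y2] i; rewrite ge_max le_min; case/andP: (y1 i) => -> ->;
      case/andP: (y2 i) => -> ->.
  by move=> yi; split => i; have := yi i; rewrite ge_max le_min => /andP[/andP[? ?] /andP[? ?]];
    apply/andP.
rewrite lebesgue_tuple_box; last by move=> i; exact/ltW.
move=> /eqP; rewrite eqe => /eqP/eqP; rewrite gt_eqF// prodr_gt0// => i _.
by rewrite subr_gt0.
Qed.

(* Just above the graph of [gamma], inside the box [D nu], no piece is left. *)
Lemma graph_in_boundary u (j : 'I_u -> 'I_d) (iota : 'I_u -> R)
    (gamma : 'I_u -> euclid R d.-1 -> R) (a b : 'I_u -> 'I_d -> R)
    (Hs : 'I_u -> set (euclid R d)) (nu : 'I_u) x (y : R) :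
  (forall nu, iota nu = -1 \/ iota nu = 1) ->
  (forall nu i, 0 <= a nu i /\ a nu i < b nu i /\ b nu i <= 1) ->
  (forall nu, Hs nu = box (a nu) (b nu) `&` [set x | unit_cube x /\
     iota nu * xcoord x (j nu) <= gamma nu (remove_coord (j nu) x)]) ->
  (forall nu1 nu2, nu1 != nu2 -> lebesgue_tuple R d
     (box (a nu1) (b nu1) `&` box (a nu2) (b nu2)) = 0%E) ->
  (forall i, i != j nu -> a nu i < xcoord x i < b nu i) ->
  y = gamma nu (remove_coord (j nu) x) ->
  a nu (j nu) <= iota nu * y <= b nu (j nu) ->
  (exists2 e, 0 < e & forall s, 0 < s < e ->
     a nu (j nu) < iota nu * (y + s) < b nu (j nu)) ->
  (box (a nu) (b nu) `&` cube_boundary (\bigcup_nu Hs nu))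
    (replace_coord (j nu) (iota nu * y) x).
Proof.
move=> iota1 ab HsE disj xin yE yin [e0 e00 ey].
have cube_box mu z : box (a mu) (b mu) z -> unit_cube z.
  move=> zb i; have [a0 [_ b1]] := ab mu i; have /andP[z1 z2] := zb i.
  by rewrite (le_trans a0)// (le_trans z2).
have inbox t : a nu (j nu) <= t <= b nu (j nu) ->
    box (a nu) (b nu) (replace_coord (j nu) t x).
  move=> tin i; rewrite xcoord_replace; case: eqP => [->//|/eqP ij].
  by have /andP[x1 x2] := xin _ ij; rewrite !ltW.
have iota2 t : iota nu * (iota nu * t) = t.
  by case: (iota1 nu) => ->; rewrite ?mul1r ?mulN1r ?opprK.
set x' := replace_coord _ _ _; have x'b : box (a nu) (b nu) x' by exact: inbox.
split=> //; split; first exact: cube_box x'b.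
split.
  apply: subset_closure; exists x' => //; split; first exact: cube_box x'b.
  exists nu => //; rewrite HsE; split=> //; split; first exact: cube_box x'b.
  by rewrite xcoord_replace eqxx remove_replace iota2 yE.
move=> U /nbhs_ballP[e /= e1 Ue].
pose s := Num.min e e0 / 2.
have s0 : 0 < s by rewrite divr_gt0// lt_min e1.
have se : s < Num.min e e0 by rewrite /s ltr_pdivrMr// ltr_pMr ?lt_min ?e1// ltr1n.
move: (se); rewrite lt_min => /andP[se1 se0].
pose z := replace_coord (j nu) (iota nu * (y + s)) x.
have zin : a nu (j nu) < iota nu * (y + s) < b nu (j nu) by rewrite ey// s0.
have zint i : a nu i < xcoord z i < b nu i.
  by rewrite xcoord_replace; case: eqP => [->//|/eqP ij]; exact: xin.
have zb : box (a nu) (b nu) z by move=> i; have /andP[] := zint i => *; rewrite !ltW.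
exists (to_col z); split.
  exists z => //; split; first exact: cube_box zb.
  move=> [mu _]; rewrite HsE => -[zmu [_]].
  (* In its own piece, [z] lies above the graph. In another piece it would force two boxes to
     overlap in positive volume, [z] being interior to the box of [nu]. *)
  have [->|numu] := eqVneq mu nu.
    by rewrite xcoord_replace eqxx remove_replace iota2 -yE gerDl leNgt s0.
  move=> _; rewrite eq_sym in numu; apply: (boxes_overlap _ _ zint zmu (disj _ _ numu)).
    by move=> i; have [_ []] := ab nu i.
  by move=> i; have [_ []] := ab mu i.
apply: Ue; split=> // i k; rewrite /ball /= !mxE !xcoord_replace; case: eqP => _; last first.
  by rewrite subrr normr0.
rewrite -mulrBr opprD addNKr mulrN normrN normrM (gtr0_norm s0).
by case: (iota1 nu) => ->; rewrite ?normrN normr1 mul1r.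
Qed.

End graph_boundary.

(** * The error made by a single piece *)

Section piece_error.
Variable R : realType.

(* [th] contracts the height [y] towards the middle of [[a, b]], so that the test
   [T <= 0] fails everywhere on [[a, b]] when [gam < a] and holds everywhere when
   [b <= gam], although [r] only approximates [gam]. *)
Lemma threshold_error (a b y gam r th q eps eta eps2 k T : R) :
  a < y < b -> eps2 <= b - a -> b - a <= 1 -> 0 < eps2 -> 0 < eps ->
  0 <= eta <= eps -> 0 <= th -> th <= 1 - 4 * (eps / eps2) < th + eta ->
  `|q - (1 - th) * ((a + b) / 2)| <= eta -> `|r - gam| <= eps ->
  k = 5 * (eps / eps2) -> T = th * y + q - r ->
  (y <= gam) != (T <= 0) ->
  [/\ a <= gam < b, `|y - gam| <= k & `|T| <= k].
Proof.
move=> /andP[ay yb] ba2 ba1 e20 e0 /andP[eta0 etae] th0 /andP[th1 th2].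
rewrite !ler_norml => /andP[q1 q2] /andP[r1 r2] kE TE HG.
set w := eps / eps2 in th1 th2 kE.
have w_eps : w * eps2 = eps by rewrite /w divfK// gt_eqF.
have epsw : eps <= w by rewrite -w_eps ler_piMr ?(le_trans ba2)// /w divr_ge0 ?ltW.
set de := 1 - th in q1 q2; have de0 : 0 <= de by rewrite /de; lra.
have dek : de <= k by rewrite /de; lra.
(* At an endpoint of [[a, b]] the contraction moves the height inwards by
   [de * (b - a) / 2 >= 2 * eps]. This outweighs the error [eta <= eps] of [q] together with the
   error [eps] of [r], whence the factor 4; the 5 in [k] adds the rounding of [th]. *)
have del : 4 * eps <= de * (b - a).
  apply: (@le_trans _ _ (4 * w * (b - a))).
    by rewrite -{1}w_eps mulrA ler_wpM2l//; lra.
  by rewrite ler_wpM2r /de; lra.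
have f1 : 0 <= th * (b - y) by rewrite mulr_ge0//; lra.
have f2 : 0 <= th * (y - a) by rewrite mulr_ge0//; lra.
have f3 : de * (y - a) <= de by rewrite ler_piMr//; lra.
have f4 : de * (b - y) <= de by rewrite ler_piMr//; lra.
have f5 : 0 <= de * (y - a) by rewrite mulr_ge0//; lra.
have f6 : 0 <= de * (b - y) by rewrite mulr_ge0//; lra.
have thE : th = 1 - de by rewrite /de; ring.
clearbody de w.
move: f1 f2 TE; rewrite thE; clear thE th1 th2 th0 w_eps => f1 f2 TE.
move: HG; have [yg|yg] := leP y gam; have [T0|T0] := leP T 0 => // _.
  have gb : gam < b by rewrite ltNge; apply/negP => bg; lra.
  by split; lra.
have ga : a <= gam by rewrite leNgt; apply/negP => bg; lra.
by split; lra.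
Qed.

Variable d : nat.

Lemma drop_mx_to_col (j : 'I_d) (x : euclid R d) :
  drop_mx R j *m to_col x = to_col (remove_coord j x).
Proof.
by apply/matrixP => i k; rewrite (ord1 k) drop_mxE !mxE /xcoord tnth_mktuple.
Qed.

Lemma margin_to_col (P : piece R d) (x : euclid R d) :
  margin P (to_col x) = piece_slope P * xcoord x (piece_axis P) + piece_offset P -
    net_fun (piece_net P) (remove_coord (piece_axis P) x).
Proof. by rewrite /margin drop_mx_to_col mxE. Qed.

Lemma unit_cube_remove (j : 'I_d) (x : euclid R d) :
  unit_cube x -> unit_cube (remove_coord j x).
Proof. by move=> cx i; rewrite /xcoord tnth_mktuple; exact: cx. Qed.

(** Farther than [eta] from all faces, rounding the box to the grid does not change membership. A
    disagreement therefore happens inside the box and comes from the threshold in direction [j]. *)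
Lemma piece_error (Phi : relu_net R 1 d.-1) (j : 'I_d) (iota th q : R)
    (lo hi : 'cV[R]_d) (gam : R) (a b : 'I_d -> R) (eps eta eps2 k : R)
    (x : euclid R d) :
  let P := Piece Phi j (th * iota) q lo hi in
  iota = -1 \/ iota = 1 -> (forall i, 0 <= a i /\ a i < b i /\ b i <= 1) ->
  eps2 <= b j - a j -> 0 < eps2 -> 0 < eps -> 0 <= eta <= eps -> 0 <= th ->
  th <= 1 - 4 * (eps / eps2) < th + eta ->
  `|q - (1 - th) * iota * ((a j + b j) / 2)| <= eta ->
  (forall i, `|lo i 0 - a i| <= eta) -> (forall i, `|hi i 0 - b i| <= eta) ->
  k = 5 * (eps / eps2) ->
  `|net_fun Phi (remove_coord j x) - gam| <= eps ->
  (forall i, eta < `|xcoord x i - a i|) -> (forall i, eta < `|xcoord x i - b i|) ->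
  ~ ((box a b x /\ iota * xcoord x j <= gam) <-> penalty P (to_col x) = 0) ->
  [/\ forall i, a i < xcoord x i < b i, `|iota * xcoord x j - gam| <= k,
     `|margin P (to_col x)| <= k, a j <= iota * gam <= b j &
     exists2 e, 0 < e & forall s, 0 < s < e -> a j < iota * (gam + s) < b j].
Proof.
move=> P iota1 ab e2 e20 e0 eta0e th0 th1 qe loe hie kE Phie xa xb neq.
have eta0 : 0 <= eta by case/andP: eta0e.
have [xin|xout] := pselect (box a b x); last first.
  exfalso; apply: neq; split=> [[/xout]//|/penalty_eq0[_ lh]].
  exfalso; apply: xout => i; have := lh i; rewrite mxE /= => /andP[l1 h1].
  have := loe i; have := hie i; have := xa i; have := xb i.
  rewrite !ltr_normr !ler_norml; clear -l1 h1 eta0 => /orP xb /orP xa /andP[h2 h3] /andP[l2 l3].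
  by apply/andP; split; rewrite leNgt; apply/negP => ?; case: xa; case: xb; lra.
have xstrict i : a i < xcoord x i < b i.
  have := xin i; have := xa i; have := xb i; clear - eta0.
  rewrite !ltr_normr => /orP xb /orP xa /andP[x1 x2].
  by apply/andP; split; rewrite ltNge; apply/negP => ?; case: xa; case: xb; lra.
have pen : penalty P (to_col x) = 0 <-> margin P (to_col x) <= 0.
  split=> [/penalty_eq0[]//|m0]; apply/penalty_eq0; split=> // i; rewrite mxE /=.
  have := loe i; have := hie i; have := xa i; have := xb i; have := xstrict i; clear.
  rewrite !ltr_normr !ler_norml => /andP[x1 x2] /orP xb /orP xa /andP[h2 h3] /andP[l2 l3].
  by apply/andP; split; rewrite leNgt; apply/negP => ?; case: xa; case: xb; lra.
have HG : (iota * xcoord x j <= gam) != (margin P (to_col x) <= 0).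
  apply/eqP => e; apply: neq; split=> [[_ h]|/pen h]; first by apply/pen; rewrite -e.
  by split=> //; rewrite e.
have [a0 [_ b1]] := ab j; have := xstrict j => xj.
have mE : margin P (to_col x) = th * (iota * xcoord x j) + q -
    net_fun Phi (remove_coord j x) by rewrite margin_to_col mulrA.
case: iota1 => iE; rewrite {}iE in P qe HG mE pen neq *.
  (* For [iota = -1] the picture is reflected: the height [- x_j] ranges over [[- b j, - a j]]. *)
  have := @threshold_error (- b j) (- a j) (-1 * xcoord x j) gam
    (net_fun Phi (remove_coord j x)) th q eps eta eps2 k (margin P (to_col x)).
  case=> //; [lra|lra|lra| |].
    by move: qe; congr (`|_| <= _); ring.
  move=> g1 g2 g3; split=> //; first by lra.
  by exists (- a j - gam); [lra|move=> s; lra].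
have := @threshold_error (a j) (b j) (1 * xcoord x j) gam
  (net_fun Phi (remove_coord j x)) th q eps eta eps2 k (margin P (to_col x)).
case=> //; [by rewrite mul1r|lra|by move: qe; rewrite mulr1|].
move=> g1 g2 g3; split=> //; first by lra.
by exists (b j - gam); [lra|move=> s; lra].
Qed.

End piece_error.

(** * Approximation of the Bayes rule by a network region *)

Section strips.
Variables (R : realType) (d : nat).

(** Along direction [j] the function is affine with slope [s], so a slice lies in an interval of
    length [2 * w / |s| <= 4 * w]. *)
Lemma lebesgue_strip (j : 'I_d) (g : euclid R d -> R) (s : R) (g0 : euclid R d -> R) (w : R) :
  measurable_fun setT g -> 0 <= w -> 2^-1 <= `|s| ->
  (forall x t, g (replace_coord j t x) = s * t + g0 x) ->
  (lebesgue_tuple R d (unit_cube `&` [set x | (`|g x| <= w)%R]) <= (4 * w)%:E)%E.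
Proof.
move=> mg w0 s2 gE; apply: (lebesgue_tuple_slices (j := j)).
- apply: measurableI; first exact: unit_cube_measurable.
  rewrite (_ : [set x | _] = (fun x => `|g x|) @^-1` `]-oo, w]); last first.
    by apply/seteqP; split => x; rewrite /= in_itv.
  rewrite -[X in measurable X]setTI; apply: measurableT_comp => //; exact: measurable_itv.
- by move=> x [].
move=> x; have s0 : 0 < `|s| by apply: lt_le_trans s2; rewrite invr_gt0.
set c := - (g0 x / s).
apply: (@le_trans _ _ (@lebesgue_measure R `[c - 2 * w, c + 2 * w])).
  apply: le_outer_measure => t [_ /=]; rewrite gE in_itv /= => H.
  have sn0 : s != 0 by rewrite -normr_gt0.
  rewrite -ler_distl /c opprK.
  have -> : t + g0 x / s = (s * t + g0 x) / s by field.
  rewrite normrM normfV ler_pdivrMr//; apply: le_trans H _.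
  have : w * 2^-1 <= w * `|s| by rewrite ler_wpM2l.
  clear; lra.
rewrite lebesgue_measure_itv /= lte_fin; case: ltP => _; last by rewrite lee_fin mulr_ge0.
by rewrite -EFinB lee_fin; lra.
Qed.

Definition face_strip (i : 'I_d) (t w : R) : set (euclid R d) :=
  unit_cube `&` [set x | `|xcoord x i - t| <= w].

(** Cut out by the margin and not by [gamma]: the margin is built from a network, hence measurable,
    and it is affine in the coordinate of the axis. *)
Definition margin_strip (P : piece R d) (w : R) : set (euclid R d) :=
  unit_cube `&` [set x | `|margin P (to_col x)| <= w].

Lemma lebesgue_face_strip i t w : 0 <= w ->
  (lebesgue_tuple R d (face_strip i t w) <= (4 * w)%:E)%E.
Proof.
move=> w0; apply: (@lebesgue_strip i _ 1 (fun=> - t)) => //.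
- by apply: measurable_funB => //; exact: measurable_tnth.
- by rewrite normr1 invf_le1// ler1n.
- by move=> x u; rewrite xcoord_replace eqxx mul1r.
Qed.

Lemma lebesgue_margin_strip P w : 0 <= w -> 2^-1 <= `|piece_slope P| ->
  (lebesgue_tuple R d (margin_strip P w) <= (4 * w)%:E)%E.
Proof.
move=> w0 s2; apply: (@lebesgue_strip (piece_axis P) _ (piece_slope P)
  (fun x => piece_offset P - net_fun (piece_net P) (remove_coord (piece_axis P) x))) => //.
  exact: measurable_margin.
by move=> x t; rewrite margin_to_col remove_replace xcoord_replace eqxx addrA.
Qed.

Lemma measurable_face_strip i t w : measurable (face_strip i t w).
Proof.
apply: measurableI; first exact: unit_cube_measurable.
rewrite (_ : [set x | _] = (fun x => `|xcoord x i - t|) @^-1` `]-oo, w]); last first.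
  by apply/seteqP; split => x; rewrite /= in_itv.
have mh : measurable_fun setT (fun x : euclid R d => `|xcoord x i - t|).
  apply: measurableT_comp => //; apply: measurable_funB => //; exact: measurable_tnth.
by rewrite -[X in measurable X]setTI; apply: mh => //; exact: measurable_itv.
Qed.

Lemma measurable_margin_strip P w : measurable (margin_strip P w).
Proof.
apply: measurableI; first exact: unit_cube_measurable.
rewrite (_ : [set x | _] = (fun x => `|margin P (to_col x)|) @^-1` `]-oo, w]); last first.
  by apply/seteqP; split => x; rewrite /= in_itv.
have mh : measurable_fun setT (fun x : euclid R d => `|margin P (to_col x)|).
  by apply: measurableT_comp => //; exact: measurable_margin.
by rewrite -[X in measurable X]setTI; apply: mh => //; exact: measurable_itv.
Qed.

Lemma marginal_le_lebesgue (Q : probability (sample R d) R) (M : R) A :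
  has_density_bounded_by Q M -> measurable A ->
  (marginal Q A <= M%:E * lebesgue_tuple R d A)%E.
Proof.
move=> [p [mp pM pE]] mA; rewrite pE//.
have M0 : 0 <= M by case/andP: (pM [tuple 0 | i < d]) => /le_trans; apply.
rewrite -integral_cst//; apply: ge0_le_integral => //.
- by move=> x _; rewrite lee_fin; case/andP: (pM x).
- by apply/measurable_EFinP; exact: measurable_funTS.
- by move=> x _; rewrite lee_fin; case/andP: (pM x).
Qed.

End strips.

Section approximation.
Variables (R : realType) (d : nat).

Lemma grid_box (c : nat) (t : 'I_d -> R) : (forall i, 0 <= t i <= 1) ->
  exists2 v : 'cV[R]_d, grid_mx c v & forall i, `|v i 0 - t i| <= 2^-1 ^+ c.
Proof.
move=> t01.
have /choice[w wP] : forall i, exists w, weight_grid c w /\ w <= t i < w + 2^-1 ^+ c.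
  move=> i; have [|w cw wt] := @grid_floor R c (t i); last by exists w.
  by have /andP[t0 t1] := t01 i; rewrite t1 andbT; lra.
exists (\col_i w i) => [i k|i]; rewrite mxE; have [cw /andP[w1 w2]] := wP i => //.
by rewrite ler_norml; lra.
Qed.

(** A measurable majorant of [|2 f - 1|] on the points misjudged by one piece: weight 1 near the
    faces, where only the trivial bound holds, and the small weight [w] near the graph. *)
Definition error_weight (a b : 'I_d -> R) (P : piece R d) (eta k w : R) (x : euclid R d) : R :=
  \sum_i (\1_(face_strip i (a i) eta) x + \1_(face_strip i (b i) eta) x) +
  w * \1_(margin_strip P k) x.

Lemma measurable_error_weight a b P eta k w :
  measurable_fun setT (error_weight a b P eta k w).
Proof.
apply: measurable_funD.
  apply: measurable_sum => i; apply: measurable_funD; apply: measurable_indic;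
  exact: measurable_face_strip.
by apply: measurable_funM => //; apply: measurable_indic; exact: measurable_margin_strip.
Qed.

Lemma error_weight_ge0 a b P eta k w x : 0 <= w -> 0 <= error_weight a b P eta k w x.
Proof.
by move=> w0; rewrite addr_ge0 ?mulr_ge0// sumr_ge0// => i _; rewrite addr_ge0.
Qed.

Local Open Scope ereal_scope.

Lemma integral_error_weight (Q : probability (sample R d) R) (M : R) a b P eta k w :
  has_density_bounded_by Q M -> (0 <= M)%R -> (0 <= eta)%R -> (0 <= k)%R -> (0 <= w)%R ->
  (2^-1 <= `|piece_slope P|)%R ->
  \int[marginal Q]_x (error_weight a b P eta k w x)%:E <=
  (M * (8 * d%:R * eta + w * (4 * k)))%:E.
Proof.
move=> QM M0 eta0 k0 w0 s2.
have mI (A : set (euclid R d)) : measurable A ->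
    measurable_fun setT (fun x => (\1_A x : R)%:E).
  by move=> mA; apply/measurable_EFinP; exact: measurable_indic.
have face i t : \int[marginal Q]_x (\1_(face_strip i t eta) x)%:E <= (M * (4 * eta))%:E.
  rewrite integral_indic ?setIT//; last exact: measurable_face_strip.
  apply: le_trans (marginal_le_lebesgue QM (measurable_face_strip i t eta)) _.
  by rewrite EFinM lee_wpmul2l// lebesgue_face_strip.
under eq_integral do rewrite EFinD -sumEFin.
rewrite ge0_integralD//=; last 4 first.
- by move=> x _; apply: sume_ge0 => i _; rewrite lee_fin addr_ge0.
- apply: emeasurable_sum => i; apply/measurable_EFinP; apply: measurable_funD;
  apply: measurable_indic; exact: measurable_face_strip.
- by move=> x _; rewrite lee_fin mulr_ge0.
- apply/measurable_EFinP; apply: measurable_funM => //; apply: measurable_indic.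
  exact: measurable_margin_strip.
rewrite mulrDr EFinD; apply: leeD.
  rewrite ge0_integral_sum//=; last first.
    move=> i; apply/measurable_EFinP; apply: measurable_funD;
    apply: measurable_indic; exact: measurable_face_strip.
  apply: (@le_trans _ _ (\sum_(i < d) (M * (8 * eta))%:E)).
    apply: lee_sum => i _; under eq_integral do rewrite EFinD.
    rewrite ge0_integralD//=; last 2 first.
    - by apply: mI; exact: measurable_face_strip.
    - by apply: mI; exact: measurable_face_strip.
    apply: le_trans (leeD (face _ _) (face _ _)) _.
    by rewrite -EFinD lee_fin; lra.
  by rewrite sumEFin lee_fin sumr_const card_ord -mulr_natr; lra.
under eq_integral do rewrite EFinM.
rewrite ge0_integralZl//; last by apply: mI; exact: measurable_margin_strip.
rewrite integral_indic ?setIT//; last exact: measurable_margin_strip.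
rewrite mulrCA EFinM lee_wpmul2l//.
apply: le_trans (marginal_le_lebesgue QM (measurable_margin_strip P k)) _.
by rewrite EFinM lee_wpmul2l// lebesgue_margin_strip.
Qed.

End approximation.

Section bayes_approximation.
Variables (R : realType) (d : nat) (Q : probability (sample R d) R).
Variables (f : euclid R d -> R).
Hypothesis f_regr : is_regression_fun Q f.

Lemma penalty_piece (Phi : relu_net R 1 d.-1) (j : 'I_d) (iota : R) (gam : euclid R d.-1 -> R)
    (a b : 'I_d -> R) (eps eps2 : R) (c : nat) :
  iota = -1 \/ iota = 1 -> (forall i, 0 <= a i /\ a i < b i /\ b i <= 1) ->
  eps2 <= b j - a j -> 0 < eps2 -> 0 < eps -> 2^-1 ^+ c <= eps -> 16 * eps <= eps2 ->
  grid_net c Phi ->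
  (forall x, unit_cube x -> `|net_fun Phi x - gam x| <= eps) ->
  exists P : piece R d, [/\ piece_net P = Phi, grid_piece c P, 2^-1 <= `|piece_slope P| &
    forall x, unit_cube x ->
      (forall i, 2^-1 ^+ c < `|xcoord x i - a i|) ->
      (forall i, 2^-1 ^+ c < `|xcoord x i - b i|) ->
      ~ ((box a b x /\ iota * xcoord x j <= gam (remove_coord j x)) <->
         penalty P (to_col x) = 0) ->
    let y := gam (remove_coord j x) in
    [/\ forall i, a i < xcoord x i < b i,
      `|iota * xcoord x j - y| <= 5 * (eps / eps2),
      `|margin P (to_col x)| <= 5 * (eps / eps2), a j <= iota * y <= b j &
     exists2 e, 0 < e & forall s, 0 < s < e -> a j < iota * (y + s) < b j] ].
Proof.
move=> iota1 ab e2 e20 e0 ce ee2 cPhi Phie.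
set eta := 2^-1 ^+ c in ce *.
have eta0 : 0 <= eta by rewrite exprn_ge0// invr_ge0.
have [aj0 [ajbj bj1]] := ab j.
have w4 : 4 * (eps / eps2) <= 4^-1.
  by rewrite mulrA ler_pdivrMr//; lra.
have w0 : 0 < eps / eps2 by rewrite divr_gt0.
have e16 : eps <= 16^-1 by lra.
have [|th cth thP] := @grid_floor R c (1 - 4 * (eps / eps2)); first by lra.
have [th1 th2] := andP thP.
(* [16 * eps <= eps2 <= 1] gives [th > 1 - 1/4 - 1/16]. The lower bound on the slope is what makes
   margin strips thin. *)
have th0 : 2^-1 <= th by move: th2; rewrite -/eta; lra.
have thle1 : th <= 1 by lra.
have mid : -1 <= (1 - th) * iota * ((a j + b j) / 2) <= 1.
  have m01 : 0 <= (1 - th) * ((a j + b j) / 2) <= 1.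
    by apply/andP; split; [rewrite mulr_ge0//|rewrite mulr_ile1//]; lra.
  by case: iota1 => ->; rewrite ?mulrN1 ?mulr1 ?mulNr; lra.
have [q cq qP] := @grid_floor R c _ mid.
have [lo clo loP] : exists2 v : 'cV[R]_d, grid_mx c v & forall i, `|v i 0 - a i| <= eta.
  by apply: grid_box => i; have [? [? ?]] := ab i; lra.
have [hi chi hiP] : exists2 v : 'cV[R]_d, grid_mx c v & forall i, `|v i 0 - b i| <= eta.
  by apply: grid_box => i; have [? [? ?]] := ab i; lra.
exists (Piece Phi j (th * iota) q lo hi); split => //=.
- split => //=; case: iota1 => ->; rewrite ?mulrN mulr1//; exact: weight_gridN.
- rewrite normrM ger0_norm; last lra.
  by case: iota1 => ->; rewrite ?normrN normr1 mulr1.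
move=> x cx xa xb neq.
apply: (@piece_error R d Phi j iota th q lo hi _ a b eps eta eps2) => //.
- by rewrite eta0.
- by lra.
- by move: qP; rewrite -/eta ler_norml; lra.
- by apply: Phie; exact: unit_cube_remove.
Qed.

Lemma net_regions_union u (P : 'I_u -> piece R d) (r : nat) (L0 s0 : R) (c : nat) :
  (u <= r)%N -> 0 <= L0 -> 0 <= s0 ->
  (forall nu, (layers (piece_net (P nu)))%:R <= L0) ->
  (forall nu, (sparsity (piece_net (P nu)))%:R <= s0) ->
  (forall nu, grid_piece c (P nu)) ->
  net_regions d (r%:R * (L0 + 4) + 2)
    (r%:R * (s0 + L0 * (d + 1)%:R + (30 * (d + 1) ^ 2)%:R) + (5 * (d + 1))%:R) c
    [set x | unit_cube x /\ exists nu, penalty (P nu) (to_col x) = 0].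
Proof.
move=> ur L00 s00 LP sP cP; exists (union_net P); last first.
  apply/seteqP; split=> x [cx ex]; split=> //.
    by apply/union_netP => // i; rewrite mxE; case/andP: (cx i).
  by apply/union_netP => // i; rewrite mxE; case/andP: (cx i).
have sum_le (F : 'I_u -> nat) (K : R) : 0 <= K -> (forall nu, (F nu)%:R <= K) ->
    (\sum_nu F nu)%:R <= r%:R * K.
  move=> K0 FK; rewrite natr_sum.
  apply: (@le_trans _ _ (\sum_(nu < u) K)); first exact: ler_sum.
  by rewrite sumr_const card_ord -[K *+ _]mulr_natl ler_wpM2r// ler_nat.
split; last exact: grid_union_net.
  rewrite layers_union_net natrD addrC lerD2r; apply: sum_le; first lra.
  by move=> nu; rewrite natrD lerD2r.
apply: (@le_trans _ _ (5 * (d + 1) + \sum_nu (sparsity (piece_net (P nu)) +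
     layers (piece_net (P nu)) * (d + 1) + 30 * (d + 1) ^ 2))%:R).
  by rewrite ler_nat; exact: sparsity_union_net.
rewrite natrD addrC lerD2r; apply: sum_le.
  by rewrite !addr_ge0// mulr_ge0.
move=> nu; rewrite natrD [X in X + _ <= _]natrD natrM lerD2r.
by apply: lerD => //; apply: ler_wpM2r.
Qed.

Lemma bayes_approx (F : set (euclid R d.-1 -> R)) (beta B M eps1 eps2 L0 s0 eps : R) (r c0 c : nat) :
  has_density_bounded_by Q M ->
  piecewise_class F f beta B eps1 eps2 r (bayes_rule f) ->
  (forall gamma, F gamma -> exists2 Phi : relu_net R 1 d.-1,
     bounded_net L0 s0 c0 Phi & forall x, unit_cube x -> `|net_fun Phi x - gamma x| <= eps) ->
  0 <= beta -> 0 < B -> 0 < eps2 -> 0 <= M -> 0 <= L0 -> 0 <= s0 -> (c0 <= c)%N ->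
  0 < eps -> 2^-1 ^+ c <= eps -> 16 * eps <= eps2 -> 5 * (eps / eps2) <= eps1 ->
  exists2 G0, net_regions d (r%:R * (L0 + 4) + 2)
    (r%:R * (s0 + L0 * (d + 1)%:R + (30 * (d + 1) ^ 2)%:R) + (5 * (d + 1))%:R) c G0 &
    (excess_risk Q f G0 (bayes_rule f) <=
      (r%:R * (M * (8 * d%:R * 2^-1 ^+ c +
        (1 + B * (5 / eps2) `^ beta) * eps `^ beta * (4 * (5 * (eps / eps2))))))%:E)%E.
Proof.
move=> QM [u [ur [j [iota [gamma [a [b [Hs]]]]]]]] /=.
move=> [HE [iota1 [Fg [ab [HsE [disj [grad e2]]]]]]] Fapp b0 B0 e20 M0 L00 s00 c0c e0 ce ee2 ke1.
set k := 5 * (eps / eps2) in ke1 *.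
have k0 : 0 <= k by rewrite mulr_ge0// divr_ge0 ?ltW.
(* The summand 1 is for [beta = 0]: then no Hoelder condition is imposed, and [w >= 1] reduces the
   claim to [|2 f - 1| <= 1]. *)
set C := (1 + B * _).
have C1 : 1 <= C by rewrite lerDl mulr_ge0 ?powR_ge0// ltW.
set w := C * eps `^ beta; have w0 : 0 <= w by rewrite mulr_ge0 ?powR_ge0//; lra.
have [mf f01 _] := f_regr.
have phi1 x : `|2 * f x - 1| <= 1.
  by rewrite ler_norml; have /andP[] := f01 x; lra.
have /choice[P HP] : forall nu, exists P : piece R d,
   [/\ (layers (piece_net P))%:R <= L0, (sparsity (piece_net P))%:R <= s0,
     grid_piece c P, 2^-1 <= `|piece_slope P| &
    forall x, unit_cube x ->
      (forall i, 2^-1 ^+ c < `|xcoord x i - a nu i|) ->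
      (forall i, 2^-1 ^+ c < `|xcoord x i - b nu i|) ->
      ~ (Hs nu x <-> penalty P (to_col x) = 0) ->
    `|2 * f x - 1| <= w /\ `|margin P (to_col x)| <= k].
  move=> nu; have [Phi [LPhi sPhi cPhi] Phie] := Fapp _ (Fg nu).
  have cPhi' : grid_net c Phi.
    by move=> v vPhi; apply: weight_grid_mono c0c _; exact: cPhi.
  have [P [PE cP sP PP]] := penalty_piece (iota1 nu) (ab nu) (e2 nu) e20 e0 ce ee2 cPhi' Phie.
  exists P; rewrite PE; split => // x cx xa xb neq.
  have [|xin xy mk yin ye] := PP x cx xa xb.
    move=> h; apply: neq; rewrite HsE; split=> [[h1 [_ h2]]|/h[h1 h2]]; first exact/h.
    by split.
  split => //; have [b00|bpos] := eqVneq beta 0.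
    by rewrite /w b00 powRr0 mulr1 (le_trans (phi1 x)).
  have {}bpos : 0 < beta by rewrite lt_neqAle eq_sym bpos.
  have [x'D] := graph_in_boundary iota1 ab HsE disj (fun i _ => xin i) erefl yin ye.
  rewrite -HE => x'B; have [g gH gx] := grad bpos nu _ (conj x'D x'B).
  set y := gamma nu (remove_coord (j nu) x) in xy mk yin ye x'D x'B gx.
  have x'j : xcoord (replace_coord (j nu) (iota nu * y) x) (j nu) = iota nu * y.
    by rewrite xcoord_replace eqxx.
  have dist : `|xcoord x (j nu) - iota nu * y| = `|iota nu * xcoord x (j nu) - y|.
    case: (iota1 nu) => ->; last by rewrite !mul1r.
    by rewrite !mulN1r opprK -normrN opprD.
  have [aj0 [ajb bj1]] := ab nu (j nu).
  have /andP[xj0 xj1] := cx (j nu).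
  (* The condition at the boundary point is evaluated at the height of [x]: resetting coordinate
     [j nu] of that point gives [x] back. *)
  have := gx (xcoord x (j nu)); rewrite x'j replace_coord_id => /(_ _)/wrap[].
    rewrite ge_max le_min xj0 xj1 /=.
    have : `|xcoord x (j nu) - iota nu * y| <= eps1 by rewrite dist (le_trans xy).
    by rewrite ler_norml; lra.
  move=> /le_trans; apply; rewrite dist.
  have h01 : 0 <= `|iota nu * xcoord x (j nu) - y| <= 1.
    by rewrite normr_ge0 -dist ler_norml; lra.
  apply: le_trans (ler_norm _) _; apply: le_trans (hoelder0_powR bpos gH h01) _.
  rewrite /w /C; apply: (@le_trans _ _ (B * k `^ beta)).
    by rewrite ler_wpM2l ?(ltW B0)// ge0_ler_powR// ?nnegrE.
  have -> : k `^ beta = (5 / eps2) `^ beta * eps `^ beta.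
    by rewrite -powRM ?divr_ge0 ?ltW//; congr (_ `^ _); rewrite /k; ring.
  by rewrite mulrA [leRHS]mulrDl mul1r lerDr powR_ge0.
exists [set x | unit_cube x /\ exists nu, penalty (P nu) (to_col x) = 0].
  by apply: net_regions_union => // nu; have [] := HP nu.
set G0 := [set x | _].
rewrite /excess_risk integral_mkcond.
pose W nu := error_weight (a nu) (b nu) (P nu) (2^-1 ^+ c) k w.
apply: (@le_trans _ _ (\int[marginal Q]_x (\sum_(nu < u) (W nu x)%:E))%E).
  apply: ge0_le_integral_nonmeasurable => x.
    by rewrite /patch; case: ifPn => // _; rewrite lee_fin.
  rewrite /patch; case: ifPn => xD; last first.
    by apply: sume_ge0 => nu _; rewrite lee_fin error_weight_ge0.
  rewrite sumEFin lee_fin.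
  have cx : unit_cube x by move/set_mem: xD => [[[]]|[[]]].
  (* The Bayes rule and [G0] are unions over the same indices, so a point in only one of them is
     misjudged by some piece. *)
  have [nu neq] : exists nu, ~ (Hs nu x <-> penalty (P nu) (to_col x) = 0).
    apply: contrapT => /forallNP h; move/set_mem: xD.
    have {}h nu : Hs nu x <-> penalty (P nu) (to_col x) = 0 by apply: contrapT; exact: h.
    rewrite HE => -[[[_ [nu /h Hnu]]]|[[nu _ /h Hnu]]]; apply.
      by exists nu.
    by split=> //; exists nu.
  have [_ _ _ _ key] := HP nu.
  rewrite (bigD1 nu)//=; apply: (@le_trans _ _ (W nu x)); last first.
    by rewrite lerDl sumr_ge0// => mu _; rewrite error_weight_ge0.
  rewrite /W /error_weight.
  have strip i t : `|xcoord x i - t| <= 2^-1 ^+ c ->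
      \1_(face_strip i t (2^-1 ^+ c)) x = 1 :> R.
    by move=> h; rewrite indicE mem_set.
  have face_case : (exists i, `|xcoord x i - a nu i| <= 2^-1 ^+ c \/
        `|xcoord x i - b nu i| <= 2^-1 ^+ c) ->
      `|2 * f x - 1| <= \sum_i (\1_(face_strip i (a nu i) (2^-1 ^+ c)) x +
        \1_(face_strip i (b nu i) (2^-1 ^+ c)) x) + w * \1_(margin_strip (P nu) k) x.
    move=> [i hi]; apply: le_trans (phi1 x) _.
    rewrite (bigD1 i)//= -!addrA.
    case: hi => /strip ->; last rewrite addrCA;
      rewrite lerDl; do ?[apply: addr_ge0 | apply: sumr_ge0 => ? _ | apply: (mulr_ge0 w0)]; done.
  have [xs|xs] := pselect (exists i, `|xcoord x i - a nu i| <= 2^-1 ^+ c \/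
        `|xcoord x i - b nu i| <= 2^-1 ^+ c); first exact: face_case.
  have [||h1 h2] := key x cx _ _ neq.
  - by move=> i; rewrite ltNge; apply/negP => h; apply: xs; exists i; left.
  - by move=> i; rewrite ltNge; apply/negP => h; apply: xs; exists i; right.
  rewrite [\1_(margin_strip _ _) x]indicE mem_set// mulr1 (le_trans h1)// lerDr.
  by rewrite sumr_ge0// => i _; rewrite addr_ge0.
rewrite ge0_integral_sum//=; last 2 first.
- by move=> nu; apply/measurable_EFinP; exact: measurable_error_weight.
- by move=> nu x _; rewrite lee_fin error_weight_ge0.
apply: (@le_trans _ _ (\sum_(nu < u) (M * (8 * d%:R * 2^-1 ^+ c + w * (4 * k)))%:E)%E).
  apply: lee_sum => nu _; apply: integral_error_weight => //.
  - by have [] := HP nu.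
rewrite sumEFin lee_fin sumr_const card_ord -[_ *+ u]mulr_natl ler_wpM2r ?ler_nat//.
apply: mulr_ge0 => //; apply: addr_ge0; last by apply: (mulr_ge0 w0); exact: mulr_ge0.
by apply: mulr_ge0 => //; rewrite exprn_ge0// invr_ge0.
Qed.

End bayes_approximation.

(** * Rates *)

Section rate.
Variable R : realType.

Lemma powR_inv (x r : R) : 0 <= x -> (x^-1) `^ r = (x `^ r)^-1.
Proof. by move=> x0; rewrite -powR_inv1// -powRrM mulN1r powRN. Qed.

Lemma ln_le_powR (s x : R) : 0 < s -> 0 < x -> ln x <= s^-1 * x `^ s.
Proof.
move=> s0 x0; rewrite ler_pdivlMl// -ln_powR ltW// ln_sublinear//.
by rewrite powR_gt0.
Qed.

Lemma rate_ge (kappa rho : R) : 1 <= kappa -> 0 < rho -> forall K : R,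
  \forall n \near \oo, K <= rate kappa rho n.
Proof.
move=> k1 r0 K.
set a := (2 * kappa + rho - 1)^-1; set b := 2 / rho.
have a0 : 0 < a by rewrite invr_gt0; lra.
have b0 : 0 < b by rewrite divr_gt0.
(* With this [s], the estimate [ln n <= n ^ s / s] makes the logarithmic factor cost [n ^ (a / 2)],
   half of the available power. *)
have [s sE] : exists s, s = a / (2 * b) by exists (a / (2 * b)).
have s0 : 0 < s by rewrite sE divr_gt0// mulr_gt0.
pose K1 := Num.max K 1; have K10 : 0 < K1 by rewrite lt_max ltr01 orbT.
near=> n.
have n3 : (expR 1 : R) <= n%:R by near: n; exact: nbhs_infty_ger.
have n0 : (0 : R) < n%:R by apply: lt_le_trans n3; exact: expR_gt0.
have ln1 : 1 <= ln (n%:R : R) by rewrite -[leLHS](@expRK R) ler_ln ?posrE ?expR_gt0.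
have nK : (K1 / s `^ b) `^ (2 / a) <= n%:R by near: n; exact: nbhs_infty_ger.
apply: (@le_trans _ _ K1); first by rewrite le_max lexx.
have sb0 : 0 < s `^ b by rewrite powR_gt0.
rewrite /rate -/a -/b ler_pdivlMr; last by rewrite powR_gt0//; lra.
have h1 : ln (n%:R : R) `^ b <= (s `^ b)^-1 * n%:R `^ (a / 2).
  have -> : (s `^ b)^-1 * n%:R `^ (a / 2) = (s^-1 * n%:R `^ s) `^ b.
    rewrite powRM ?invr_ge0 ?powR_ge0 ?(ltW s0)// powR_inv ?(ltW s0)//.
    rewrite -[in RHS]powRrM; congr (_ * _ `^ _).
    by rewrite sE; field; rewrite gt_eqF.
  rewrite ge0_ler_powR ?(ltW b0) ?nnegrE//; [lra|by rewrite mulr_ge0 ?powR_ge0// invr_ge0 ltW|].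
  exact: ln_le_powR.
apply: (@le_trans _ _ (K1 * ((s `^ b)^-1 * n%:R `^ (a / 2)))).
  by rewrite ler_wpM2l// ltW.
have -> : n%:R `^ a = n%:R `^ (a / 2) * n%:R `^ (a / 2) :> R.
  by rewrite -powRD ?(gt_eqF n0) ?implybT//; congr (_ `^ _); field.
rewrite mulrA ler_wpM2r ?powR_ge0//.
have -> : K1 / s `^ b = ((K1 / s `^ b) `^ (2 / a)) `^ (a / 2).
  rewrite -powRrM (_ : 2 / a * (a / 2) = 1) ?powRr1 ?divr_ge0 ?(ltW K10) ?(ltW sb0)//.
  by field; rewrite gt_eqF.
by rewrite ge0_ler_powR ?nnegrE ?powR_ge0 ?(ltW n0)// divr_ge0// ltW.
Unshelve. all: by end_near. Qed.

(** With [g = 2 * kappa + rho - 1], the definition of [y] reads [n = y ^ g * ln n ^ (2 * g / rho)],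
    so the right-hand side is [y ^ rho * ln n ^ (2 * g / rho)]. As [g >= rho], this holds at least
    two logarithms, and [ln y <= ln n]. *)
Lemma rate_facts (kappa rho : R) : 1 <= kappa -> 0 < rho -> forall K : R,
  \forall n \near \oo, let y := rate kappa rho n in
  [/\ 0 < y, K <= ln y & y `^ rho * ln y ^+ 2 <= n%:R * (y^-1) `^ (2 * kappa - 1)].
Proof.
move=> k1 r0 K; near=> n => /=.
have yK : expR (Num.max K 1) <= rate kappa rho n by near: n; exact: rate_ge.
have n3 : (expR 1 : R) <= n%:R by near: n; exact: nbhs_infty_ger.
have n0 : (0 : R) < n%:R by apply: lt_le_trans n3; exact: expR_gt0.
have ln1 : 1 <= ln (n%:R : R) by rewrite -[leLHS](@expRK R) ler_ln ?posrE ?expR_gt0.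
set y := rate kappa rho n in yK *.
have y0 : 0 < y by apply: lt_le_trans yK; exact: expR_gt0.
have lnK : Num.max K 1 <= ln y by rewrite -[leLHS](@expRK R) ler_ln ?posrE ?expR_gt0.
have [lK l1] : K <= ln y /\ 1 <= ln y by move: lnK; rewrite ge_max => /andP[].
split => //.
set g := 2 * kappa + rho - 1.
have g1 : 1 <= g by rewrite /g; lra.
set b := 2 / rho; have b0 : 0 < b by rewrite divr_gt0.
set ll := ln (n%:R : R) in ln1 *.
have ll0 : 0 < ll by lra.
have yE : y = n%:R `^ g^-1 / ll `^ b by [].
have yll : y * ll `^ b = n%:R `^ g^-1.
  by rewrite yE divfK// gt_eqF// powR_gt0.
have g0 : g != 0 by rewrite gt_eqF//; lra.
have nE : n%:R = y `^ g * ll `^ (b * g).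
  by rewrite powRrM -powRM ?powR_ge0 ?(ltW y0)// yll -powRrM mulVf// powRr1 ?(ltW n0).
have yn : y <= n%:R.
  have n1 : (1 : R) <= n%:R by rewrite (le_trans _ n3)// -[leLHS](@expR0 R) ler_expR.
  apply: (@le_trans _ _ (n%:R `^ g^-1)); last first.
    by apply: ler1_powR => //; rewrite invf_le1//; lra.
  rewrite -yll -[leLHS]mulr1 ler_wpM2l ?(ltW y0)//.
  by rewrite -[leLHS](powRr0 ll) ler_powR// ltW.
have lnyn : ln y <= ll by rewrite ler_ln// posrE.
have yinv : y^-1 = y `^ (-1) by rewrite powR_inv1// ltW.
have -> : n%:R * y^-1 `^ (2 * kappa - 1) = y `^ rho * ll `^ (b * g).
  rewrite nE mulrAC yinv -powRrM -powRD ?(gt_eqF y0) ?implybT//.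
  by congr (_ `^ _ * _); rewrite /g; ring.
rewrite ler_wpM2l ?powR_ge0//.
apply: (@le_trans _ _ (ll ^+ 2)); first by rewrite lerXn2r ?nnegrE ?(ltW ll0)//; lra.
rewrite -powR_mulrn ?(ltW ll0)// ler_powR//.
rewrite /b mulrAC ler_pdivlMr// ler_pM2l// /g; lra.
Unshelve. all: by end_near. Qed.

End rate.

(** * Entropy of the network class *)

Section code_count.
Variable R : realType.

Lemma natr_le_expR (n : nat) : (n%:R + 1 : R) <= expR n%:R.
Proof. by rewrite addrC expR_ge1Dx. Qed.

Lemma pow2_le_expR (n : nat) : (2 : R) ^+ n <= expR n%:R.
Proof.
rewrite -[n%:R]mulr1 mulrC expRM_natr lerXn2r ?nnegrE ?expR_ge0//.
by rewrite (le_trans _ (expR_ge1Dx 1))//.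
Qed.

(** Here [l] stands for [log (1 / eps)] and [expR (rho * l)] for [eps ^ - rho]. The leading term is
    [s] times the logarithm of the number of possible entries; both [ln (s + d + 2) <= a4 * l] and
    [c] are of order [l], which gives one [l] beyond the one in [s]. *)
Lemma card_code_type_le (a1 a2 a3 l rho : R) (d lb s c : nat) :
  0 <= a1 -> 0 <= a2 -> 0 <= a3 -> 0 < rho -> 1 <= l ->
  lb%:R <= a1 * l -> s%:R <= a2 * (expR (rho * l) * l) -> c%:R <= a3 * l ->
  let a4 := a2 + d%:R + 3 + rho in
  (#|{: code_type lb s c (s + d)}|%:R <=
    expR ((a1 + 1 + (a1 + 1) * a4 + a2 * (2 * a4 + a3 + 2)) *
      (expR (rho * l) * l ^+ 2)))%R.
Proof.
move=> a10 a20 a30 r0 l1 lbl sl cl; lazy zeta; set a4 := a2 + d%:R + 3 + rho.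
have a40 : 0 <= a4 by have := ler0n R d; rewrite /a4; lra.
set Y := expR (rho * l) in sl *.
have Y1 : 1 <= Y by rewrite -(@expR0 R) ler_expR mulr_ge0 ?(ltW r0)//; lra.
have l0 : 0 <= l by lra.
have sd : (s + d)%:R + 2 <= expR (a4 * l).
  have h1 : (s + d)%:R + 2 <= (a2 + d%:R + 2) * (Y * l).
    have Yl : 1 <= Y * l by rewrite mulr_ege1.
    rewrite natrD 2!mulrDl; apply: lerD; first apply: lerD => //; by rewrite ler_peMr.
  apply: le_trans h1 _.
  have -> : a4 * l = (a2 + d%:R + 2) * l + rho * l + l by rewrite /a4; ring.
  rewrite !expRD -mulrA ler_pM ?mulr_ge0 ?expR_ge0 ?addr_ge0//.
    apply: le_trans (le_trans (expR_ge1Dx _) _); last first.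
      rewrite ler_expR; apply: (@ler_peMr _ l (a2 + d%:R + 2)) => //.
      by rewrite !addr_ge0.
    by rewrite lerDr.
  by rewrite ler_wpM2l ?expR_ge0// (le_trans _ (expR_ge1Dx _))// lerDr.
rewrite card_code_type !natrM !natrX.
have f1 : (lb.+2%:R : R) <= expR ((a1 + 1) * l).
  rewrite -natr1 (le_trans (natr_le_expR _))// ler_expR -natr1 mulrDl mul1r lerD//.
have f2 : (s.+1%:R : R) ^+ lb.+1 <= expR ((a1 + 1) * l * (a4 * l)).
  apply: (@le_trans _ _ (expR (a4 * l) ^+ lb.+1)).
    rewrite lerXn2r ?nnegrE ?expR_ge0// (le_trans _ sd)// -natr1 natrD -addrA lerD2l.
    by rewrite ler_wpDl// ler1n.
  rewrite -expRM_natl ler_expR ler_wpM2r ?mulr_ge0// -natr1 mulrDl mul1r lerD//.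
have f3 : ((s + d).+1 * (s + d).+2 * (2 ^ c.+1).+1)%:R <= expR ((2 * a4 + a3 + 2) * l).
  have -> : (2 * a4 + a3 + 2) * l = a4 * l + a4 * l + (a3 * l + 2 * l) by ring.
  rewrite !natrM expRD [X in _ <= X * _]expRD; apply: ler_pM => //; first apply: ler_pM => //.
  - by rewrite (le_trans _ sd)// -natr1 lerD2l ler1n.
  - by rewrite (le_trans _ sd)// -addn2 natrD.
  apply: (@le_trans _ _ (2 ^+ c.+2)).
    rewrite -natrX ler_nat [X in (_ <= X)%N]expnS.
    have p : (0 < 2 ^ c.+1)%N by rewrite expn_gt0.
    by move: (2 ^ c.+1)%N p => k p; clear -p; lia.
  rewrite (le_trans (pow2_le_expR _))// ler_expR -addn2 natrD lerD// ler_peMr//.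
have f4 : ((s + d).+1 * (s + d).+2 * (2 ^ c.+1).+1)%:R ^+ s <=
    expR (a2 * (Y * l) * ((2 * a4 + a3 + 2) * l)).
  apply: (@le_trans _ _ (expR ((2 * a4 + a3 + 2) * l) ^+ s)).
    by rewrite lerXn2r ?nnegrE ?expR_ge0//.
  rewrite -expRM_natl ler_expR ler_wpM2r// mulr_ge0// !addr_ge0// mulr_ge0//.
apply: (@le_trans _ _ (expR ((a1 + 1) * l) * expR ((a1 + 1) * l * (a4 * l)) *
   expR (a2 * (Y * l) * ((2 * a4 + a3 + 2) * l)))).
  by apply: ler_pM => //; rewrite ?mulr_ge0 ?exprn_ge0//; apply: ler_pM; rewrite ?exprn_ge0.
rewrite -!expRD ler_expR.
rewrite [leRHS]mulrDl [X in _ <= X + _]mulrDl; apply: lerD; first apply: lerD.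
- apply: ler_wpM2l; first by rewrite addr_ge0.
  apply: (@le_trans _ _ (l ^+ 2)); first by rewrite expr2 ler_peMr.
  by apply: ler_peMl => //; rewrite exprn_ge0.
- have -> : (a1 + 1) * l * (a4 * l) = (a1 + 1) * a4 * l ^+ 2 by ring.
  apply: ler_wpM2l; first by rewrite mulr_ge0// addr_ge0.
  by apply: ler_peMl => //; rewrite exprn_ge0.
- by rewrite le_eqVlt; apply/orP; left; apply/eqP; ring.
Qed.

End code_count.

Section network_class.
Variables (R : realType) (d : nat).

Lemma net_regions_mono (L L' s s' : R) (c c' : nat) : L <= L' -> s <= s' -> (c <= c')%N ->
  net_regions d L s c `<=` net_regions d L' s' c'.
Proof.
move=> LL ss cc G [Phi [LP sP cP] GE]; exists Phi => //; split.
- exact: le_trans LL.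
- exact: le_trans ss.
- by move=> w wP; apply: weight_grid_mono cc _; exact: cP.
Qed.

Lemma net_regions_all (L s : R) (c : nat) : net_regions d L s c `<=` all_net_regions d.
Proof.
move=> G NG; pose n := maxn (maxn (Num.truncn L).+1 (Num.truncn s).+1) c.
exists n => //; apply: net_regions_mono NG; last exact: leq_maxr.
- apply: (le_trans (ltW (truncnS_gt L))); rewrite ler_nat.
  by rewrite (leq_trans _ (leq_maxl _ _))// leq_maxl.
- apply: (le_trans (ltW (truncnS_gt s))); rewrite ler_nat.
  by rewrite (leq_trans _ (leq_maxl _ _))// leq_maxr.
Qed.

Lemma net_regions_measurable (L s : R) (c : nat) G : net_regions d L s c G ->
  measurable G /\ G `<=` unit_cube.
Proof.
move=> [Phi _ ->]; split; last by move=> x [].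
apply: measurableI; first exact: unit_cube_measurable.
by have := measurable_net_fun Phi measurableT (measurable_set1 1); rewrite setTI.
Qed.

Lemma ceil_itv_ge0 (l : R) : 0 <= l ->
  [/\ l <= (Num.ceil l)%:~R, (Num.ceil l)%:~R <= l + 1 :> R &
      (`|Num.ceil l|%N%:R : R) = (Num.ceil l)%:~R].
Proof.
move=> l0; have := ceil_itv l; rewrite intrB => /andP[h1 h2]; split => //.
  by lra.
have : 0 <= Num.ceil l by rewrite ceil_ge0; lra.
by case: (Num.ceil l).
Qed.

Lemma powR_expR (y a : R) : 0 < y -> y `^ a = expR (a * ln y).
Proof. by move=> y0; rewrite /powR gt_eqF. Qed.

Lemma truncnS_le (x : R) : 0 <= x -> (Num.truncn x).+1%:R <= x + 1.
Proof. by move=> x0; rewrite -natr1 lerD2r truncn_le. Qed.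

Lemma class_count (C1 C2 rho C1' C2' : R) (C3 C4 C3' : nat) :
  0 < C1 -> 0 < C2 -> 0 < rho -> 0 < C1' -> 0 < C2' ->
  exists2 CN : R, 0 <= CN & forall y : R, 0 < y -> 1 <= ln y ->
    exists (T : finType) (dec : T -> set (euclid R d)),
      (forall G, net_regions d (C1' * net_layers C1 y^-1)
        (C2' * net_sparsity C2 rho y^-1) (C3' * net_precision C3 C4 y^-1)%N G ->
        exists t, dec t = G) /\
      #|T|%:R <= expR (CN * (y `^ rho * ln y ^+ 2)).
Proof.
move=> C10 C20 r0 C10' C20'.
pose a1 := C1' * C1 * 2 + 1; pose a2 := C2' * C2 + 1.
pose a3 : R := C3'%:R * (C3%:R + 2 * C4%:R).
have a10 : 0 <= a1 by rewrite addr_ge0// !mulr_ge0// ltW.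
have a20 : 0 <= a2 by rewrite addr_ge0// !mulr_ge0// ltW.
have a30 : 0 <= a3 by rewrite mulr_ge0// addr_ge0// mulr_ge0.
pose a4 := a2 + d%:R + 3 + rho.
have a40 : 0 <= a4 by have := ler0n R d; rewrite /a4; lra.
exists (a1 + 1 + (a1 + 1) * a4 + a2 * (2 * a4 + a3 + 2)).
  have m1 : 0 <= (a1 + 1) * a4 by apply: mulr_ge0 => //; exact: addr_ge0.
  have m2 : 0 <= a2 * (2 * a4 + a3 + 2).
    by apply: mulr_ge0 => //; apply: addr_ge0 => //; apply: addr_ge0 => //; exact: mulr_ge0.
  by apply: addr_ge0 => //; apply: addr_ge0 => //; exact: addr_ge0.
move=> y y0; set l := ln y => l1.
have l0 : 0 <= l by lra.
have [ce1 ce2 ceE] := ceil_itv_ge0 l0.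
have LE : net_layers C1 y^-1 = C1 * (Num.ceil l)%:~R by rewrite /net_layers invrK.
have yr : y `^ rho = expR (rho * l) by exact: powR_expR.
have sE : net_sparsity C2 rho y^-1 = C2 * expR (rho * l) * l.
  by rewrite /net_sparsity invrK powRN powR_inv ?ltW// invrK yr.
have cE : net_precision C3 C4 y^-1 = (C3 + C4 * `|Num.ceil l|)%N.
  by rewrite /net_precision invrK.
set LL := C1' * net_layers C1 y^-1; set ss := C2' * net_sparsity C2 rho y^-1.
set cc := (C3' * _)%N.
have LL0 : 0 <= LL by rewrite /LL LE !mulr_ge0 ?(ltW C10) ?(ltW C10')//; lra.
have ss0 : 0 <= ss by rewrite /ss sE !mulr_ge0 ?(ltW C20) ?(ltW C20') ?expR_ge0.
pose lb := (Num.truncn LL).+1; pose s := (Num.truncn ss).+1.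
have Y1 : 1 <= expR (rho * l) by rewrite -(@expR0 R) ler_expR mulr_ge0// ltW.
have lbl : lb%:R <= a1 * l.
  apply: le_trans (truncnS_le LL0) _; rewrite /a1 mulrDl mul1r lerD//.
  rewrite /LL LE -!mulrA ler_wpM2l ?(ltW C10')// ler_wpM2l ?(ltW C10)//.
  by apply: le_trans ce2 _; lra.
have sl : s%:R <= a2 * (expR (rho * l) * l).
  apply: le_trans (truncnS_le ss0) _; rewrite /a2 mulrDl mul1r lerD//.
    by rewrite /ss sE !mulrA.
  by rewrite mulr_ege1.
have cl : cc%:R <= a3 * l.
  rewrite /cc cE natrM natrD natrM ceE /a3 -mulrA ler_wpM2l// mulrDl lerD//.
    by rewrite ler_peMr.
  by rewrite -mulrA mulrCA ler_wpM2l//; lra.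
have := card_code_type_le d a10 a20 a30 r0 l1 lbl sl cl.
rewrite -/a4 => card.
exists (code_type lb s cc (s + d)), (fun t : code_type lb s cc (s + d) => @code_region R d (decode R t)); split.
  move=> G NG; apply: net_regions_code NG.
  - exact/ltW/truncnS_gt.
  - exact/ltW/truncnS_gt.
by rewrite yr.
Qed.

Lemma limn_esup_lty (u : nat -> \bar R) (C : R) :
  (\forall n \near \oo, (u n <= C%:E)%E) -> (limn_esup u < +oo)%E.
Proof.
move=> uC; apply: (@le_lt_trans _ _ C%:E); last exact: ltry.
apply: (@le_trans _ _ (ereal_sup (u @` [set n | (u n <= C%:E)%E]))).
  by apply: ereal_inf_lbound; exists [set n | (u n <= C%:E)%E].
by apply: ge_ereal_sup => _ [n /= un <-].
Qed.

End network_class.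

(** * Constants of the approximating class *)

Section class_approximation.
Variables (R : realType) (d : nat).

(** By [ln y < y]. It allows every smallness condition on [eps = y^-1] to be stated as a lower bound
    on [ln y]. *)
Lemma inv_le_of_ln (y z : R) : 0 < y -> 0 < z -> z^-1 <= ln y -> y^-1 < z.
Proof.
move=> y0 z0 zy; rewrite -[z]invrK ltf_pV2 ?posrE ?invr_gt0//.
by apply: le_lt_trans zy (ln_sublinear y0).
Qed.

(** [2 ^ - c = exp (- c * ln 2)], whence the ratio [kappa / ln 2]. *)
Lemma grid_step_le (kappa l : R) (c c' : nat) : 0 <= l -> kappa / ln 2 <= c'%:R ->
  c'%:R * l <= c%:R -> (2^-1 : R) ^+ c <= expR (- (kappa * l)).
Proof.
move=> l0 kc cl.
have ln20 : 0 < ln (2 : R) by rewrite ln_gt0// ltr1n.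
have -> : (2^-1 : R) ^+ c = expR (- (c%:R * ln 2)).
  by rewrite -mulrN expRM_natl expRN lnK// posrE.
rewrite ler_expR lerN2.
apply: (@le_trans _ _ (c'%:R * ln 2 * l)).
  by rewrite ler_wpM2r// -ler_pdivrMr.
by rewrite mulrAC ler_wpM2r// ltW.
Qed.

Lemma class_approx (F : set (euclid R d.-1 -> R)) (beta B rho M eps0 eps1 eps2 C1 C2 : R)
    (r C3 C4 : nat) :
  0 <= beta -> 0 < B -> 0 < rho -> 0 <= M -> 0 < eps0 -> 0 < eps1 -> 0 < eps2 ->
  0 < C1 -> 0 < C2 -> (0 < C4)%N ->
  (forall gamma, F gamma -> forall eps : R, 0 < eps < eps0 ->
     exists2 Phi : relu_net R 1 d.-1,
       bounded_net (net_layers C1 eps) (net_sparsity C2 rho eps)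
         (net_precision C3 C4 eps) Phi &
       forall x, unit_cube x -> `|net_fun Phi x - gamma x| <= eps) ->
  exists (C1' C2' : R) (C3' : nat), [/\ 0 < C1', 0 < C2', (0 < C3')%N &
   exists (K1 l0 : R), 0 <= K1 /\ forall y : R, 0 < y -> l0 <= ln y ->
    forall (Q : probability (sample R d) R) (f : euclid R d -> R),
    is_regression_fun Q f -> has_density_bounded_by Q M ->
    piecewise_class F f beta B eps1 eps2 r (bayes_rule f) ->
    exists2 G0, net_regions d (C1' * net_layers C1 y^-1)
        (C2' * net_sparsity C2 rho y^-1) (C3' * net_precision C3 C4 y^-1)%N G0 &
      (excess_risk Q f G0 (bayes_rule f) <= (K1 * (y^-1) `^ (1 + beta))%:E)%E].
Proof.
move=> b0 B0 rho0 M0 e00 e10 e20 C10 C20 C40 Fapp.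
pose kappa := 1 + beta.
have [C3' C3P C30] : exists2 C3' : nat, kappa / ln 2 <= C3'%:R & (0 < C3')%N.
  by exists (Num.truncn (kappa / ln 2)).+1 => //; exact/ltW/truncnS_gt.
(* Converts the cost [r * L0 * (d + 1)] of carrying the input, where [L0 <= 2 * C1 * l], into a
   multiple of the sparsity bound, which is at least [C2 * l]. *)
pose rD := r%:R * (2 * C1 * (d + 1)%:R) / C2.
have rD0 : 0 <= rD by rewrite divr_ge0 ?mulr_ge0 ?(ltW C10) ?(ltW C20).
pose Cst : R := r%:R * (30 * (d + 1) ^ 2)%:R + (5 * (d + 1))%:R.
have Cst0 : 0 <= Cst by rewrite addr_ge0// mulr_ge0.
(* [r] for the pieces, [rD] for carrying the input, and 1 for the additive constants, which are
   absorbed once [l] is large. *)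
exists (r%:R + 1), (r%:R + rD + 1), C3'.
have r0 := ler0n R r.
split; [by lra|by lra|by []|].
pose Cb := 1 + B * (5 / eps2) `^ beta.
have Cb0 : 0 <= Cb by rewrite addr_ge0// mulr_ge0 ?powR_ge0 ?ltW.
exists (r%:R * (M * (8 * d%:R + Cb * (20 / eps2)))).
(* One summand per requirement: [l >= 1], the range of [F_approx], [16 * eps <= eps2],
   [5 * eps / eps2 <= eps1], and the additive constants in depth and sparsity. *)
pose l0 := 1 + eps0^-1 + (eps2 / 16)^-1 + (eps1 * eps2 / 5)^-1 +
   (4 * r%:R + 2) / C1 + Cst / C2.
exists l0; split.
  by rewrite mulr_ge0// mulr_ge0// addr_ge0// mulr_ge0// divr_ge0// ltW.
move=> y y0; set l := ln y => ll0 Q f f_regr Qd Qb.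
have p1 : 0 < eps0^-1 by rewrite invr_gt0.
have p2 : 0 < (eps2 / 16)^-1 by rewrite invr_gt0 divr_gt0.
have p3 : 0 < (eps1 * eps2 / 5)^-1 by rewrite invr_gt0 divr_gt0// mulr_gt0.
have p4 : 0 <= (4 * r%:R + 2) / C1 by rewrite divr_ge0 ?(ltW C10)//; lra.
have p5 : 0 <= Cst / C2 by rewrite divr_ge0 ?(ltW C20).
have l1 : 1 <= l by apply: (@le_trans _ _ l0) => //; rewrite /l0; lra.
have h0 : eps0^-1 <= l by apply: (@le_trans _ _ l0) => //; rewrite /l0; lra.
have h2 : (eps2 / 16)^-1 <= l by apply: (@le_trans _ _ l0) => //; rewrite /l0; lra.
have h3 : (eps1 * eps2 / 5)^-1 <= l by apply: (@le_trans _ _ l0) => //; rewrite /l0; lra.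
have h4 : 4 * r%:R + 2 <= C1 * l.
  by rewrite [leRHS]mulrC -ler_pdivrMr//; apply: (@le_trans _ _ l0) => //; rewrite /l0; lra.
have h5 : Cst <= C2 * l.
  by rewrite [leRHS]mulrC -ler_pdivrMr//; apply: (@le_trans _ _ l0) => //; rewrite /l0; lra.
clear ll0 p1 p2 p3 p4 p5 l0.
have l0 : 0 <= l by lra.
set w := y^-1; have w0 : 0 < w by rewrite invr_gt0.
have w_eps0 : w < eps0 by exact: inv_le_of_ln.
have w_eps2 : w < eps2 / 16 by apply: inv_le_of_ln => //; rewrite divr_gt0.
have w_eps1 : w < eps1 * eps2 / 5.
  by apply: inv_le_of_ln => //; rewrite divr_gt0// mulr_gt0.
have wE : w = expR (- l) by rewrite expRN lnK.
have wp (a : R) : w `^ a = expR (- (a * l)).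
  by rewrite powR_expR// /w lnV ?posrE// mulrN.
have [ce1 ce2 ceE] := ceil_itv_ge0 l0.
have LE : net_layers C1 w = C1 * (Num.ceil l)%:~R by rewrite /net_layers invrK.
have sE : net_sparsity C2 rho w = C2 * expR (rho * l) * l.
  by rewrite /net_sparsity wp mulNr opprK invrK.
have cE : net_precision C3 C4 w = (C3 + C4 * `|Num.ceil l|)%N.
  by rewrite /net_precision invrK.
have L0 : C1 * l <= net_layers C1 w by rewrite LE ler_wpM2l// ltW.
have L1 : net_layers C1 w <= 2 * C1 * l.
  by rewrite LE -mulrA mulrCA ler_wpM2l ?(ltW C10)//; lra.
have s0 : C2 * l <= net_sparsity C2 rho w.
  rewrite sE mulrAC ler_peMr//; first by rewrite mulr_ge0 ?(ltW C20).
  by rewrite -(@expR0 R) ler_expR mulr_ge0// ltW.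
have [cc ccE] : exists cc, cc = (C3' * net_precision C3 C4 w)%N by eexists.
have grid : 2^-1 ^+ cc <= w `^ kappa.
  rewrite wp; apply: (@grid_step_le kappa l _ C3') => //.
  rewrite ccE natrM ler_wpM2l// cE natrD natrM ceE.
  apply: (@le_trans _ _ (C4%:R * (Num.ceil l)%:~R)); last by rewrite lerDr.
  by apply: (le_trans ce1); rewrite ler_peMl ?ler1n//; exact: le_trans l0 ce1.
have w1 : w <= 1 by rewrite wE expR_le1 oppr_le0.
have wk : w `^ kappa <= w.
  rewrite -[leRHS](powRr1 (ltW w0)) ger_powR ?w0// /kappa; lra.
have grid1 := le_trans grid wk.
have [||||||||G0 NG0 exG0] := @bayes_approx R d Q f f_regr F beta B M eps1 eps2
    (net_layers C1 w) (net_sparsity C2 rho w) w r (net_precision C3 C4 w)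
    cc Qd Qb _ b0 B0 e20 M0.
- by move=> gamma Fg; apply: Fapp => //; rewrite w0.
- by apply: (@le_trans _ _ (C1 * l)) => //; rewrite mulr_ge0// ltW.
- by apply: (@le_trans _ _ (C2 * l)) => //; rewrite mulr_ge0// ltW.
- by rewrite ccE leq_pmull.
- exact: w0.
- exact: grid1.
- lra.
- have -> : 5 * (w / eps2) = 5 * w / eps2 by rewrite mulrA.
  rewrite ler_pdivrMr//; lra.
rewrite -ccE; exists G0.
  apply: net_regions_mono NG0 => //.
    rewrite mulrDl mul1r [in leLHS]mulrDr -addrA lerD2l; lra.
  have -> : (r%:R + rD + 1) * net_sparsity C2 rho w =
    r%:R * net_sparsity C2 rho w + rD * net_sparsity C2 rho w + net_sparsity C2 rho w by ring.
  rewrite !mulrDr -!addrA lerD2l lerD//; last by apply: (@le_trans _ _ (C2 * l)) => //; rewrite addrC.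
  apply: (@le_trans _ _ (rD * (C2 * l))); last by rewrite ler_wpM2l.
  have -> : rD * (C2 * l) = r%:R * (2 * C1 * l * (d + 1)%:R).
    by rewrite /rD; field; rewrite gt_eqF.
  by rewrite ler_wpM2l// ler_wpM2r.
apply: le_trans exG0 _; rewrite lee_fin -/Cb -!mulrA ler_wpM2l// ler_wpM2l//.
have wk1 : w `^ (1 + beta) = w `^ beta * w.
  by rewrite powRD ?(gt_eqF w0) ?implybT// powRr1 ?(ltW w0)// mulrC.
rewrite /kappa wk1 in grid; rewrite wk1 [leRHS]mulrDl; apply: lerD.
  by rewrite mulrA ler_wpM2l// mulr_ge0.
have -> : Cb * (w `^ beta * (4 * (5 * (w / eps2)))) =
  Cb * (20 / eps2) * (w `^ beta * w) by field; rewrite gt_eqF.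
exact: lexx.
Qed.

End class_approximation.

(** * Final estimates in powers of the rate *)

Section rate_bounds.
Variable R : realType.

(** Let [Y] be the entropy without its constant [CN]. The size of [K] lets the exponent beat
    [CN * Y] by a whole [Y], and [exp (- Y)] is below the required power since
    [Y >= ln y ^ 2 >= p * kappa * ln y]. The requirement on [K] does not involve [p]. *)
Lemma tail_le (kappa rho p K A CN m y : R) (n : nat) :
  1 <= kappa -> 0 < rho -> 1 <= K -> 0 < A -> 0 <= CN -> 16 * A * (CN + 1) <= K ->
  0 < y -> 1 <= ln y -> p * kappa <= ln y -> 0 <= m ->
  m <= expR (CN * (y `^ rho * ln y ^+ 2)) ->
  y `^ rho * ln y ^+ 2 <= n%:R * (y^-1) `^ (2 * kappa - 1) ->
  m * expR (- (n%:R * ((K * (y^-1) `^ kappa) `^ (2 - kappa^-1) / (16 * A)))) <=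
    (y^-1) `^ (p * kappa).
Proof.
move=> k1 r0 K1 A0 CN0 AK y0 l1 pl m0 mY Yn.
set Y := y `^ rho * _ in mY Yn *; set w := y^-1 in Yn *.
have w0 : 0 < w by rewrite invr_gt0.
have kap0 : 0 < kappa by lra.
have ki1 : kappa^-1 <= 1 by rewrite invf_le1.
have yr1 : 1 <= y `^ rho.
  by rewrite powR_expR// -[leLHS](@expR0 R) ler_expR mulr_ge0 ?(ltW r0)//; lra.
have Y0 : 0 <= Y by rewrite mulr_ge0 ?powR_ge0 ?sqr_ge0.
have YL : p * kappa * ln y <= Y.
  apply: (@le_trans _ _ (ln y ^+ 2)); last by rewrite ler_peMl// sqr_ge0.
  by rewrite expr2 ler_wpM2r//; lra.
have tE : (K * w `^ kappa) `^ (2 - kappa^-1) =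
    K `^ (2 - kappa^-1) * w `^ (2 * kappa - 1).
  rewrite powRM ?powR_ge0//; last by lra.
  by rewrite -powRrM; congr (_ * _ `^ _); rewrite mulrBr divff ?gt_eqF//; ring.
have KK : K <= K `^ (2 - kappa^-1) by apply: le1r_powR => //; lra.
have main : (CN + 1) * Y <= n%:R * ((K * w `^ kappa) `^ (2 - kappa^-1) / (16 * A)).
  rewrite tE mulrA ler_pdivlMr ?mulr_gt0//.
  apply: (@le_trans _ _ (K * Y)); first by rewrite mulrAC [_ * (16 * A)]mulrC ler_wpM2r.
  by rewrite [leRHS]mulrCA; apply: ler_pM => //; apply: le_trans K1.
apply: (@le_trans _ _ (expR (CN * Y) * expR (- ((CN + 1) * Y)))).
  by apply: ler_pM => //; rewrite ?expR_ge0// ler_expR lerN2.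
rewrite -expRD mulrDl mul1r opprD addNKr powR_expR// ler_expR.
by rewrite /w lnV ?posrE// mulrN lerN2.
Qed.

Lemma scaled_excess_le (kappa p K y : R) : 0 < y -> 0 <= K ->
  y `^ (p * kappa) * ((K * (y^-1) `^ kappa) `^ p + (y^-1) `^ (p * kappa)) = K `^ p + 1.
Proof.
move=> y0 K0; have yw : y `^ (p * kappa) * (y^-1) `^ (p * kappa) = 1.
  by rewrite -powRM ?invr_ge0 ?ltW// divff ?gt_eqF// powR1.
rewrite mulrDr yw powRM ?powR_ge0// -powRrM mulrCA [kappa * p]mulrC.
by rewrite yw mulr1.
Qed.

Lemma scaled_distance_le (kappa p K A y : R) : 1 <= kappa -> 1 <= p -> 0 < y -> 1 <= ln y ->
  0 <= K -> 0 <= A ->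
  y `^ p * ((A * (K * (y^-1) `^ kappa) `^ kappa^-1) `^ p + (y^-1) `^ (p * kappa)) <=
    (A * K `^ kappa^-1) `^ p + 1.
Proof.
move=> k1 p1 y0 l1 K0 A0.
have w0 : 0 < y^-1 by rewrite invr_gt0.
have yw : y `^ p * (y^-1) `^ p = 1.
  by rewrite -powRM ?(ltW y0) ?(ltW w0)// divff ?gt_eqF// powR1.
have -> : A * (K * (y^-1) `^ kappa) `^ kappa^-1 = A * K `^ kappa^-1 * y^-1.
  rewrite powRM ?powR_ge0// -powRrM divff ?powRr1 ?(ltW w0) ?mulrA// gt_eqF//; lra.
rewrite mulrDr; apply: lerD.
  rewrite (powRM _ (mulr_ge0 A0 (powR_ge0 _ _)) (ltW w0)) mulrCA yw mulr1.
  exact: lexx.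
rewrite -[leRHS]yw ler_wpM2l ?powR_ge0// ger_powR//.
  rewrite w0 invf_le1//= -[leLHS]expR0 -[leRHS]lnK ?posrE// ler_expR; lra.
by rewrite ler_peMr//; lra.
Qed.

(** The summand 1 is slack: it makes the constant at least 1, as the choice of [lam] demands. *)
Lemma margin_bound (v D c1 kappa : R) : 0 <= v -> 0 <= D -> 0 < c1 -> 1 <= kappa ->
  c1 * v `^ kappa <= D -> v <= (1 + (c1^-1) `^ kappa^-1) * D `^ kappa^-1.
Proof.
move=> v0 D0 c0 k1 cvD.
have kap0 : 0 < kappa by lra.
have h : v `^ kappa <= c1^-1 * D by rewrite ler_pdivlMl.
have -> : v = (v `^ kappa) `^ kappa^-1 by rewrite -powRrM divff ?powRr1 ?gt_eqF.
apply: (@le_trans _ _ ((c1^-1 * D) `^ kappa^-1)).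
  by rewrite ge0_ler_powR ?nnegrE ?powR_ge0 ?invr_ge0 ?(ltW kap0)// mulr_ge0// invr_ge0 ltW.
rewrite powRM ?invr_ge0 ?(ltW c0)// ler_wpM2r ?powR_ge0// lerDr//.
Qed.

End rate_bounds.

Unset Implicit Arguments.

Theorem theorem3p5 (R : realType) (beta B rho : R) (d : nat)
  (beta_ge0 : 0 <= beta) (B_gt0 : 0 < B) (rho_gt0 : 0 < rho) (d_ge2 : (2 <= d)%N)
  (F : set (euclid R d.-1 -> R))
  (eps0 C1 C2 : R) (C3 C4 : nat)
  (eps0_gt0 : 0 < eps0) (C1_gt0 : 0 < C1) (C2_gt0 : 0 < C2)
  (C3_gt0 : (0 < C3)%N) (C4_gt0 : (0 < C4)%N)
  (F_approx : forall gamma, F gamma -> forall eps : R, 0 < eps < eps0 ->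
     exists2 Phi : relu_net R 1 d.-1,
       bounded_net (net_layers C1 eps) (net_sparsity C2 rho eps)
         (net_precision C3 C4 eps) Phi &
       forall x, unit_cube x -> `|net_fun Phi x - gamma x| <= eps)
  (frakQ : set (probability (sample R d) R))
  (f : probability (sample R d) R -> euclid R d -> R)
  (Q_supp : forall Q, frakQ Q -> Q (unit_cube `*` [set: bool]) = 1%E)
  (f_regr : forall Q, frakQ Q -> is_regression_fun Q (f Q))
  (M : R) (M_gt1 : 1 < M)
  (Q_density : forall Q, frakQ Q -> has_density_bounded_by Q M)
  (r : nat) (eps1 eps2 : R) (eps1_gt0 : 0 < eps1) (eps2_gt0 : 0 < eps2)
  (Q_bayes : forall Q, frakQ Q ->
     piecewise_class F (f Q) beta B eps1 eps2 r (bayes_rule (f Q)))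
  (c1 : R) (c1_gt0 : 0 < c1)
  (Q_margin : forall Q, frakQ Q -> forall G, all_net_regions d G ->
     (c1%:E * sym_diff_dist Q G (bayes_rule (f Q)) `^ (1 + beta)
        <= excess_risk Q (f Q) G (bayes_rule (f Q)))%E) :
  let kappa : R := 1 + beta in
  let tau : nat -> R := rate kappa rho in
  exists (C1' C2' : R) (C3' : nat),
    [/\ 0 < C1', 0 < C2', (0 < C3')%N &
    let N (n : nat) : set (set (euclid R d)) :=
      net_regions d (C1' * net_layers C1 (tau n)^-1)
        (C2' * net_sparsity C2 rho (tau n)^-1)
        (C3' * net_precision C3 C4 (tau n)^-1)%N in
    forall p : R, 1 <= p ->
    forall Ghat : estimator R d, empirical_risk_minimizer N Ghat ->
      (limn_esup (fun n => ereal_sup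
         [set ((tau n) `^ (p * kappa))%:E *
              expectation_iid Q (fun z : n.-tuple (sample R d) =>
                excess_risk Q (f Q) (Ghat n z) (bayes_rule (f Q)) `^ p)
         | Q in frakQ]) < +oo)%E /\
      (limn_esup (fun n => ereal_sup
         [set ((tau n) `^ p)%:E *
              expectation_iid Q (fun z : n.-tuple (sample R d) =>
                sym_diff_dist Q (Ghat n z) (bayes_rule (f Q)) `^ p)
         | Q in frakQ]) < +oo)%E].
Proof.
move=> kappa tau.
have k1 : 1 <= kappa by rewrite /kappa lerDl.
have kap0 : 0 < kappa by lra.
have M0 : 0 <= M by lra.
have [C1' [C2' [C3' [C1'0 C2'0 C3'0 [K1 [l0 [K10 approx]]]]]]] :=
  @class_approx R d F beta B rho M eps0 eps1 eps2 C1 C2 r C3 C4 beta_ge0 B_gt0 rho_gt0 M0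
    eps0_gt0 eps1_gt0 eps2_gt0 C1_gt0 C2_gt0 C4_gt0 F_approx.
have [CN CN0 count] :=
  @class_count R d C1 C2 rho C1' C2' C3 C4 C3' C1_gt0 C2_gt0 rho_gt0 C1'0 C2'0.
exists C1', C2', C3'; split => // N p p1 Ghat erm.
have p0 : 0 < p by lra.
(* [A] is twice [A2] because two sets are compared through the Bayes rule. *)
pose A2 := 1 + (c1^-1) `^ kappa^-1; pose A := 2 * A2.
have A21 : 1 <= A2 by rewrite /A2 lerDl powR_ge0.
have A1 : 1 <= A by rewrite /A; lra.
have A0 : 0 < A by lra.
have AA2 : A / 2 = A2 by rewrite /A; field.
(* The 1 ensures [K >= 1], [2 * K1] puts twice the excess risk of the approximation below
   [K * eps ^ kappa], and the rest outweighs the entropy. *)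
pose K := 1 + 2 * K1 + 16 * A * (CN + 1).
have ACN : 0 <= 16 * A * (CN + 1) by rewrite mulr_ge0// ?addr_ge0// mulr_ge0// ltW.
have K1' : 1 <= K by rewrite /K; lra.
have K0 : 0 <= K by lra.
have marg n Q G : frakQ Q -> N n G -> exists v : R,
    [/\ sym_diff_dist Q G (bayes_rule (f Q)) = v%:E, 0 <= v <= 1 &
        v <= A2 * real_excess Q (f Q) G `^ kappa^-1].
  move=> fQ NG; have [mG _] := net_regions_measurable NG; have f_reg := f_regr Q fQ.
  have mGG : measurable (G `+` bayes_rule (f Q)).
    by apply: measurableU; apply: measurableD => //; exact: (measurable_bayes f_reg).
  have /andP[D0 _] := real_excess_itv f_reg mG.
  have h := Q_margin Q fQ G (net_regions_all NG); rewrite (real_excessE f_reg mG) in h.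
  have v1 : (sym_diff_dist Q G (bayes_rule (f Q)) <= 1)%E.
    exact: (probability_le1 (marginal Q) mGG).
  have v0 : (0 <= sym_diff_dist Q G (bayes_rule (f Q)))%E.
    exact: (measure_ge0 (marginal Q) (G `+` bayes_rule (f Q))).
  move: h v0 v1; case: (sym_diff_dist _ _ _) => [v| |]//.
  rewrite poweR_EFin -EFinM !lee_fin => h v0 v1.
  by exists v; split => //; [rewrite v0|exact: margin_bound h].
(* Common to both claims, with [Psi] and its bound [a] left open. *)
pose good n := [/\ 0 < tau n, 1 <= ln (tau n) &
    forall Q, frakQ Q -> forall (Psi : set (euclid R d) -> \bar R) (a : R), 0 <= a ->
    (forall G, N n G -> 0 <= Psi G <= 1)%E ->
    (forall G, N n G -> real_excess Q (f Q) G <= K * (tau n)^-1 `^ kappa ->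
       (Psi G <= a%:E)%E) ->
    (expectation_iid Q (fun z => Psi (Ghat n z)) <=
      (a + (tau n)^-1 `^ (p * kappa))%:E)%E].
have core : \forall n \near \oo, good n.
  near=> n; rewrite /good.
  (* [p] decides how large [n] has to be; the class of networks was fixed before [p]. *)
  have [y0 ly Yn] : [/\ 0 < tau n,
      Num.max l0 (Num.max 1 (p * kappa)) <= ln (tau n) &
      tau n `^ rho * ln (tau n) ^+ 2 <= n%:R * (tau n)^-1 `^ (2 * kappa - 1)].
    by near: n; exact: rate_facts.
  have [ermn _] : (forall z, N n (Ghat n z) /\
      forall G, N n G -> empirical_risk z (Ghat n z) <= empirical_risk z G) /\
      (forall G, measurable [set z | Ghat n z = G]) by near: n.
  move: ly; rewrite !ge_max => /and3P[ly0 ly1 lyp].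
  split => // Q fQ Psi a a0 Psi01 Psia.
  have f_reg := f_regr Q fQ.
  have [G0 NG0 exG0] := approx _ y0 ly0 Q (f Q) f_reg (Q_density Q fQ) (Q_bayes Q fQ).
  have [T [dec [decN cardT]]] := count _ y0 ly1.
  have mN G : N n G -> measurable G /\ G `<=` unit_cube by exact: net_regions_measurable.
  set t := K * (tau n)^-1 `^ kappa in Psia *.
  have wk0 : 0 < (tau n)^-1 `^ kappa by rewrite powR_gt0// invr_gt0.
  have t0 : 0 < t by rewrite mulr_gt0//; lra.
  have margN G : N n G -> (sym_diff_dist Q G (bayes_rule (f Q)) <=
      (A / 2 * real_excess Q (f Q) G `^ kappa^-1)%:E)%E.
    by move=> NG; have [v [-> _ vD]] := marg _ _ _ fQ NG; rewrite lee_fin AA2.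
  have G0t : 2 * real_excess Q (f Q) G0 <= t.
    have [mG0 _] := mN _ NG0.
    move: exG0; rewrite (real_excessE f_reg mG0) lee_fin -/kappa => h.
    apply: (@le_trans _ _ (2 * K1 * (tau n)^-1 `^ kappa)); first by rewrite -mulrA ler_wpM2l.
    by rewrite /t ler_wpM2r ?(ltW wk0)// /K; lra.
  apply: le_trans (erm_expectation f_reg decN mN ermn k1 A1 t0 a0 margN NG0 G0t Psi01 Psia) _.
  rewrite lee_fin lerD2l; apply: (@tail_le R kappa rho p K A CN) => //.
  by rewrite /K; lra.
split.
  apply: (@limn_esup_lty _ _ (K `^ p + 1)); near=> n.
  have [y0 l1 bound] : good n by near: n.
  apply: ge_ereal_sup => _ [Q fQ <-].
  rewrite -(scaled_excess_le kappa p y0 K0) EFinM lee_wpmul2l ?lee_fin ?powR_ge0//.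
  apply: (bound _ fQ (fun G => excess_risk Q (f Q) G (bayes_rule (f Q)) `^ p)%E).
  - exact: powR_ge0.
  - move=> G /net_regions_measurable[mG _].
    rewrite (real_excessE (f_regr Q fQ) mG) poweR_EFin !lee_fin powR_ge0 /=.
    have /andP[D0 D1] := real_excess_itv (f_regr Q fQ) mG.
    have one : 1 `^ p = 1 :> R by rewrite powR1.
    by rewrite -[leRHS]one ge0_ler_powR ?nnegrE// ltW.
  - move=> G /net_regions_measurable[mG _] Dt.
    have /andP[D0 D1] := real_excess_itv (f_regr Q fQ) mG.
    rewrite (real_excessE (f_regr Q fQ) mG) poweR_EFin lee_fin.
    by rewrite ge0_ler_powR ?nnegrE ?(ltW p0)// (le_trans D0 Dt).
apply: (@limn_esup_lty _ _ ((A2 * K `^ kappa^-1) `^ p + 1)); near=> n.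
have [y0 l1 bound] : good n by near: n.
apply: ge_ereal_sup => _ [Q fQ <-].
have A20 : 0 <= A2 by lra.
apply: (@le_trans _ _ ((tau n `^ p)%:E *
   ((A2 * (K * (tau n)^-1 `^ kappa) `^ kappa^-1) `^ p + (tau n)^-1 `^ (p * kappa))%:E)%E);
  last by rewrite -EFinM lee_fin; exact: scaled_distance_le.
rewrite lee_wpmul2l ?lee_fin ?powR_ge0//.
apply: (bound _ fQ (fun G => sym_diff_dist Q G (bayes_rule (f Q)) `^ p)%E).
- exact: powR_ge0.
- move=> G NG; have [v [-> /andP[v0 v1] _]] := marg _ _ _ fQ NG.
  rewrite poweR_EFin !lee_fin powR_ge0 /=.
  have one : 1 `^ p = 1 :> R by rewrite powR1.
  by rewrite -[leRHS]one ge0_ler_powR ?nnegrE// ltW.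
(* The margin condition turns an excess risk of order [eps ^ kappa] into a distance of order
   [eps]. *)
- move=> G NG Dt; have [v [-> /andP[v0 v1] vD]] := marg _ _ _ fQ NG.
  have [mG _] := net_regions_measurable NG.
  have /andP[D0 _] := real_excess_itv (f_regr Q fQ) mG.
  rewrite poweR_EFin lee_fin ge0_ler_powR ?nnegrE ?(ltW p0)//.
    by rewrite mulr_ge0// powR_ge0.
  apply: le_trans vD _; rewrite ler_wpM2l// ge0_ler_powR ?nnegrE ?invr_ge0 ?(ltW kap0)//.
  exact: le_trans D0 Dt.
Unshelve. all: by end_near. Qed.
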